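(* Let $p\geq3$ be a prime and let $f\colon \mathbb{Z}_p\to\mathbb{C}$ be a function such that $|f(x)|\geq 1$ for all $x\in S:=\{x\in\mathbb{Z}_p: f(x)\neq 0\}$. Set $M:=\max_{x\in\mathbb{Z}_p}|f(x)|$, and suppose that $\exp\left((\log p/\log\log p)^{1/3}\right)\leq|S|\leq p/3$. Then $$\|\hat f\|_1\geq M$$ and $$\|\hat f\|_1\gg (\log(p/|S|))^{1/3}(\log\log(p/|S|))^{-1-o(1)},\qquad p/|S|\to\infty.$$ The last bound means: there exist absolute constants $c>0$ and $t_0\geq 3$ and a function $\omega\colon[t_0,\infty)\to\mathbb{R}$ with $\omega(t)\to0$ as $t\to\infty$ such that, for all primes $p\geq3$ and all functions $f\colon\mathbb{Z}_p\to\mathbb{C}$ such that $|f(x)|\geq1$ for all $x\in S:=\{x\in\mathbb{Z}_p: f(x)\neq 0\}$ and $\exp\left((\log p/\log\log p)^{1/3}\right)\leq|S|\leq p/3$, with $t:=p/|S|\geq t_0$, $$\|\hat f\|_1\geq c\,(\log t)^{1/3}(\log\log t)^{-1-\omega(t)}.$$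
   Context: $\mathbb{Z}_p=\mathbb{Z}/p\mathbb{Z}$, and $\log$ is the natural logarithm. For $f\colon\mathbb{Z}_p\to\mathbb{C}$ the Fourier transform is $\hat f(\xi)=p^{-1}\sum_{x\in\mathbb{Z}_p}f(x)e^{-2\pi i\xi x/p}$ for $\xi\in\mathbb{Z}_p$, and the Wiener norm of $f$ is $\|\hat f\|_1=\sum_{\xi\in\mathbb{Z}_p}|\hat f(\xi)|$. *)

(* Defs.v *)
From HB Require Import structures.
From mathcomp Require Import all_boot all_order all_algebra.
From mathcomp Require Import all_classical all_reals all_analysis.
From mathcomp Require Import complex.

Set Implicit Arguments.
Unset Strict Implicit.
Unset Printing Implicit Defensive.

Import Order.TTheory GRing.Theory Num.Theory.
Import numFieldNormedType.Exports.

Local Open Scope ring_scope.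
Local Open Scope complex_scope.

(* [Normc.normc] is the [R]-valued modulus; the norm [`|z|] of [z : R[i]] lives
   in [R[i]]. *)
Notation cabs := ComplexField.Normc.normc.

(* e^(i theta) *)
Definition expi (R : realType) (theta : R) : R[i] :=
  cos theta +i* sin theta.

(* Z/pZ is ['F_p], which is the integers modulo p only when p is prime.
   In the exponent, xi and x are represented by their residues in [0, p). *)
Definition fourier (R : realType) (p : nat) (f : 'F_p -> R[i]) (xi : 'F_p) :
    R[i] :=
  (p%:R)^-1 *
  \sum_(x : 'F_p)
     f x * expi (- (2 * pi * (val xi)%:R * (val x)%:R / p%:R)).

Definition wiener_norm (R : realType) (p : nat) (f : 'F_p -> R[i]) : R :=
  \sum_(xi : 'F_p) cabs (fourier f xi).

Definition supp (R : realType) (p : nat) (f : 'F_p -> R[i]) : {set 'F_p} :=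
  [set x : 'F_p | f x != 0]%SET.

(* As moduli are nonnegative, the default value 0 does not affect the maximum. *)
Definition max_abs (R : realType) (p : nat) (f : 'F_p -> R[i]) : R :=
  \big[Num.max/0]_(x : 'F_p) cabs (f x).

Definition admissible (R : realType) (p : nat) (f : 'F_p -> R[i]) : Prop :=
  [/\ forall x : 'F_p, x \in supp f -> 1 <= cabs (f x),
      expR ((ln p%:R / ln (ln p%:R)) `^ (1 / 3)) <= (#|supp f|%:R : R)
    & (#|supp f|%:R : R) <= p%:R / 3].

(* Main.v *)
Require Import Defs.
From HB Require Import structures.
From mathcomp Require Import all_boot all_order all_algebra.
From mathcomp Require Import all_classical all_reals all_analysis.
From mathcomp Require Import complex.
From mathcomp Require Import zify ring lra.

Set Implicit Arguments.
Unset Strict Implicit.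
Unset Printing Implicit Defensive.

Import Order.TTheory GRing.Theory Num.Theory.
Import numFieldNormedType.Exports.

Local Open Scope ring_scope.

(** The first inequality holds because the values of [f] are sums of its Fourier coefficients
    times unimodular numbers.  The second one is derived from a statement about powers of two,
    [wiener_lower_bound]: if [|f| >= 1] on its support [S], if [2 ^ (C0 * 2 ^ e) <= |S|], and if
    [p / |S|] is at least two to the power [C0 * 8 ^ e * (e * (log e + 1)) ^ 3], then the Wiener
    norm of [f] exceeds [2 ^ e].  Choosing [e] as large as possible gives the theorem, with the
    factor [1 / ln (ln (ln t))] absorbed by the exponent [omega].

    So suppose that the Wiener norm is at most [2 ^ e].  There are three ideas.

    First, [S] is additively structured.  A positive proportion of the pairs of [S] have their
    difference in a small symmetric set ([correlation_graph]), so by the theorem of Balog,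
    Szemeredi and Gowers ([bsg]) a large subset [A] of [S] has few differences.  Iterating the
    lemma of Croot and Sisask ([croot_sisask]) in such a way that the number of summands
    doubles at each stage, one finds a translate of a large set [Y] inside [A] whose sumsets
    grow polynomially ([bohr_structure]).  If [p] is large enough compared with [S], such
    growth has to slow down at some point, and then some nontrivial character is nearly
    constant on [Y] ([concentration]).  As the Wiener norm is invariant under affine maps,
    half of [Y] may be assumed to lie in a short interval around zero.

    Second, among roughly [8 ^ e] annuli around this interval, of radii growing by factors of
    three, at least one contains few points of [S] ([sparse_annulus]).  For otherwise one could
    thin out the support by multiplying [f] by a triangle function composed with a random
    affine map, keeping a point of every annulus.  The points obtained form a lacunary
    sequence on which [f] is large, and Riesz products bound the length of such a sequence by
    the square of the Wiener norm times the logarithm of the size of the support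
    ([riesz_chain]).

    Third, an interval with many points of [S] that is followed by an annulus with few of them
    forces a large Wiener norm ([littlewood_contrast]).  This is the method by which McGehee,
    Pigno and Smith proved Littlewood's conjecture: blocks of coefficients of geometrically
    decreasing size are combined into one bounded polynomial with the help of multipliers that
    make room for each new block ([multiplier], [test_polynomial]).  The pairing of [f] with
    this polynomial is of the order of the sum of the reciprocals of the ranks of the points of
    [S], counted from the outside; the few points in the annulus occupy the first ranks, and
    the points of the interval contribute the logarithm of the ratio of the two numbers.  The
    parameters are such that this logarithm exceeds a large multiple of [2 ^ e], which is the
    contradiction ([small_or_far]). *)


(** * Sumsets in a finite abelian group *)

Section Counting.
Import mathcomp.boot.fintype mathcomp.boot.finset.

Lemma sqr_sum_leq (T : finType) (S : {set T}) (a : T -> nat) :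
  ((\sum_(z in S) a z) ^ 2 <= #|S| * \sum_(z in S) a z ^ 2)%N.
Proof.
have h : (\sum_(x in S) \sum_(y in S) 2 * (a x * a y) <=
          \sum_(x in S) \sum_(y in S) (a x ^ 2 + a y ^ 2))%N.
  by apply: leq_sum => x _; apply: leq_sum => y _; apply: nat_Cauchy.
suff [E1 E2] : (\sum_(x in S) \sum_(y in S) 2 * (a x * a y) = 2 * (\sum_(z in S) a z) ^ 2)%N /\
  (\sum_(x in S) \sum_(y in S) (a x ^ 2 + a y ^ 2) = 2 * (#|S| * \sum_(z in S) a z ^ 2))%N.
  by move: h; rewrite E1 E2 leq_pmul2l.
split.
  rewrite -mulnn big_distrlr /= big_distrr /=; apply: eq_bigr => x _.
  by rewrite big_distrr.
under eq_bigr => x _ do rewrite big_split /= sum_nat_const.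
by rewrite big_split /= -big_distrr /= sum_nat_const mul2n addnn.
Qed.

Lemma double_count (T U : finType) (A : {set T}) (B : {set U}) (P : T -> U -> bool) :
  (\sum_(a in A) #|[set b in B | P a b]| = \sum_(b in B) #|[set a in A | P a b]|)%N.
Proof.
under eq_bigr => a _ do rewrite -sum1_card big_set /= big_mkcondr /=.
rewrite exchange_big /=; apply: eq_bigr => b _.
by rewrite -sum1_card big_set /= big_mkcondr.
Qed.

End Counting.

Section Sumsets.
Import mathcomp.boot.fintype mathcomp.boot.finset.
Variable G : finZmodType.
Implicit Types (A B C D E F P S U V W X Y Z : {set G}) (x y z : G) (s : seq G).

Definition sumset A B : {set G} := [set x + y | x in A, y in B].
Definition oppset A : {set G} := [set - x | x in A].
Definition diffset A B : {set G} := sumset A (oppset B).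
Definition nsum n A : {set G} := iter n (sumset A) [set 0].

Arguments nsum : simpl never.

Lemma sumsetP A B z :
  reflect (exists x y, [/\ x \in A, y \in B & z = x + y]) (z \in sumset A B).
Proof.
apply: (iffP imset2P) => [[x y xA yB ->]|[x [y [xA yB ->]]]]; first by exists x, y.
by exists x y.
Qed.

Lemma mem_sumset A B x y : x \in A -> y \in B -> x + y \in sumset A B.
Proof. by move=> xA yB; apply/sumsetP; exists x, y. Qed.

Lemma mem_oppset A x : (x \in oppset A) = (- x \in A).
Proof.
apply/imsetP/idP => [[y yA ->]|xA]; first by rewrite opprK.
by exists (- x); rewrite ?opprK.
Qed.

Lemma mem_diffset A B x y : x \in A -> y \in B -> x - y \in diffset A B.
Proof. by move=> xA yB; apply: mem_sumset; rewrite // mem_oppset opprK. Qed.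

Lemma diffsetP A B z :
  reflect (exists x y, [/\ x \in A, y \in B & z = x - y]) (z \in diffset A B).
Proof.
apply: (iffP (sumsetP _ _ _)) => [[x [y [xA yB ->]]]|[x [y [xA yB ->]]]].
  by exists x, (- y); rewrite opprK -mem_oppset.
by exists x, (- y); rewrite mem_oppset opprK.
Qed.

Lemma sumsetC A B : sumset A B = sumset B A.
Proof.
by apply/setP=> z; apply/sumsetP/sumsetP => -[x [y [? ? ->]]]; exists y, x; rewrite addrC.
Qed.

Lemma sumsetA A B C : sumset A (sumset B C) = sumset (sumset A B) C.
Proof.
apply/setP=> z; apply/sumsetP/sumsetP => [[x [w [xA /sumsetP[y [u [yB uC ->]]] ->]]]|].
  by exists (x + y), u; rewrite addrA mem_sumset.
move=> [w [u [/sumsetP[x [y [xA yB ->]]] uC ->]]].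
by exists x, (y + u); rewrite addrA mem_sumset.
Qed.

Lemma sumset0 A : sumset A [set 0] = A.
Proof.
apply/setP=> z; apply/sumsetP/idP => [[x [y [xA /set1P -> ->]]]|zA]; first by rewrite addr0.
by exists z, 0; rewrite set11 addr0.
Qed.

Lemma sum0set A : sumset [set 0] A = A.
Proof. by rewrite sumsetC sumset0. Qed.

Lemma sumsetAC A B C : sumset (sumset A B) C = sumset (sumset A C) B.
Proof. by rewrite -sumsetA (sumsetC B) sumsetA. Qed.

Lemma sumsetACA A B C D :
  sumset (sumset A B) (sumset C D) = sumset (sumset A C) (sumset B D).
Proof. by rewrite sumsetA (sumsetAC A) -sumsetA. Qed.

Lemma sumsetSS A B C D : A \subset C -> B \subset D -> sumset A B \subset sumset C D.
Proof.
move=> /subsetP AC /subsetP BD; apply/subsetP => z /sumsetP[x [y [xA yB ->]]].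
by apply: mem_sumset; [apply: AC|apply: BD].
Qed.

Lemma oppsetS A B : A \subset B -> oppset A \subset oppset B.
Proof. by move=> /subsetP AB; apply/subsetP => z; rewrite !mem_oppset; apply: AB. Qed.

Lemma oppsetK A : oppset (oppset A) = A.
Proof. by apply/setP=> z; rewrite !mem_oppset opprK. Qed.

Lemma oppset_sum A B : oppset (sumset A B) = sumset (oppset A) (oppset B).
Proof.
apply/setP=> z; rewrite mem_oppset; apply/sumsetP/sumsetP => -[x [y [xA yB]]].
  by move/(canRL opprK) => ->; exists (- x), (- y); rewrite !mem_oppset !opprK opprD.
by move=> ->; exists (- x), (- y); rewrite -!mem_oppset opprD.
Qed.

Lemma oppset0 : oppset [set 0] = [set 0].
Proof. by apply/setP=> z; rewrite mem_oppset !inE oppr_eq0. Qed.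

Lemma card_oppset A : #|oppset A| = #|A|.
Proof. exact/card_imset/oppr_inj. Qed.

Lemma sumset_empty A : sumset set0 A = set0.
Proof. by apply/setP=> z; apply/sumsetP; rewrite inE => -[x [y []]]; rewrite inE. Qed.

Lemma sumsetUl A B C : sumset (A :|: B) C = sumset A C :|: sumset B C.
Proof.
apply/setP=> z; rewrite inE; apply/sumsetP/orP => [[x [y [/setUP[xA|xB] yC ->]]]|].
- by left; apply: mem_sumset.
- by right; apply: mem_sumset.
by case=> /sumsetP[x [y [xA yC ->]]]; exists x, y; rewrite inE xA ?orbT.
Qed.

Lemma card_sumset A B : (#|sumset A B| <= #|A| * #|B|)%N.
Proof.
rewrite /sumset curry_imset2X; apply: leq_trans (leq_imset_card _ _) _.
by rewrite cardsX.
Qed.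

Lemma card_shift x A : #|sumset [set x] A| = #|A|.
Proof.
suff -> : sumset [set x] A = [set x + y | y in A] by apply/card_imset/addrI.
by apply/setP=> z; apply/sumsetP/imsetP => [[u [y [/set1P -> yA ->]]]|[y yA ->]];
  [exists y|exists x, y; rewrite set11].
Qed.

Lemma card_sumset_geL A B : B != set0 -> (#|A| <= #|sumset A B|)%N.
Proof.
case/set0Pn=> y yB; rewrite -(card_shift y A) sumsetC.
by apply: subset_leq_card; apply: sumsetSS => //; rewrite sub1set.
Qed.

Lemma sumset_neq0 A B : A != set0 -> B != set0 -> sumset A B != set0.
Proof.
by move=> /set0Pn[x xA] /set0Pn[y yB]; apply/set0Pn; exists (x + y); apply: mem_sumset.
Qed.

Lemma nsum0 A : nsum 0 A = [set 0]. Proof. by []. Qed.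
Lemma nsumS n A : nsum n.+1 A = sumset A (nsum n A). Proof. by []. Qed.
Lemma nsum1 A : nsum 1 A = A. Proof. by rewrite nsumS nsum0 sumset0. Qed.

Lemma nsumD m n A : nsum (m + n) A = sumset (nsum m A) (nsum n A).
Proof.
by elim: m => [|m IH]; rewrite ?add0n ?nsum0 ?sum0set // addSn !nsumS IH sumsetA.
Qed.

Lemma nsum_sum n A B : nsum n (sumset A B) = sumset (nsum n A) (nsum n B).
Proof. by elim: n => [|n IH]; rewrite ?nsum0 ?sumset0 // !nsumS IH sumsetACA. Qed.

Lemma nsum_opp n A : nsum n (oppset A) = oppset (nsum n A).
Proof. by elim: n => [|n IH]; rewrite ?nsum0 ?oppset0 // !nsumS IH oppset_sum. Qed.

Lemma nsum_diff n A : nsum n (diffset A A) = diffset (nsum n A) (nsum n A).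
Proof. by rewrite /diffset nsum_sum nsum_opp. Qed.

Lemma nsumSS n A B : A \subset B -> nsum n A \subset nsum n B.
Proof. by move=> AB; elim: n => // n IH; rewrite !nsumS sumsetSS. Qed.

Lemma nsum_neq0 n A : A != set0 -> nsum n A != set0.
Proof.
move=> A0; elim: n => [|n IH]; first by apply/set0Pn; exists 0; rewrite set11.
by rewrite nsumS sumset_neq0.
Qed.

Lemma subset_sumset0 A B : 0 \in B -> A \subset sumset A B.
Proof. by move=> B0; rewrite -{1}(sumset0 A) sumsetSS // sub1set. Qed.

Lemma mem0_nsum n A : 0 \in A -> 0 \in nsum n A.
Proof.
move=> A0; elim: n => [|n IH]; first by rewrite set11.
by rewrite nsumS -[0]addr0 mem_sumset.
Qed.

Lemma nsum_mono m n A : 0 \in A -> (m <= n)%N -> nsum m A \subset nsum n A.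
Proof.
by move=> A0 /subnKC <-; rewrite nsumD subset_sumset0 // mem0_nsum.
Qed.

Lemma mem0_diffset A : A != set0 -> 0 \in diffset A A.
Proof. by case/set0Pn => x xA; rewrite -(subrr x) mem_diffset. Qed.

Lemma oppset_diff A B : oppset (diffset A B) = diffset B A.
Proof. by rewrite /diffset oppset_sum oppsetK sumsetC. Qed.

Lemma diffsetSS A B C D : A \subset C -> B \subset D -> diffset A B \subset diffset C D.
Proof. by move=> AC BD; apply: sumsetSS => //; apply: oppsetS. Qed.

(** Fix for every difference [d] a representation [d = v - w].  The map sending [(u, d)] to
    [(u + v, u + w)] is injective, since [d] is the difference of the two coordinates. *)
Lemma ruzsa_triangle U V W :
  (#|U| * #|diffset V W| <= #|sumset U V| * #|sumset U W|)%N.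
Proof.
have [g gP] : exists g : G -> G * G, forall d, d \in diffset V W ->
    [/\ (g d).1 \in V, (g d).2 \in W & d = (g d).1 - (g d).2].
  apply/(@fin_all_exists _ _ (fun d q => d \in diffset V W ->
    [/\ q.1 \in V, q.2 \in W & d = q.1 - q.2])) => d.
  have [/diffsetP[x [y [? ? ?]]]|dn] := boolP (d \in diffset V W); first by exists (x, y).
  by exists (0, 0) => dV; case/negP: dn.
rewrite -!cardsX -(@card_in_imset _ _ (fun q : G * G => (q.1 + (g q.2).1, q.1 + (g q.2).2))).
  apply: subset_leq_card; apply/subsetP => _ /imsetP[[u d] /setXP[uU dV] ->].
  by have [? ? _] := gP _ dV; apply/setXP; split; apply: mem_sumset.
move=> [u d] [u' d'] /setXP[uU dV] /setXP[u'U d'V] /= [E1 E2].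
have [_ _ Ed] := gP _ dV; have [_ _ Ed'] := gP _ d'V.
have shift (a b c : G) : a - b = (c + a) - (c + b) by rewrite opprD addrACA subrr add0r.
have dd : d = d' by rewrite Ed Ed' (shift _ _ u) E1 E2 -shift.
by move: E1; rewrite dd => /addIr ->.
Qed.

(** Petridis' argument, by induction on [C].  Adding an element [c] to [C'] contributes to
    [C' + X] exactly the translate by [c] of the complement of [Z], the part of [X] whose
    translate is already covered; in [C' + X + Y] all of [c + Z + Y] is covered, and the
    minimality of the ratio of [X] makes this part large. *)
Lemma petridis X Y C :
  (forall Z, Z != set0 -> Z \subset X ->
     (#|sumset X Y| * #|Z| <= #|sumset Z Y| * #|X|)%N) ->
  (#|sumset C (sumset X Y)| * #|X| <= #|sumset X Y| * #|sumset C X|)%N.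
Proof.
move=> Xmin; elim: {C}_.+1 {-2}C (ltnSn #|C|) => // n IHn C Cn.
have [->|/set0Pn[c cC]] := eqVneq C set0.
  by rewrite !sumset_empty !cards0 muln0.
have {}IH := IHn (C :\ c); move: IH; set C' := C :\ c => IH.
have {}IH : (#|sumset C' (sumset X Y)| * #|X| <= #|sumset X Y| * #|sumset C' X|)%N.
  by apply: IH; move: Cn; rewrite (cardsD1 c) cC.
have CE : C = c |: C' by rewrite setD1K.
have sumU A : sumset C A = sumset C' A :|: sumset [set c] A.
  by rewrite CE setUC sumsetUl.
pose Z := [set x in X | c + x \in sumset C' X].
have ZX : Z \subset X by apply/subsetP => x; rewrite inE => /andP[].
have cardCX : (#|sumset C X| = #|sumset C' X| + (#|X| - #|Z|))%N.
  rewrite sumU cardsU card_shift -addnBA; last first.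
    by rewrite -(card_shift c X) subset_leq_card // subsetIr.
  congr (_ + (_ - _))%N; rewrite -(card_shift c Z); congr #|pred_of_set _|.
  apply/setP => u; rewrite inE andbC; apply/andP/sumsetP.
    move=> [/sumsetP[c' [x [/set1P -> xX ->]]] h].
    by exists c, x; rewrite set11 inE xX.
  move=> [c' [x [/set1P -> + ->]]]; rewrite inE => /andP[xX h].
  by rewrite h mem_sumset ?set11.
have cardCXY : (#|sumset C (sumset X Y)| + #|sumset Z Y| <=
                #|sumset C' (sumset X Y)| + #|sumset X Y|)%N.
  rewrite sumU cardsU card_shift.
  have h1 : (#|sumset Z Y| <= #|sumset C' (sumset X Y) :&: sumset [set c] (sumset X Y)|)%N.
    rewrite -(card_shift c (sumset Z Y)); apply: subset_leq_card.
    rewrite subsetI; apply/andP; split; last by rewrite !sumsetSS.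
    rewrite !sumsetA sumsetSS //.
    apply/subsetP => u /sumsetP[c' [x [/set1P -> + ->]]].
    by rewrite inE => /andP[].
  have h2 : (#|sumset C' (sumset X Y) :&: sumset [set c] (sumset X Y)| <= #|sumset X Y|)%N.
    by rewrite -(card_shift c (sumset X Y)) subset_leq_card // subsetIr.
  lia.
have ZXc := subset_leq_card ZX.
have hZ : (#|sumset X Y| * #|Z| <= #|sumset Z Y| * #|X|)%N.
  have [->|Z0] := eqVneq Z set0; first by rewrite cards0 muln0.
  exact: Xmin.
rewrite cardCX mulnDr mulnBr.
have := leq_mul cardCXY (leqnn #|X|); rewrite !mulnDl => h.
have ? : (#|sumset X Y| * #|Z| <= #|sumset X Y| * #|X|)%N by rewrite leq_mul2l ZXc orbT.
lia.
Qed.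

(** The subset [X'] minimises [|X' + Y| / |X'|], so that [petridis] applies to it with [C]
    running through the iterated sumsets of [Y]. *)
Lemma plunnecke X Y : X != set0 ->
  exists2 X', X' != set0 /\ X' \subset X &
    (#|sumset X' Y| * #|X| <= #|sumset X Y| * #|X'|)%N /\
    forall n, (#|sumset X' (nsum n Y)| * #|X'| ^ n <= #|sumset X' Y| ^ n * #|X'|)%N.
Proof.
move=> X0.
pose ok Z := (Z != set0) && (Z \subset X).
have okX : ok X by rewrite /ok X0 subxx.
pose r Z : rat := #|sumset Z Y|%:R / #|Z|%:R.
have [X' okX' X'min] : exists2 X', ok X' & forall Z, ok Z -> r X' <= r Z.
  by case: (@Order.TotalTheory.arg_minP _ _ _ X ok r okX) => X' ? ?; exists X'.
have pos Z : Z != set0 -> (0 : rat) < #|Z|%:R by rewrite ltr0n card_gt0.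
have hmin Z : ok Z -> (#|sumset X' Y| * #|Z| <= #|sumset Z Y| * #|X'|)%N.
  move=> okZ; have := X'min _ okZ; case/andP: okZ => Z0 _; case/andP: okX' => X'0 _.
  by rewrite /r ler_pdivrMr ?pos // mulrAC ler_pdivlMr ?pos // -!natrM ler_nat.
case/andP: (okX') => X'0 X'X; exists X' => //; split; first exact: hmin.
elim=> [|n IH]; first by rewrite nsum0 sumset0 !expn0 mul1n muln1.
have := @petridis X' Y (nsum n Y); have h : forall Z, Z != set0 -> Z \subset X' ->
    (#|sumset X' Y| * #|Z| <= #|sumset Z Y| * #|X'|)%N.
  by move=> Z Z0 ZX'; apply: hmin; rewrite /ok Z0 (subset_trans ZX').
move=> /(_ h) {h}.
have -> : sumset (nsum n Y) (sumset X' Y) = sumset X' (nsum n.+1 Y).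
  by rewrite nsumS sumsetC -sumsetA.
rewrite (sumsetC (nsum n Y)) => h.
rewrite !expnS mulnA.
apply: leq_trans (leq_mul h (leqnn _)) _.
by rewrite -!mulnA leq_mul2l IH orbT.
Qed.

Lemma plunnecke_ruzsa X Y n : X != set0 ->
  (#|diffset (nsum n Y) (nsum n Y)| * #|X| ^ (2 * n) <=
   #|sumset X Y| ^ (2 * n) * #|X|)%N.
Proof.
move=> X0; have [X' [X'0 X'X] [h1 h2]] := plunnecke Y X0.
have h3 := h2 n; have p' : (0 < #|X'|)%N by rewrite card_gt0.
have h4 : (#|sumset X' (nsum n Y)| * #|X| ^ n <= #|sumset X Y| ^ n * #|X'|)%N.
  have pn : (0 < #|X'| ^ n)%N by rewrite expn_gt0 p'.
  rewrite -(leq_pmul2r pn) mulnAC.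
  apply: leq_trans (leq_mul h3 (leqnn _)) _.
  rewrite mulnAC -expnMn [leqRHS]mulnAC -expnMn leq_mul2r.
  by apply/orP; right; case: (n) => [|m]; rewrite ?expn0 // leq_exp2r.
have h5 := ruzsa_triangle X' (nsum n Y) (nsum n Y).
have h6 := subset_leq_card X'X.
rewrite mul2n -addnn !expnD.
move: h4 h5 h6 p'; move: (#|sumset X' _|) (#|sumset X Y| ^ n)%N (#|X| ^ n)%N (#|diffset _ _|).
move=> c yn xn b; move: #|X| #|X'| => x a h4 h5 h6 p'.
rewrite -(leq_pmul2l p').
have e1 := leq_mul h4 h4; have e2 := leq_mul h5 (leqnn (xn * xn)).
have e3 := leq_mul (leqnn (yn * yn * a)) h6.
lia.
Qed.

(** The inequality [plunnecke_ruzsa] is used with [X = - A], as the hypothesis is about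
    differences. *)
Lemma iterated_diffset A K N : A != set0 ->
  (#|diffset A A| <= K * #|A|)%N ->
  (#|diffset (nsum N A) (nsum N A)| <= K ^ (2 * N) * #|A|)%N.
Proof.
move=> A0 hK; have := plunnecke_ruzsa (oppset A) N A0.
have -> : diffset (nsum N (oppset A)) (nsum N (oppset A)) = diffset (nsum N A) (nsum N A).
  by rewrite -[RHS]oppset_diff /diffset oppset_sum nsum_opp.
move=> h; have pA : (0 < #|A| ^ (2 * N))%N by rewrite expn_gt0 card_gt0 A0.
rewrite -(leq_pmul2r pA); apply: leq_trans h _.
rewrite mulnAC leq_mul2r -expnMn; apply/orP; right.
by case: (2 * N)%N => [|m]; rewrite ?expn0 // leq_exp2r.
Qed.

(** Balog-Szemeredi-Gowers theorem for difference sets, by dependent random choice.  Join [x]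
    and [y] when [x - y] lies in [P].  For a suitable vertex [z], the neighbourhood [N z] is
    large and contains few bad pairs, that is pairs with few common neighbours.  Deleting
    the [x] of [N z] that belong to many bad pairs leaves [A]: any two elements of [A] are
    both good with half of the [w] in [N z], so [x - y] has many representations
    [(x - u) - (w - u) + (w - v) - (y - v)] as an alternating sum of four elements of [P].
    As there are [|P| ^ 4] such sums, few differences are possible. *)
Lemma bsg (S P : {set G}) (d : nat) :
  (forall x, x \in P -> - x \in P) -> S != set0 ->
  (#|S| ^ 2 <= d * #|[set q in setX S S | (q.1 - q.2)%R \in P]|)%N ->
  exists2 A : {set G}, A \subset S &
    (#|S| <= 4 * d * #|A|)%N /\ (#|diffset A A| * #|S| ^ 3 <= 4096 * d ^ 5 * #|P| ^ 4)%N.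
Proof.
move=> Psym S0 dense.
have S_gt0 : (0 < #|S|)%N by rewrite card_gt0.
have d_gt0 : (0 < d)%N by case: (d) dense => // ; rewrite mul0n leqn0 expn_eq0 /= cards_eq0 (negbTE S0).
have PE x : (- x \in P) = (x \in P).
  by apply/idP/idP => [/Psym|/Psym //]; rewrite opprK.
pose N z := [set x in S | (x - z) \in P].
pose c x y := #|[set z in S | (x - z \in P) && (y - z \in P)]|.
pose bad x y := (32 * d ^ 2 * c x y < #|S|)%N.
pose B z := #|[set q in setX (N z) (N z) | bad q.1 q.2]|.
have sumN : #|[set q in setX S S | (q.1 - q.2) \in P]| = (\sum_(z in S) #|N z|)%N.
  rewrite -sum1_card.
  under [RHS]eq_bigr => z _ do rewrite -sum1_card.
  rewrite (exchange_big_dep (fun x => x \in S)) /=; last first.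
    by move=> z x _; rewrite inE => /andP[].
  rewrite pair_big_dep /=; apply: eq_bigl => -[x z]; rewrite !inE /=.
  by do 3!case: (_ \in _).
have CS := sqr_sum_leq S (fun z => #|N z|).
have sumB : (32 * d ^ 2 * \sum_(z in S) B z <= #|S| ^ 3)%N.
  have -> : (\sum_(z in S) B z = \sum_(q in setX S S | bad q.1 q.2) c q.1 q.2)%N.
    rewrite /B /c; under eq_bigr => z _ do rewrite -sum1_card.
    under [RHS]eq_bigr => z _ do rewrite -sum1_card.
    rewrite (exchange_big_dep (fun q => (q \in setX S S) && bad q.1 q.2)) /=.
      apply: eq_bigr => -[x y] /andP[/setXP[/= xS yS] bxy]; apply: eq_bigl => z.
      by rewrite !inE /= xS yS bxy /= andbT.
    by move=> z [x y] zS; rewrite !inE /= => /andP[/andP[/andP[-> _] /andP[-> _]] ->].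
  have -> : (#|S| ^ 3 = #|setX S S| * #|S|)%N by rewrite cardsX mulnn -expnSr.
  rewrite big_distrr /= -sum_nat_const.
  rewrite big_mkcondr /=; apply: leq_sum => q _; case: ifP => // /ltnW; exact.
(* An averaging argument over the vertices: the weight 32 d^2 on the bad pairs is what the
   bound on their total number allows. *)
have [z zS hz] : exists2 z, z \in S & (#|S| ^ 2 + 32 * d ^ 2 * B z <= 2 * d ^ 2 * #|N z| ^ 2)%N.
  apply/exists_inP; apply: contraT; rewrite negb_exists_in => /forall_inP hn.
  have /(_ S) h : forall S' : {set G}, S' \subset S -> (\sum_(z in S') 2 * d ^ 2 * #|N z| ^ 2 + #|S'| <=
      \sum_(z in S') (#|S| ^ 2 + 32 * d ^ 2 * B z))%N.
    move=> S' /subsetP S'S; rewrite -sum1_card -big_split /=; apply: leq_sum => z /S'S /hn.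
    by rewrite -ltnNge addn1.
  move: (h (subxx _)); rewrite big_split /= -!big_distrr /= sum_nat_const.
  move: dense CS sumB; rewrite sumN.
  move: (\sum_(z in S) #|N z|)%N (\sum_(z in S) #|N z| ^ 2)%N (\sum_(z in S) B z)%N.
  move: #|S| S_gt0 => n n0 s1 s2 b h1 h2 h3 h4.
  have h5 : (n ^ 4 <= d ^ 2 * s1 ^ 2)%N by rewrite -expnMn (_ : n ^ 4 = (n ^ 2) ^ 2)%N ?leq_exp2r // -expnM.
  have h6 : (n ^ 4 <= n * (d ^ 2 * s2))%N by nia.
  have h7 : (n ^ 3 <= d ^ 2 * s2)%N by rewrite -(leq_pmul2l n0) -expnS.
  nia.
have hN1 : (#|S| <= 2 * d * #|N z|)%N.
  by rewrite -leq_sqr !expnMn; move: hz; nia.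
have hN2 : (16 * B z <= #|N z| ^ 2)%N.
  have d2 : (0 < d ^ 2)%N by rewrite expn_gt0 d_gt0.
  by rewrite -(leq_pmul2l d2); move: hz; nia.
have N_gt0 : (0 < #|N z|)%N by move: hN1; nia.
pose bd x := #|[set y in N z | bad x y]|.
pose A := [set x in N z | (4 * bd x <= #|N z|)%N].
have AN : A \subset N z by apply/subsetP => x; rewrite inE => /andP[].
have cardA : (3 * #|N z| <= 4 * #|A|)%N.
  have h1 : (#|N z :\: A| * #|N z| <= 4 * B z)%N.
    have -> : B z = (\sum_(x in N z) bd x)%N.
      rewrite /B /bd -sum1_card; under [RHS]eq_bigr => x _ do rewrite -sum1_card.
      rewrite pair_big_dep /=; apply: eq_bigl => -[x y]; rewrite !inE /=.
      by rewrite -!andbA.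
    rewrite -sum_nat_const big_distrr /= [leqRHS](big_setID (N z :\: A)) /=.
    rewrite (setIidPr (subsetDl _ _)); apply: leq_trans (leq_addr _ _).
    apply: leq_sum => x; rewrite inE => /andP[+ xN]; rewrite !inE => xA.
    by move: xA; move: xN; rewrite inE => -> /=; rewrite -ltnNge => /ltnW.
  have h2 := cardsD (N z) A; rewrite (setIidPr AN) in h2.
  have h3 := subset_leq_card AN.
  nia.
exists A; first by apply: subset_trans AN _; apply/subsetP => x; rewrite inE => /andP[].
split; first by move: hN1 cardA; nia.
(* Quadruples of elements of P, counted by the difference that they represent. *)
pose Q := setX (setX P P) (setX P P).
pose sgm (q : (G * G) * (G * G)) := q.1.1 - q.1.2 + (q.2.1 - q.2.2).
pose rep g := #|[set q in Q | sgm q == g]|.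
have sumrep : (\sum_(g in diffset A A) rep g <= #|P| ^ 4)%N.
  have -> : (#|P| ^ 4 = \sum_(g : G) rep g)%N.
    have -> : (#|P| ^ 4 = #|Q|)%N by rewrite !cardsX; ring.
    rewrite -sum1_card (partition_big sgm predT) //=; apply: eq_bigr => g _.
    by rewrite /rep -sum1_card; apply: eq_bigl => q; rewrite inE.
  by rewrite [leqRHS](bigID (mem (diffset A A))) /= leq_addr.
have rep_ge g : g \in diffset A A -> (#|N z| * #|S| ^ 2 <= 2048 * d ^ 4 * rep g)%N.
  case/diffsetP => x [y [xA yA ->]].
  pose U x w := [set u in S | (x - u \in P) && (w - u \in P)].
  pose W := [set w in N z | ~~ bad x w && ~~ bad y w].
  have cardW : (#|N z| <= 2 * #|W|)%N.
    have h1 : (#|N z| <= #|W| + (bd x + bd y))%N.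
      have : N z \subset W :|: ([set w in N z | bad x w] :|: [set w in N z | bad y w]).
        apply/subsetP => w wN; rewrite !inE; move: wN; rewrite !inE => -> /=.
        by case: (bad x w); case: (bad y w).
      move/subset_leq_card/leq_trans; apply.
      by apply: leq_trans (leq_card_setU _ _) _; rewrite leq_add2l leq_card_setU.
    move: xA yA; rewrite !inE => /andP[_ hx] /andP[_ hy]; lia.
  have repT : (\sum_(w in W) #|setX (U x w) (U y w)| <= rep (x - y)%R)%N.
    under eq_bigr => w _ do rewrite -sum1_card.
    rewrite pair_big_dep /= sum1dep_card /rep.
    pose h (t : G * (G * G)) := ((x - t.2.1, t.1 - t.2.1), (t.1 - t.2.2, y - t.2.2)).
    have hinj : injective h.
      move=> [w [u v]] [w' [u' v']] [/= /addrI/oppr_inj <- /addIr <- _].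
      by move=> /addrI/oppr_inj <-.
    rewrite -(card_imset _ hinj); apply: subset_leq_card.
    apply/subsetP => _ /imsetP[[w [u v]] + ->]; rewrite !inE /= /h /sgm /=.
    move=> /andP[/andP[_ _] /andP[/andP[_ /andP[-> ->]] /andP[_ /andP[-> ->]]]] /=.
    by rewrite !opprB !addrA !subrK.
  have hU x' w : ~~ bad x' w -> (#|S| <= 32 * d ^ 2 * #|U x' w|)%N by rewrite /bad -leqNgt.
  have : (#|W| * #|S| ^ 2 <= 1024 * d ^ 4 * \sum_(w in W) #|setX (U x w) (U y w)|)%N.
    rewrite -sum_nat_const big_distrr /=; apply: leq_sum => w.
    rewrite inE => /andP[_ /andP[/hU hx /hU hy]].
    have := leq_mul hx hy; rewrite cardsX mulnn (_ : 4 = 2 + 2)%N // expnD.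
    by rewrite mulnACA (_ : 1024 * _ = 32 * d ^ 2 * (32 * d ^ 2))%N //; ring.
  have := leq_mul cardW (leqnn (#|S| ^ 2)); have := leq_mul (leqnn (1024 * d ^ 4)) repT.
  move: (\sum_(w in W) _)%N => ss; lia.
have h : (#|diffset A A| * (#|N z| * #|S| ^ 2) <= 2048 * d ^ 4 * #|P| ^ 4)%N.
  rewrite -sum_nat_const; apply: leq_trans (leq_mul (leqnn _) sumrep).
  by rewrite big_distrr /=; apply: leq_sum.
have h' := leq_mul hN1 (leqnn (#|diffset A A| * #|S| ^ 2)).
have h'' := leq_mul (leqnn (2 * d)) h.
have e5 : (d ^ 5 = d * d ^ 4)%N by rewrite -expnS.
rewrite e5 (expnS _ 2); lia.
Qed.

Lemma diffset_shift a Y : diffset (sumset [set a] Y) (sumset [set a] Y) = diffset Y Y.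
Proof.
rewrite /diffset oppset_sum sumsetACA.
suff -> : sumset [set a] (oppset [set a]) = [set 0] by rewrite sum0set.
apply/setP => u; apply/sumsetP/set1P => [[x [y [/set1P -> + ->]]]|->].
  by rewrite mem_oppset => /set1P ya; rewrite -[y]opprK ya subrr.
by exists a, (- a); rewrite mem_oppset opprK !set11 subrr.
Qed.

Lemma nsum2 A : nsum 2 A = sumset A A.
Proof. by rewrite nsumS nsum1. Qed.

Lemma diffset_sum A B C D :
  diffset (sumset A B) (sumset C D) = sumset (diffset A C) (diffset B D).
Proof. by rewrite /diffset oppset_sum sumsetACA. Qed.

(** The set of all subset sums of [s]. *)
Definition cube (s : seq G) : {set G} := foldr (fun y C => sumset [set 0; y] C) [set 0] s.

Lemma cube_sub s F : 0 \in F -> {subset s <= F} -> cube s \subset nsum (size s) F.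
Proof.
move=> F0; elim: s => [|y s IH] sF //=; rewrite nsumS; apply: sumsetSS.
  by apply/subsetP => u /set2P[] -> //; apply: sF; rewrite inE eqxx.
by apply: IH => u us; apply: sF; rewrite inE us orbT.
Qed.

Lemma card_nsum_cube s k : (#|nsum k (diffset (cube s) (cube s))| <= (2 * k).+1 ^ size s)%N.
Proof.
elim: s => [|y s IH] /=.
  rewrite /diffset oppset0 sumset0; suff -> : nsum k [set 0 : G] = [set 0] by rewrite cards1.
  by elim: k => // k; rewrite nsumS sum0set.
rewrite diffset_sum nsum_sum expnS.
apply: leq_trans (card_sumset _ _) _; apply: leq_mul => //.
suff h : nsum k (diffset [set 0; y] [set 0; y]) \subset
    [set y *+ i - y *+ k | i : 'I_(2 * k).+1].
  apply: leq_trans (subset_leq_card h) _.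
  by apply: leq_trans (leq_imset_card _ _) _; rewrite card_ord.
have h j : nsum j [set 0; y] \subset [set y *+ val i | i : 'I_j.+1].
  elim: j => [|j IHj]; apply/subsetP => u.
    by rewrite inE => /eqP ->; apply/imsetP; exists ord0.
  rewrite nsumS => /sumsetP[a [b [ha /(subsetP IHj)/imsetP[i _ ->] ->]]].
  case/set2P: ha => ->; apply/imsetP.
    by exists (widen_ord (leqnSn _) i) => //=; rewrite add0r.
  by exists (lift ord0 i) => //=; rewrite -mulrS.
rewrite nsum_diff; apply/subsetP => u /diffsetP[a [b [/(subsetP (h k))/imsetP[i _ ->]]]].
move=> /(subsetP (h k))/imsetP[j _ ->] ->.
have lt : (i + (k - j) < (2 * k).+1)%N by have := ltn_ord i; have := ltn_ord j; lia.
apply/imsetP; exists (Ordinal lt) => //=.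
have jk : (j <= k)%N by rewrite -ltnS ltn_ord.
by rewrite mulrnDr mulrnBr // addrA [RHS]addrAC addrK.
Qed.

(** Greedy choice: as long as some [y] of [F] is not in [cube s - cube s + Y - Y], the two
    translates of [cube s + Y] by [0] and [y] are disjoint, and appending [y] to [s] doubles
    [cube s + Y]. *)
Lemma cube_dichotomy Y F r :
  (exists s, [/\ size s = r, {subset s <= F} & (2 ^ r * #|Y| <= #|sumset (cube s) Y|)%N]) \/
  (exists s, [/\ (size s < r)%N, {subset s <= F} &
     F \subset sumset (diffset (cube s) (cube s)) (diffset Y Y)]).
Proof.
elim: r => [|r [[s [sr sF hs]]|[s [sr sF hs]]]].
- by left; exists [::]; split=> //=; rewrite sum0set expn0 mul1n.
- have [sub|] := boolP (F \subset sumset (diffset (cube s) (cube s)) (diffset Y Y)).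
    by right; exists s; rewrite sr.
  case/subsetPn => y yF ny; left; exists (y :: s); split; first by rewrite /= sr.
    by move=> u; rewrite inE => /predU1P[-> //|]; apply: sF.
  rewrite /= sumsetUl sum0set sumsetUl -sumsetA cardsU card_shift disjoint_setI0.
    by rewrite cards0 subn0 expnS -mulnA mul2n -addnn leq_add.
  rewrite disjoints_subset; apply/subsetP => u /sumsetP[c [a [cC aY ->]]]; rewrite inE.
  apply: contra ny => /sumsetP[y' [v [/set1P -> /sumsetP[c' [a' [c'C a'Y ->]]] e]]].
  have -> : y = (c - c') + (a - a').
    by rewrite addrACA e -opprD addrK.
  by rewrite mem_sumset ?mem_diffset.
- by right; exists s; split => //; apply: ltnW.
Qed.

(** A set with little growth at a high order has polynomial growth at all orders.  By
    [cube_dichotomy] with [F = 2 E], the doubling cannot go on for [r] steps, as it stays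
    inside [n Y - n Y].  So [2 E] is covered by [E] plus differences of a cube of dimension
    less than [r]; by induction so is [k E] with [k] copies of these differences, and a
    cube of dimension [r] grows like [(2 k + 1) ^ r]. *)
Lemma covering_growth Y n r : 0 \in Y -> (2 * r < n)%N ->
  (#|diffset (nsum n Y) (nsum n Y)| < 2 ^ r * #|Y|)%N ->
  forall k, (#|nsum k (diffset Y Y)| <= #|diffset Y Y| * (2 * k).+1 ^ r)%N.
Proof.
move=> Y0 rn small; set E := diffset Y Y.
have E0 : 0 \in E by apply: mem0_diffset; apply/set0Pn; exists 0.
have YE : Y \subset E by apply: subset_sumset0; rewrite mem_oppset oppr0.
case: (cube_dichotomy Y (nsum 2 E) r) => [[s [sr sF hs]]|[s [sr sF hs]]].
  suff : (2 ^ r * #|Y| <= #|diffset (nsum n Y) (nsum n Y)|)%N by rewrite leqNgt small.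
  apply: leq_trans hs _; apply: subset_leq_card.
  rewrite -nsum_diff -/E.
  apply: subset_trans (nsum_mono E0 rn); rewrite -addn1 nsumD nsum1.
  apply: sumsetSS => //; rewrite -sr.
  have -> : nsum (2 * size s) E = nsum (size s) (nsum 2 E).
    by elim: (size s) => [|m IH]; rewrite ?muln0 // mulnS nsumD IH.
  by apply: cube_sub; rewrite // mem0_nsum.
have key k : nsum k.+1 E \subset sumset (nsum k (diffset (cube s) (cube s))) E.
  elim: k => [|k IH]; first by rewrite nsum1 nsum0 sum0set.
  rewrite nsumS; apply: subset_trans (sumsetSS (subxx E) IH) _.
  rewrite sumsetC -sumsetA -nsum2.
  apply: subset_trans (sumsetSS (subxx _) hs) _.
  by rewrite sumsetA -/E -[X in sumset (nsum k _) X]nsum1 -nsumD addn1.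
move=> k; have Ene : E != set0 by apply/set0Pn; exists 0.
have kE : nsum k E \subset nsum k.+1 E by apply: nsum_mono.
apply: leq_trans (subset_leq_card kE) _.
apply: leq_trans (subset_leq_card (key k)) _.
apply: leq_trans (card_sumset _ _) _; rewrite mulnC leq_mul2l.
apply/orP; right; apply: leq_trans (card_nsum_cube _ _) _.
by rewrite leq_pexp2l // ltnW.
Qed.
End Sumsets.

(** * Almost periods by random sampling *)

Lemma expR_le_quad (R : realType) (y : R) : `|y| <= 1 / 4 -> expR y <= 1 + y + y ^+ 2.
Proof.
rewrite ler_norml => /andP[y1 y2].
have h : expR (y / 2) * (1 - y / 2) <= 1.
  rewrite -[leRHS](expRxMexpNx_1 (y / 2)) ler_wpM2l ?expR_ge0 //.
  by have := expR_ge1Dx (- (y / 2)).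
have e0 : 0 <= expR (y / 2) by exact: expR_ge0.
have -> : expR y = expR (y / 2) ^+ 2 by rewrite expr2 -expRD -splitr.
have h' : (expR (y / 2) * (1 - y / 2)) ^+ 2 <= 1.
  by rewrite expr_le1 // mulr_ge0 //; lra.
have pos : 0 < (1 - y / 2) ^+ 2 by rewrite exprn_gt0 //; lra.
rewrite -(ler_pM2r pos) -exprMn; apply: le_trans h' _; nra.
Qed.

Section CrootSisask.
Import mathcomp.boot.fintype mathcomp.boot.finset.
Variables (R : realType) (G : finZmodType).
Implicit Types (X Y Z B V W : {set G}).

Definition tuples m X : {set {ffun 'I_m -> G}} := [set t in ffun_on (mem X)]%SET.

Lemma card_tuples m X : #|tuples m X| = (#|X| ^ m)%N.
Proof. by rewrite cardsE card_ffun_on card_ord. Qed.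

Lemma sum_tuples m X (F : G -> R) :
  \sum_(t in tuples m X) \prod_i F (t i) = (\sum_(x in X) F x) ^+ m.
Proof.
rewrite -[m in RHS]card_ord -prodr_const.
rewrite (bigA_distr_big [in X] (fun _ x => F x)) /=.
by apply: eq_bigl => t; rewrite inE.
Qed.

(** Chernoff's method: the exponential moment factors over the coordinates of a tuple, and
    each factor is at most [expR (eps ^ 2 / 4)] as [c] has mean zero. *)
Lemma hoeffding m X (c : G -> R) (eps : R) :
  X != set0 -> 0 < eps <= 1 / 2 -> (forall x, `|c x| <= 1) -> \sum_(x in X) c x = 0 ->
  #|[set t in tuples m X | m%:R * eps <= \sum_i c (t i)]|%:R
    <= expR (- (m%:R * eps ^+ 2 / 4)) * (#|X| ^ m)%:R.
Proof.
move=> X0 /andP[e0 e1] c1 csum.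
have n0 : 0 < #|X|%:R :> R by rewrite ltr0n card_gt0.
have mgf : \sum_(x in X) expR (eps / 2 * c x) <= #|X|%:R * expR (eps ^+ 2 / 4).
  apply: (@le_trans _ _ (\sum_(x in X) (1 + eps / 2 * c x + eps ^+ 2 / 4))).
    apply: ler_sum => x _; have := c1 x => cx.
    have yx : `|eps / 2 * c x| <= 1 / 4.
      rewrite normrM ger0_norm; last by lra.
      by apply: (@le_trans _ _ (eps / 2 * 1)); [rewrite ler_wpM2l //; lra|lra].
    apply: le_trans (expR_le_quad yx) _; rewrite lerD2l exprMn.
    have : c x ^+ 2 <= 1 by rewrite -(real_normK (num_real (c x))) expr_le1.
    have -> : (eps / 2) ^+ 2 = eps ^+ 2 / 4 by field.
    by move=> ?; rewrite ler_piMr // divr_ge0 ?sqr_ge0.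
  rewrite !big_split /= -mulr_sumr csum mulr0 addr0 !sumr_const.
  rewrite -(mulr_natl (eps ^+ 2 / 4)) -[X in X + _]mulr1 -mulrDr ler_wpM2l ?(ltW n0) //.
  exact: expR_ge1Dx.
have := sum_tuples m X (fun x => expR (eps / 2 * c x)) => E.
have h1 : \sum_(t in tuples m X) \prod_i expR (eps / 2 * c (t i)) <=
   (#|X| ^ m)%:R * expR (m%:R * (eps ^+ 2 / 4)).
  rewrite E natrX expRM_natl -exprMn; apply: lerXn2r => //; rewrite nnegrE.
    by apply: sumr_ge0 => x _; apply: expR_ge0.
  by rewrite mulr_ge0 ?expR_ge0 // (ltW n0).
have h2 : #|[set t in tuples m X | m%:R * eps <= \sum_i c (t i)]|%:R * expR (m%:R * (eps ^+ 2 / 2))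
   <= \sum_(t in tuples m X) \prod_i expR (eps / 2 * c (t i)).
  rewrite mulr_natl -sumr_const big_set /= big_mkcondr /=; apply: ler_sum => t tX.
  rewrite -expR_sum; case: ifP => [h|_]; last exact: expR_ge0.
  rewrite ler_expR -mulr_sumr.
  have : eps / 2 * (m%:R * eps) <= eps / 2 * \sum_i c (t i) by rewrite ler_wpM2l //; lra.
  by apply: le_trans; rewrite le_eqVlt; apply/orP; left; apply/eqP; field.
have := le_trans h2 h1.
rewrite -ler_pdivlMr ?expR_gt0 // -expRN => h; apply: (le_trans h).
rewrite -(mulrA (#|X| ^ m)%:R) -expRD mulrC le_eqVlt; apply/orP; left; apply/eqP.
by congr (expR _ * _); field.
Qed.

(** The density [g u] of the [x] in [X] with [u + x] in [W = X + B] is [1] on [B] and [0]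
    outside [V = X + B - X].  Sampling [m] random elements of [X] gives an estimate of [g]
    that is accurate outside a small proportion of [V]; if a sample and its translate by
    [- y] are both accurate, then [y] is almost a period of [g]. *)
Section AlmostPeriods.
Variables (X B Y : {set G}) (m : nat) (eps : R).
Hypotheses (X0 : X != set0) (B0 : B != set0) (Y0 : Y != set0) (m_gt0 : (0 < m)%N) (eps01 : 0 < eps <= 1 / 2).
Let W := sumset X B.
Let V := diffset W X.
Let hit u x : R := (u + x \in W)%:R.
Let g u : R := (\sum_(x in X) hit u x) / #|X|%:R.

Let n0 : 0 < #|X|%:R :> R. Proof. by rewrite ltr0n card_gt0. Qed.

Let hit01 u x : 0 <= hit u x <= 1.
Proof. by rewrite /hit; case: (_ \in _); rewrite ?lexx ler01. Qed.

Let g01 u : 0 <= g u <= 1.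
Proof.
apply/andP; split.
  by rewrite divr_ge0 // sumr_ge0 // => x _; case/andP: (hit01 u x).
rewrite ler_pdivrMr // mul1r -sum1_card natr_sum; apply: ler_sum => x _.
by case/andP: (hit01 u x).
Qed.

Let hitV u x : x \in X -> u \notin V -> hit u x = 0.
Proof.
move=> xX uV; rewrite /hit; have [h|//] := boolP (u + x \in W); case/negP: uV.
by rewrite -(addrK x u) mem_diffset.
Qed.

Let gV u : u \notin V -> g u = 0.
Proof.
by move=> uV; rewrite /g big1 ?mul0r // => x xX; apply: hitV.
Qed.

Let gB u : u \in B -> g u = 1.
Proof.
move=> uB; rewrite /g (eq_bigr (fun=> 1)) => [|x xX].
  by rewrite sumr_const divff // gt_eqF.
by rewrite /hit addrC mem_sumset.
Qed.

Let V_gt0 : 0 < #|V|%:R :> R.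
Proof.
rewrite ltr0n card_gt0; apply: sumset_neq0; first exact: sumset_neq0.
by rewrite -card_gt0 card_oppset card_gt0.
Qed.

Let off (t : {ffun 'I_m -> G}) u := m%:R * eps <= `|\sum_i hit u (t i) - m%:R * g u|.
Let beta := 4 * expR (- (m%:R * eps ^+ 2 / 4)).
Let good (t : {ffun 'I_m -> G}) := #|[set u in V | off t u]|%:R <= beta * #|V|%:R.

Let beta_gt0 : 0 < beta. Proof. by rewrite mulr_gt0 ?expR_gt0. Qed.

Let card_off u : #|[set t in tuples m X | off t u]|%:R <= beta / 2 * (#|X| ^ m)%:R.
Proof.
pose c x := hit u x - g u.
have cX : \sum_(x in X) c x = 0.
  by rewrite sumrB sumr_const -(mulr_natr (g u)) /g divfK ?subrr // gt_eqF.
have c1 x : `|c x| <= 1.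
  by rewrite /c ler_norml; move: (hit01 u x) (g01 u); lra.
have cN1 x : `|- c x| <= 1 by rewrite normrN.
have cNX : \sum_(x in X) - c x = 0 by rewrite sumrN cX oppr0.
have sumc t : \sum_i hit u (t i) - m%:R * g u = \sum_(i < m) c (t i).
  by rewrite sumrB sumr_const card_ord mulr_natl.
have sub : [set t in tuples m X | off t u] \subset
    [set t in tuples m X | m%:R * eps <= \sum_i c (t i)] :|:
    [set t in tuples m X | m%:R * eps <= \sum_i - c (t i)].
  apply/subsetP => t; rewrite !inE /off sumc => /andP[-> /=].
  by rewrite sumrN ler_normr.
have := subset_leq_card sub; move/leq_trans => /(_ _ (leq_card_setU _ _)).
rewrite -(ler_nat R) natrD => /le_trans; apply.
have h1 := @hoeffding m X c eps X0 eps01 c1 cX.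
have h2 := @hoeffding m X (fun x => - c x) eps X0 eps01 cN1 cNX.
apply: le_trans (lerD h1 h2) _.
by rewrite le_eqVlt; apply/orP; left; apply/eqP; rewrite /beta; field.
Qed.

Let card_good : (#|X| ^ m <= 2 * #|[set t in tuples m X | good t]|)%N.
Proof.
have h : #|[set t in tuples m X | ~~ good t]|%:R * (beta * #|V|%:R) <=
    beta / 2 * (#|X| ^ m)%:R * #|V|%:R.
  apply: (@le_trans _ _ (\sum_(u in V) #|[set t in tuples m X | off t u]|%:R)).
    have -> : \sum_(u in V) #|[set t in tuples m X | off t u]|%:R =
      \sum_(t in tuples m X) #|[set u in V | off t u]|%:R :> R.
      by rewrite -!natr_sum double_count.
    rewrite mulr_natl -sumr_const big_set /= big_mkcondr; apply: ler_sum => t _ /=.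
    by case: ifP => // ; rewrite -ltNge => /ltW.
  rewrite mulrC mulr_natl -sumr_const; apply: ler_sum => u _; exact: card_off.
have {h} : #|[set t in tuples m X | ~~ good t]|%:R * 2 <= (#|X| ^ m)%:R :> R.
  have bV : 0 < beta * #|V|%:R / 2 by rewrite divr_gt0 // mulr_gt0.
  rewrite -(ler_pM2r bV); apply: le_trans (le_trans _ h) _; rewrite le_eqVlt; apply/orP; left; apply/eqP; by field.
rewrite -natrM ler_nat => h.
have := cardsID [set t | good t] (tuples m X).
have -> : tuples m X :&: [set t | good t] = [set t in tuples m X | good t].
  by apply/setP => t; rewrite !inE.
have -> : tuples m X :\: [set t | good t] = [set t in tuples m X | ~~ good t].
  by apply/setP => t; rewrite !inE andbC.
rewrite card_tuples; move: h; move: (#|X| ^ m)%N #|[set t in tuples m X | good t]|.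
move: #|[set t in tuples m X | ~~ good t]|. lia.
Qed.

Let sh (y : G) (t : {ffun 'I_m -> G}) : {ffun 'I_m -> G} := [ffun i => t i - y].

Let ok t := (t \in tuples m X) && good t.

Let pigeonhole : exists w : {ffun 'I_m -> G},
  (#|Y| * #|X| ^ m <= 2 * #|[set y in Y | ok (sh y w)]| * #|sumset X Y| ^ m)%N.
Proof.
apply: contrapT => /forallNP h.
have h1 : (\sum_(w in tuples m (sumset X Y)) #|[set y in Y | ok (sh y w)]| >=
    \sum_(y in Y) #|[set t in tuples m X | good t]|)%N.
  rewrite [leqRHS]double_count; apply: leq_sum => y yY.
  pose f (t : {ffun 'I_m -> G}) : {ffun 'I_m -> G} := [ffun i => t i + y].
  have finj : injective f.
    by move=> t t' /ffunP e; apply/ffunP => i; move: (e i); rewrite !ffunE => /addIr.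
  rewrite -(card_imset _ finj); apply: subset_leq_card; apply/subsetP => _ /imsetP[t + ->].
  move=> tg; rewrite inE; apply/andP; split.
    move: tg; rewrite !inE => /andP[/ffun_onP tX gt].
    by apply/ffun_onP => i; rewrite ffunE mem_sumset.
  suff -> : sh y (f t) = t by move: tg; rewrite inE.
  by apply/ffunP => i; rewrite !ffunE addrK.
have {h}h w : (2 * #|[set y in Y | ok (sh y w)]| * #|sumset X Y| ^ m < #|Y| * #|X| ^ m)%N.
  by rewrite ltnNge; apply/negP; apply: h.
have pXY : (0 < #|sumset X Y| ^ m)%N by rewrite expn_gt0 card_gt0 sumset_neq0.
have h2 : (\sum_(w in tuples m (sumset X Y)) (2 * #|[set y in Y | ok (sh y w)]| * #|sumset X Y| ^ m).+1
   <= #|sumset X Y| ^ m * (#|Y| * #|X| ^ m))%N.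
  apply: (@leq_trans (\sum_(w in tuples m (sumset X Y)) (#|Y| * #|X| ^ m))).
    by apply: leq_sum.
  by rewrite sum_nat_const card_tuples.
move: h2; under eq_bigr => w _ do rewrite -addn1.
rewrite big_split /= sum1_card card_tuples -big_distrl -big_distrr /=.
move: h1; rewrite sum_nat_const; move: (\sum_(w in _) _)%N => s h1 h2.
have h3 : (#|Y| * #|X| ^ m <= #|Y| * (2 * #|[set t in tuples m X | good t]|))%N by rewrite leq_mul2l card_good orbT.
have h4 : (#|Y| * #|X| ^ m <= 2 * s)%N by lia.
have h5 := leq_mul h4 (leqnn (#|sumset X Y| ^ m)).
move: h2 h5 pXY; move: (#|sumset X Y| ^ m)%N (#|X| ^ m)%N => q xm.
rewrite (mulnC q) => h2 /(leq_trans h2); rewrite -[leqRHS]addn0 leq_add2l leqn0 => /eqP ->.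
by [].
Qed.

(** By pigeonhole, many [y] in [Y] turn one and the same tuple [w] of elements of [X + Y]
    into an accurate sample of [X].  The differences of these [y] are almost periods of [g];
    a sum [h] of [k] of them is so with [k] times the error, which is still too small for
    [g (u + h)] to vanish for all [u] of [B], where [g] is [1]. *)
Lemma almost_periods (k : nat) :
  2 * (k%:R * beta) * #|V|%:R < #|B|%:R -> 2 * (k%:R * eps) <= 1 / 2 ->
  exists Z, [/\ Z \subset Y, (#|Y| * #|X| ^ m <= 2 * #|Z| * #|sumset X Y| ^ m)%N &
     nsum k (diffset Z Z) \subset diffset V B].
Proof.
move=> hbeta heps; have [w hw] := pigeonhole.
set Z := [set y in Y | _] in hw; exists Z; split => //.
  by apply/subsetP => y; rewrite inE => /andP[].
pose H u := \sum_i hit u (w i).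
pose b : R := beta * #|V|%:R.
have Hsh z u : \sum_i hit u (sh z w i) = H (u - z).
  by apply: eq_bigr => i _; rewrite /hit ffunE addrA addrAC.
have c1 z : z \in Z -> #|[set u | m%:R * eps <= `|H (u - z) - m%:R * g u|]|%:R <= b.
  rewrite inE => /andP[_ /andP[+ gt]]; rewrite inE => /ffun_onP tX.
  apply: le_trans gt; rewrite ler_nat; apply: subset_leq_card; apply/subsetP => u.
  rewrite !inE /off Hsh => hu; rewrite hu andbT; apply: contraLR hu => uV.
  rewrite -Hsh (gV uV) mulr0 subr0 big1 ?normr0 -?ltNge ?mulr_gt0 ?ltr0n //.
    by case/andP: eps01.
  by move=> i _; apply: hitV.
have c2 z z' : z \in Z -> z' \in Z ->
    #|[set u | 2 * eps <= `|g (u + (z - z')) - g u|]|%:R <= 2 * b.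
  move=> zZ z'Z.
  pose E d := [set u | m%:R * eps <= `|H (u - d) - m%:R * g u|].
  have sub : [set u | 2 * eps <= `|g (u + (z - z')) - g u|] \subset
      E z' :|: [set u | u + (z - z') \in E z].
    apply/subsetP => u; rewrite !inE; apply: contraLR; rewrite negb_or -!ltNge.
    move=> /andP[]; have -> : u + (z - z') - z = u - z' by rewrite addrA addrAC addrK.
    move: (H (u - z')) (g u) (g (u + (z - z'))) => h x y h1 h2.
    have mp : 0 < m%:R :> R by rewrite ltr0n.
    rewrite -(ltr_pM2l mp) -{1}(ger0_norm (ltW mp)) -normrM mulrBr.
    have -> : m%:R * y - m%:R * x = (h - m%:R * x) - (h - m%:R * y) by ring.
    apply: le_lt_trans (ler_normB _ _) _; lra.
  have := subset_leq_card sub; move/leq_trans => /(_ _ (leq_card_setU _ _)).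
  have -> : #|[set u | u + (z - z') \in E z]| = #|E z|.
    rewrite -(card_imset (E z) (addIr (- (z - z')))); congr #|pred_of_set _|.
    apply/setP => u; rewrite inE; apply/idP/imsetP => [h|[v vE ->]]; last by rewrite subrK.
    by exists (u + (z - z')); rewrite ?addrK.
  rewrite -(ler_nat R) natrD => /le_trans; apply.
  have := c1 _ zZ; have := c1 _ z'Z; rewrite -/(E z) -/(E z'); lra.
have c3 i h : h \in nsum i (diffset Z Z) ->
    #|[set u | g (u + h) < g u - i%:R * (2 * eps)]|%:R <= i%:R * (2 * b).
  elim: i h => [|i IH] h.
    rewrite nsum0 => /set1P ->.
    rewrite (_ : [set u | _] = set0) ?cards0 ?mul0r //.
    by apply/setP => u; rewrite !inE addr0 subr0 ltxx.
  rewrite nsumS => /sumsetP[_ [h' [/diffsetP[z [z' [zZ z'Z ->]]] h'i ->]]].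
  have iS (x : R) : i.+1%:R * x = i%:R * x + x by rewrite -natr1 mulrDl mul1r.
  have sub : [set u | g (u + (z - z' + h')) < g u - i.+1%:R * (2 * eps)] \subset
     [set u | g (u + h') < g u - i%:R * (2 * eps)] :|:
     [set u | u + h' \in [set u | 2 * eps <= `|g (u + (z - z')) - g u|] ].
    apply/subsetP => u; rewrite !inE; apply: contraLR; rewrite negb_or -!leNgt -ltNge.
    move=> /andP[h1]; rewrite -addrA (addrC h') => h2; rewrite iS.
    move: h2; rewrite ltr_norml => /andP[h2 _]; lra.
  have := subset_leq_card sub; move/leq_trans => /(_ _ (leq_card_setU _ _)).
  set F := [set u | 2 * eps <= `|g (u + (z - z')) - g u|].
  have -> : #|[set u | u + h' \in F]| = #|F|.
    rewrite -(card_imset F (addIr (- h'))); congr #|pred_of_set _|.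
    apply/setP => u; rewrite inE; apply/idP/imsetP => [h0|[v vE ->]]; last by rewrite subrK.
    by exists (u + h'); rewrite ?addrK.
  rewrite -(ler_nat R) natrD => /le_trans; apply.
  by rewrite iS; apply: lerD; [apply: IH|apply: c2].
apply/subsetP => h hk; have := c3 _ _ hk => hc.
have : ~~ (B \subset [set u | g (u + h) < g u - k%:R * (2 * eps)]).
  apply/negP => /subset_leq_card; rewrite leqNgt => /negP; apply.
  rewrite -(ltr_nat R); apply: le_lt_trans hc _; apply: le_lt_trans hbeta.
  by rewrite /b le_eqVlt; apply/orP; left; apply/eqP; ring.
case/subsetPn => u uB; rewrite inE -leNgt (gB uB) => hu.
have : u + h \in V.
  apply: contraT => /gV; lra.
by move=> uhV; rewrite -(addKr u h) addrC mem_diffset.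
Qed.
End AlmostPeriods.

(** The Croot-Sisask lemma: the error [1 / (8 k)] leaves room for [k] steps, and then samples
    of size [1536 k ^ 2 s] make the exceptional proportion smaller than [2 ^ -s / k]. *)
Lemma croot_sisask X B Y k s :
  X != set0 -> B != set0 -> Y != set0 -> (0 < k <= 2 ^ s)%N -> (0 < s)%N ->
  (#|sumset (diffset X X) B| <= 2 ^ s * #|B|)%N ->
  exists Z, [/\ Z \subset Y,
     (#|Y| * #|X| ^ (1536 * k ^ 2 * s) <= 2 * #|Z| * #|sumset X Y| ^ (1536 * k ^ 2 * s))%N &
     nsum k (diffset Z Z) \subset sumset (diffset X X) (diffset B B)].
Proof.
move=> X0 B0 Y0 /andP[k0 ks] s0 hV.
have VE : diffset (sumset X B) X = sumset (diffset X X) B by rewrite /diffset sumsetAC.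
have kp : 0 < k%:R :> R by rewrite ltr0n.
have k1 : 1 <= k%:R :> R by rewrite ler1n.
have m0 : (0 < 1536 * k ^ 2 * s)%N by rewrite !muln_gt0 ?expn_gt0 k0 s0.
have eps0 : ((0 : R) < 1 / (8 * k%:R)) && (1 / (8 * k%:R) <= (1 / 2 : R)).
  apply/andP; split; first by rewrite divr_gt0 // mulr_gt0.
  by rewrite ler_pM2l // lef_pV2 ?posrE ?mulr_gt0 //; nra.
have [||Z [ZY hZ kZ]] := @almost_periods X B Y _ _ X0 B0 Y0 m0 eps0 k.
- have -> : (1536 * k ^ 2 * s)%:R * (1 / (8 * k%:R)) ^+ 2 / 4 = (6 * s)%:R * 1 :> R.
    by rewrite !natrM; field; rewrite gt_eqF.
  rewrite expRN expRM_natl VE.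
  have e2 : 2 <= expR 1 :> R by apply: le_trans (expR_ge1Dx _).
  have e6 : (16 ^ s * (2 ^ s * 2 ^ s))%:R <= expR 1 ^+ (6 * s) :> R.
    rewrite -!expnMn exprM natrX; apply: lerXn2r; rewrite ?nnegrE ?exprn_ge0 ?expR_ge0 //.
    apply: (@le_trans _ _ (2 ^+ 6)); first by rewrite -natrX ler_nat.
    by apply: lerXn2r; rewrite ?nnegrE ?expR_ge0.
  have e16 : (8 * (2 ^ s * 2 ^ s) < 16 ^ s * (2 ^ s * 2 ^ s))%N.
    rewrite ltn_pmul2r ?muln_gt0 ?expn_gt0 //.
    by apply: (@leq_trans (16 ^ 1)); rewrite ?leq_exp2l.
  have ep : 0 < expR 1 ^+ (6 * s) :> R by rewrite exprn_gt0 ?expR_gt0.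
  have Bp : 0 < #|B|%:R :> R by rewrite ltr0n card_gt0.
  apply: (@le_lt_trans _ _ ((8 * (2 ^ s * 2 ^ s))%:R / expR 1 ^+ (6 * s) * #|B|%:R)).
    have h := leq_mul ks hV; rewrite mulnA -(ler_nat R) !natrM in h.
    have -> : 2 * (k%:R * (4 / expR 1 ^+ (6 * s))) * #|sumset (diffset X X) B|%:R
      = k%:R * #|sumset (diffset X X) B|%:R * (8 / expR 1 ^+ (6 * s)) :> R by field; rewrite gt_eqF.
    have -> : (8 * (2 ^ s * 2 ^ s))%:R / expR 1 ^+ (6 * s) * #|B|%:R
      = (2 ^ s)%:R * (2 ^ s)%:R * #|B|%:R * (8 / expR 1 ^+ (6 * s)) :> R.
      by rewrite !natrM; field; rewrite gt_eqF.
    by rewrite ler_pM2r // divr_gt0.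
  rewrite gtr_pMl // ltr_pdivrMr // mul1r; apply: lt_le_trans e6.
  by rewrite ltr_nat.
- have -> : 2 * (k%:R * (1 / (8 * k%:R))) = 1 / 4 :> R by field; rewrite gt_eqF.
  lra.
exists Z; split => //.
by rewrite VE /diffset -sumsetA in kZ.
Qed.

(** The product of the [k] ratios is at most [c], so not all of their [k]-th powers exceed it. *)
Lemma ratio_pigeonhole (a : nat -> nat) (k c : nat) : (0 < k)%N -> (0 < a 0)%N ->
  (a k <= c * a 0)%N -> exists2 i, (i < k)%N & (a i.+1 ^ k <= c * a i ^ k)%N.
Proof.
move=> k0 a0 hk; apply: contrapT => /forall2NP h.
have {}h i : (i < k)%N -> (c * a i ^ k < a i.+1 ^ k)%N.
  by move=> ik; case: (h i) => // /negP; rewrite -ltnNge.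
have key i : (i <= k)%N -> (c ^ i * a 0 ^ k <= a i ^ k)%N.
  elim: i => [|i IH] ik; first by rewrite mul1n.
  apply: leq_trans (ltnW (h _ ik)); rewrite expnS -mulnA leq_mul2l IH ?orbT //.
  exact: ltnW.
case: k k0 hk h key => // k _ hk h key.
have h1 := key k (leqnSn _); have h2 := h _ (ltnSn k).
have h3 : (c ^ k.+1 * a 0 ^ k.+1 < a k.+1 ^ k.+1)%N.
  apply: leq_ltn_trans h2; by rewrite expnS -mulnA leq_mul2l h1 orbT.
by move: h3; rewrite -expnMn ltnNge leq_exp2r // hk.
Qed.
End CrootSisask.

(** * A structured translate inside a set of small doubling *)

Section Konyagin.
Import mathcomp.boot.fintype mathcomp.boot.finset.
Variables (R : realType) (G : finZmodType) (A : {set G}) (D : nat).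
Implicit Types (X Y Z : {set G}).
Hypotheses (A0 : A != set0) (D0 : (0 < D)%N).
Hypothesis Agrowth : forall N, (#|diffset (nsum N A) (nsum N A)| <= 2 ^ (D * N) * #|A|)%N.

Let A_gt0 : (0 < #|A|)%N. Proof. by rewrite card_gt0. Qed.

Let card_mixed N M : (N <= M)%N ->
  (#|diffset (nsum M A) (nsum N A)| <= 2 ^ (D * M) * #|A|)%N.
Proof.
move=> NM; apply: leq_trans (Agrowth M).
have -> : diffset (nsum M A) (nsum M A) =
   sumset (diffset (nsum M A) (nsum N A)) (oppset (nsum (M - N) A)).
  by rewrite -{2}(subnKC NM) nsumD /diffset oppset_sum sumsetA.
by apply: card_sumset_geL; rewrite -card_gt0 card_oppset card_gt0 nsum_neq0.
Qed.

(** The iteration keeps a large set [Y], a translate of which lies in [A], such that [2 ^ j]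
    copies of [Y - Y] fit into [2 j + 1] copies of [A - A]: each stage doubles the number of
    copies of [Y - Y], while the number of copies of [A - A] grows only by two. *)
Definition stage j Y := [/\ 0 \in Y, exists a, sumset [set a] Y \subset A,
  nsum (2 ^ j) (diffset Y Y) \subset diffset (nsum (2 * j).+1 A) (nsum (2 * j).+1 A) &
  (#|A| <= 2 ^ (40000 * D ^ 2 * j.+1 ^ 2 * 2 ^ j) * #|Y|)%N].

Let shift_inv a Y : sumset [set a] (sumset [set - a] Y) = Y.
Proof.
rewrite sumsetA; have -> : sumset [set a] [set - a] = [set 0].
  by apply/setP => u; apply/sumsetP/set1P => [[x [y [/set1P -> /set1P -> ->]]]|->];
    [rewrite subrr|exists a, (- a); rewrite !set11 subrr].
by rewrite sum0set.
Qed.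

Let stage0 : exists Y, stage 0 Y.
Proof.
case/set0Pn: (A0) => a aA; exists (sumset [set - a] A); split.
- by rewrite -(addNr a) mem_sumset ?set11.
- by exists a; rewrite shift_inv.
- by rewrite diffset_shift !nsum1.
- by rewrite card_shift leq_pmull // expn_gt0.
Qed.

Let subY j Y : stage j Y -> forall i, (i <= 2 ^ j)%N -> nsum i Y \subset nsum (2 ^ j) (diffset Y Y).
Proof.
move=> [Y0 _ _ _] i ij.
have YE : Y \subset diffset Y Y by apply: subset_sumset0; rewrite mem_oppset oppr0.
apply: subset_trans (nsumSS _ YE) _; apply: nsum_mono => //.
by apply: mem0_diffset; apply/set0Pn; exists 0.
Qed.

(** The sets [A + i Y] with [i <= 2 ^ j] all have size comparable to [A], so for some [i] a
    further summand [Y] costs only a factor whose [2 ^ j]-th power is bounded. *)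
Lemma stage_sumset j Y : stage j Y ->
  exists i, [/\ (i < 2 ^ j)%N,
     (#|sumset (sumset A (nsum i Y)) Y| ^ (2 ^ j)
        <= 2 ^ (D * (2 * j).+2) * #|sumset A (nsum i Y)| ^ (2 ^ j))%N &
     (#|sumset A (nsum i Y)| <= 2 ^ (D * (2 * j).+2) * #|A|)%N].
Proof.
move=> st; have [Y0 _ hU _] := st.
have bnd i : (i <= 2 ^ j)%N -> (#|sumset A (nsum i Y)| <= 2 ^ (D * (2 * j).+2) * #|A|)%N.
  move=> ij; have hi := subset_trans (subY st ij) hU.
  apply: leq_trans (card_mixed (leqnSn _)); apply: subset_leq_card.
  by rewrite nsumS /diffset -sumsetA sumsetSS.
have [|||i ij hi] := @ratio_pigeonhole (fun i => #|sumset A (nsum i Y)|) (2 ^ j) (2 ^ (D * (2 * j).+2)).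
- by rewrite expn_gt0.
- by rewrite nsum0 sumset0.
- by rewrite nsum0 sumset0 bnd.
exists i; split => //; last by apply: bnd; apply: ltnW.
by rewrite -sumsetA (sumsetC (nsum i Y)) -nsumS.
Qed.

(** The set [X = A + i Y] of [stage_sumset] barely grows when [Y] is added, so in
    [croot_sisask] the sample size, of order [4 ^ j], costs only [2 ^ j] in the exponent of
    the size of [Z]. *)
Let stageS j Y : stage j Y -> exists Z, stage j.+1 Z.
Proof.
move=> st; have [i [ij h1 h2]] := stage_sumset st; have [Y0 [a aY] hU hA] := st.
set X := sumset A (nsum i Y) in h1 h2.
have Yne : Y != set0 by apply/set0Pn; exists 0.
have X0 : X != set0 by rewrite sumset_neq0 // nsum_neq0.
have E0 : 0 \in diffset Y Y by apply: mem0_diffset.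
have XX : diffset X X \subset sumset (diffset A A) (diffset (nsum (2 * j).+1 A) (nsum (2 * j).+1 A)).
  rewrite diffset_sum sumsetSS // -nsum_diff; apply: subset_trans hU.
  by apply: nsum_mono => //; apply: ltnW.
set s := (D * (2 * j).+3)%N.
have s0 : (0 < s)%N by rewrite muln_gt0 D0.
have ks : (0 < 2 ^ j.+1 <= 2 ^ s)%N.
  by rewrite expn_gt0 leq_exp2l //= /s; nia.
have hV : (#|sumset (diffset X X) A| <= 2 ^ s * #|A|)%N.
  apply: leq_trans (card_mixed (leqnSn _)); apply: subset_leq_card.
  apply: subset_trans (sumsetSS XX (subxx A)) _.
  rewrite -diffset_sum -!nsumS (nsumS (2 * j).+2 A) (sumsetC A).
  by rewrite /diffset sumsetAC.
have [Z [ZY hZ kZ]] := @croot_sisask R G X A Y (2 ^ j.+1) s X0 A0 Yne ks s0 hV.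
have pX : (0 < #|X|)%N by rewrite card_gt0.
have mE : (1536 * (2 ^ j.+1) ^ 2 * s = 2 ^ j * (6144 * 2 ^ j * s))%N.
  by rewrite (expnS 2 j); ring.
set m' := (6144 * 2 ^ j * s)%N in mE.
have hZ' : (#|Y| <= 2 ^ (D * (2 * j).+2 * m').+1 * #|Z|)%N.
  have pXm : (0 < #|X| ^ (2 ^ j * m'))%N by rewrite expn_gt0 pX.
  rewrite -(leq_pmul2r pXm); rewrite mE in hZ; apply: leq_trans hZ _.
  have h3 : (#|sumset X Y| ^ (2 ^ j * m') <= 2 ^ (D * (2 * j).+2 * m') * #|X| ^ (2 ^ j * m'))%N.
    rewrite !(expnM _ _ m') -expnMn; case: (m') => // m0; by rewrite leq_exp2r.
  apply: leq_trans (leq_mul (leqnn (2 * #|Z|)) h3) _.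
  by rewrite expnS leq_eqVlt; apply/orP; left; apply/eqP; ring.
have [z zZ] : exists z, z \in Z.
  apply/set0Pn; apply: contraTneq hZ' => ->; rewrite cards0 muln0 leqn0.
  by rewrite -lt0n card_gt0.
exists (sumset [set - z] Z); split.
- by rewrite -(addNr z) mem_sumset ?set11.
- exists (a + z); apply: subset_trans aY.
  have -> : [set a + z] = sumset [set a] [set z].
    by apply/setP => u; apply/set1P/sumsetP => [->|[x [y [/set1P -> /set1P -> ->]]] //];
      exists a, z; rewrite !set11.
  by rewrite -sumsetA shift_inv sumsetSS.
- rewrite diffset_shift; apply: subset_trans kZ _.
  have -> : (2 * j.+1).+1 = (2 * j).+3 by rewrite mulnS.
  apply: subset_trans (sumsetSS XX (subxx _)) _.
  by rewrite -!diffset_sum -!nsumS sumsetC -nsumS.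
- rewrite card_shift; apply: leq_trans hA _.
  apply: leq_trans (leq_mul (leqnn _) hZ') _.
  rewrite mulnA -expnD leq_mul2r leq_exp2l //; apply/orP; right.
  rewrite /m' /s (expnS 2 j).
  move: (2 ^ j)%N (expn_gt0 2 j) => q q0.
  have D2 : (D ^ 2 = D * D)%N by rewrite mulnn.
  have j2 : (j.+2 ^ 2 = j.+2 * j.+2)%N by rewrite mulnn.
  have j1 : (j.+1 ^ 2 = j.+1 * j.+1)%N by rewrite mulnn.
  rewrite D2 j2 j1.
  have h4 : (0 < D * D * q)%N by rewrite !muln_gt0 D0 q0.
  have -> : (D * (2 * j).+2 * (6144 * q * (D * (2 * j).+3)) = D * D * q * (6144 * ((2 * j).+2 * (2 * j).+3)))%N by ring.
  have -> : (40000 * (D * D) * (j.+1 * j.+1) * q = D * D * q * (40000 * (j.+1 * j.+1)))%N by ring.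
  have -> : (40000 * (D * D) * (j.+2 * j.+2) * (2 * q) = D * D * q * (2 * (40000 * (j.+2 * j.+2))))%N by ring.
  move: (D * D * q)%N h4 => w w0.
  have c1 : (6 * 6144 < 40000)%N by [].
  move: c1; move: 40000%N 6144%N => c2 c1 c12.
  have h5 : (c2 * (j.+1 * j.+1) + c1 * ((2 * j).+2 * (2 * j).+3) + 1 <= 2 * (c2 * (j.+2 * j.+2)))%N.
    have e1 : ((2 * j).+2 * (2 * j).+3 <= 6 * (j.+1 * j.+1))%N by clear; nia.
    have e2 : (j.+1 * j.+1 <= j.+2 * j.+2)%N by rewrite leq_mul.
    have e3 : (0 < j.+1 * j.+1)%N by [].
    move: e1 e2 e3; move: (_ * (2 * j).+3)%N (j.+1 * j.+1)%N (j.+2 * j.+2)%N => x1 y1 z1 e1 e2 e3.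
    have := leq_mul (leqnn c1) e1; have := leq_mul c12 (leqnn y1); have := leq_mul (leqnn c2) e2.
    clear -e3; lia.
  apply: leq_trans (leq_mul (leqnn w) h5); rewrite !mulnDr muln1 -addnA leq_add2l.
  by rewrite -addn1 leq_add2l.
Qed.

Lemma stage_exists j : exists Y, stage j Y.
Proof. by elim: j => [//|j [Y /stageS]]. Qed.

(** At stage [n] a summand [Y] costs so little in [stage_sumset] that [plunnecke_ruzsa] keeps
    the iterated sumsets of [Y] below the threshold of [covering_growth]. *)
Lemma bohr_structure n : (16 * (D * (2 * n).+2) <= 2 ^ n)%N ->
  exists Y a, [/\ 0 \in Y, sumset [set a] Y \subset A,
    (#|A| <= 2 ^ (40000 * D ^ 2 * n.+1 ^ 2 * 2 ^ n) * #|Y|)%N &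
    forall k, (#|nsum k (diffset Y Y)| <=
       #|diffset Y Y| * (2 * k).+1 ^ (2 ^ n.+1 * (40000 * D ^ 2 * n.+1 ^ 2).+1))%N].
Proof.
move=> hn; have [Y st] := stage_exists n.
have [i [_ h1 h2]] := stage_sumset st; have [Y0 [a aY] _ hA] := st.
set X := sumset A (nsum i Y) in h1 h2; set M := (D * (2 * n).+2)%N in hn h1 h2.
have Yne : Y != set0 by apply/set0Pn; exists 0.
have X0 : X != set0 by rewrite sumset_neq0 // nsum_neq0.
set ell := (40000 * D ^ 2 * n.+1 ^ 2)%N in hA *.
exists Y, a; split => //.
set r := (2 ^ n.+1 * ell.+1)%N.
have N_E : (4 * r = 2 ^ n * (8 * ell.+1))%N by rewrite /r expnS; ring.
have r0 : (0 < r)%N by rewrite muln_gt0 expn_gt0.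
apply: (@covering_growth _ Y (4 * r)%N) => //; first by rewrite ltn_pmul2r.
have h3 := plunnecke_ruzsa Y (4 * r)%N X0.
have pX : (0 < #|X| ^ (2 * (4 * r)))%N by rewrite expn_gt0 card_gt0 X0.
have h4 : (#|diffset (nsum (4 * r) Y) (nsum (4 * r) Y)| <= 2 ^ (M * (2 * (8 * ell.+1))) * #|X|)%N.
  rewrite -(leq_pmul2r pX); apply: leq_trans h3 _.
  rewrite mulnAC leq_mul2r; apply/orP; right.
  have -> : (2 * (4 * r) = 2 ^ n * (2 * (8 * ell.+1)))%N by rewrite N_E; ring.
  rewrite !(expnM _ _ (2 * (8 * ell.+1))) -expnMn leq_exp2r //.
apply: leq_ltn_trans h4 _.
apply: leq_ltn_trans (leq_mul (leqnn _) h2) _.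
apply: leq_ltn_trans (leq_mul (leqnn _) (leq_mul (leqnn _) hA)) _.
rewrite !mulnA -!expnD ltn_pmul2r ?card_gt0 // ltn_exp2l // /r expnS.
have := expn_gt0 2 n; move: (2 ^ n)%N hn => q hn q0; nia.
Qed.
End Konyagin.

Local Open Scope complex_scope.
Local Notation Re := complex.Re.
Local Notation Im := complex.Im.

(** * Moduli of complex numbers *)

Section Modulus.
Variable R : realType.
Local Notation C := (complex R).
Implicit Types (z w : C).

Lemma cabs_ge0 z : 0 <= cabs z.
Proof. by case: z => a b; rewrite sqrtr_ge0. Qed.

Lemma cabsE z : cabs z ^+ 2 = Re z ^+ 2 + Im z ^+ 2.
Proof. by case: z => a b /=; rewrite sqr_sqrtr // addr_ge0 ?sqr_ge0. Qed.

Lemma cabsM z w : cabs (z * w) = cabs z * cabs w.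
Proof. exact: ComplexField.Normc.normcM. Qed.

Lemma cabsD z w : cabs (z + w) <= cabs z + cabs w.
Proof. exact: le_normcD. Qed.

Lemma cabs0 : cabs (0 : C) = 0. Proof. exact: ComplexField.Normc.normc0. Qed.
Lemma cabs1 : cabs (1 : C) = 1. Proof. exact: ComplexField.Normc.normc1. Qed.
Lemma cabsN z : cabs (- z) = cabs z. Proof. exact: normcN. Qed.
Lemma cabsV z : cabs z^-1 = (cabs z)^-1. Proof. exact: ComplexField.Normc.normcV. Qed.

Lemma cabsB z w : cabs (z - w) <= cabs z + cabs w.
Proof. by rewrite -(cabsN w) cabsD. Qed.

Lemma cabs_eq0 z : (cabs z == 0) = (z == 0).
Proof.
by apply/eqP/eqP => [/ComplexField.Normc.eq0_normc|->] //; rewrite cabs0.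
Qed.

Lemma cabsX z n : cabs (z ^+ n) = cabs z ^+ n.
Proof. by elim: n => [|n IH]; rewrite ?expr0 ?cabs1 // !exprS cabsM IH. Qed.

Lemma cabs_real (x : R) : cabs (x%:C) = `|x|.
Proof. by rewrite /= expr0n addr0 sqrtr_sqr. Qed.

Lemma cabs_nat n : cabs (n%:R : C) = n%:R.
Proof.
have -> : (n%:R : C) = (n%:R : R)%:C by rewrite rmorph_nat.
by rewrite cabs_real ger0_norm.
Qed.

Lemma cabs_conj z : cabs (conjc z) = cabs z.
Proof. by case: z => a b; rewrite /= sqrrN. Qed.

Lemma cabs_sum (I : Type) (r : seq I) (P : pred I) (F : I -> C) :
  cabs (\sum_(i <- r | P i) F i) <= \sum_(i <- r | P i) cabs (F i).
Proof.
elim/big_rec2: _ => [|i x y _ h]; first by rewrite cabs0.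
by apply: le_trans (cabsD _ _) _; rewrite lerD2l.
Qed.

Lemma Re_le_cabs z : Re z <= cabs z.
Proof.
apply: le_trans (ler_norm _) _; rewrite -(ler_pXn2r (n := 2)) ?nnegrE ?cabs_ge0 //.
by rewrite cabsE real_normK ?num_real // lerDl sqr_ge0.
Qed.

Lemma Re_ge_Ncabs z : - cabs z <= Re z.
Proof. by rewrite lerNl; have := Re_le_cabs (- z); rewrite cabsN; case: z. Qed.

Lemma mul_conj z : z * conjc z = (cabs z ^+ 2)%:C.
Proof. by rewrite cabsE; case: z => a b; apply/eqP; rewrite eq_complex /=; apply/andP; split; apply/eqP; ring. Qed.

Lemma cReD z w : Re (z + w) = Re z + Re w. Proof. by case: z; case: w. Qed.
Lemma cReN z : Re (- z) = - Re z. Proof. by case: z. Qed.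
Lemma cRe_conj z : Re (conjc z) = Re z. Proof. by case: z. Qed.
Lemma cRe_realM (x : R) z : Re (x%:C * z) = x * Re z.
Proof. by case: z => a b /=; rewrite mul0r subr0. Qed.

Lemma cRe_sum (I : Type) (r : seq I) (P : pred I) (F : I -> C) :
  Re (\sum_(i <- r | P i) F i) = \sum_(i <- r | P i) Re (F i).
Proof. by elim/big_rec2: _ => [//|i x y _ <-]; rewrite cReD. Qed.

(** The factor that rotates [z] to its modulus; it is [0] at [0], so that [phase] of a
    function has the same support as the function. *)
Definition phase z : C := if z == 0 then 0 else conjc z / (cabs z)%:C.

Lemma phaseM z : z * phase z = (cabs z)%:C.
Proof.
rewrite /phase; case: eqVneq => [->|z0]; first by rewrite mulr0 cabs0.
rewrite mulrA mul_conj expr2 rmorphM mulfK //.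
by rewrite -cabs_eq0 cabs_real normr_eq0 cabs_eq0.
Qed.

Lemma phase_le1 z : cabs (phase z) <= 1.
Proof.
rewrite /phase; case: eqVneq => [_|z0]; first by rewrite cabs0.
rewrite cabsM cabs_conj cabsV cabs_real ger0_norm ?cabs_ge0 // divff //.
by rewrite cabs_eq0.
Qed.

(** Parseval's identity for any orthogonal system of functions. *)
Lemma parseval_gen (I J : finType) (e : I -> J -> C) (n : R) (a : I -> C) :
  (forall i i', \sum_j e i j * conjc (e i' j) = if i == i' then n%:C else 0) ->
  \sum_j cabs (\sum_i a i * e i j) ^+ 2 = n * \sum_i cabs (a i) ^+ 2.
Proof.
move=> orth; apply: complexI; rewrite rmorph_sum rmorphM rmorph_sum /=.
under eq_bigr => j _ do rewrite -mul_conj rmorph_sum big_distrlr /=.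
rewrite exchange_big mulr_sumr /=; apply: eq_bigr => i _.
rewrite exchange_big /= (bigD1 i) //= [X in _ + X]big1 => [|i' ne].
  under eq_bigr => j _ do rewrite rmorphM mulrACA.
  by rewrite -mulr_sumr orth eqxx -mul_conj addr0 mulrC.
under eq_bigr => j _ do rewrite rmorphM mulrACA.
by rewrite -mulr_sumr orth eq_sym (negbTE ne) mulr0.
Qed.

Lemma cauchy_schwarz (I : finType) (a b : I -> R) :
  (\sum_i a i * b i) ^+ 2 <= (\sum_i a i ^+ 2) * (\sum_i b i ^+ 2).
Proof.
have h : 0 <= \sum_i \sum_j (a i * b j - a j * b i) ^+ 2.
  by apply: sumr_ge0 => i _; apply: sumr_ge0 => j _; apply: sqr_ge0.
have E : \sum_i \sum_j (a i * b j - a j * b i) ^+ 2 =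
   2 * ((\sum_i a i ^+ 2) * (\sum_i b i ^+ 2)) - 2 * (\sum_i a i * b i) ^+ 2.
  under eq_bigr => i _. 
    under eq_bigr => j _.
      rewrite (_ : _ ^+ 2 = a i ^+ 2 * b j ^+ 2 + b i ^+ 2 * a j ^+ 2 - 2 * ((a i * b i) * (a j * b j))); last by ring.
      over.
    rewrite sumrB big_split /= -!mulr_sumr; over.
  rewrite sumrB big_split /= -!mulr_suml -mulr_sumr -mulr_suml. ring.
lra.
Qed.
End Modulus.

(** * Roots of unity and characters of the prime field *)

Section Roots.
Variable R : realType.
Local Notation C := (complex R).

Lemma expiD (a b : R) : expi (a + b) = expi a * expi b.
Proof.
apply/eqP; rewrite eq_complex /= cosD sinD; apply/andP; split; apply/eqP => //.
by rewrite addrC (mulrC (sin a)).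
Qed.

Lemma expi0 : expi (0 : R) = 1.
Proof. by rewrite /expi cos0 sin0. Qed.

Lemma expiN (a : R) : expi (- a) = conjc (expi a).
Proof. by rewrite /expi cosN sinN. Qed.

Lemma cabs_expi (a : R) : cabs (expi a) = 1.
Proof. by rewrite /= cos2Dsin2 sqrtr1. Qed.

Lemma expiX (a : R) n : expi a ^+ n = expi (n%:R * a).
Proof.
elim: n => [|n IH]; first by rewrite mul0r expi0.
by rewrite exprS IH -expiD -natr1 mulrDl mul1r addrC.
Qed.

Lemma conj_unimod (z : C) : cabs z = 1 -> conjc z = z^-1.
Proof.
move=> z1; have z0 : z != 0 by rewrite -cabs_eq0 z1 oner_eq0.
by apply: (mulfI z0); rewrite divff // mul_conj z1 expr1n.
Qed.

Definition zeta N : C := expi (2 * pi / N%:R).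

Lemma cabs_zeta N : cabs (zeta N) = 1. Proof. exact: cabs_expi. Qed.

Lemma zeta_neq0 N : zeta N != 0.
Proof. by rewrite -cabs_eq0 cabs_zeta oner_eq0. Qed.

Lemma zetaN N : (0 < N)%N -> zeta N ^+ N = 1.
Proof.
move=> N0; rewrite expiX mulrC divfK; last by rewrite pnatr_eq0 -lt0n.
by rewrite /expi mulr_natl cos2pi sin2pi.
Qed.

Lemma zeta_mod N n : (0 < N)%N -> zeta N ^+ (n %% N) = zeta N ^+ n.
Proof.
move=> N0; rewrite {2}(divn_eq n N) exprD mulnC exprM zetaN // expr1n mul1r.
by [].
Qed.

(** A root of unity equal to [1] would be [expi (2 t)] with [sin t = 0] and [0 < t < pi]. *)
Lemma zeta_neq1 N j : (0 < j < N)%N -> zeta N ^+ j != 1.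
Proof.
move=> /andP[j0 jN]; have N0 : (0 < N)%N by apply: leq_ltn_trans jN.
rewrite expiX; apply/negP => /eqP[+ _].
have -> : j%:R * (2 * pi / N%:R) = (j%:R / N%:R * pi) *+ 2 :> R by rewrite mulr2n; ring.
rewrite cos_mulr2n => h.
have s0 : sin (j%:R / N%:R * pi) = 0 :> R.
  apply/eqP; rewrite -sqrf_eq0 sin2cos2; apply/eqP; move: h; rewrite mulr2n; lra.
have : 0 < sin (j%:R / N%:R * pi : R).
  apply: sin_gt0_pi; rewrite mulr_gt0 ?pi_gt0 ?divr_gt0 ?ltr0n //=.
  by rewrite gtr_pMl ?pi_gt0 // ltr_pdivrMr ?ltr0n // mul1r ltr_nat.
by rewrite s0 ltxx.
Qed.

Lemma sum_zeta N j : (0 < N)%N ->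
  \sum_(k < N) (zeta N ^+ j) ^+ k = if (N %| j)%N then N%:R else 0 :> C.
Proof.
move=> N0; case: ifP => dv.
  have -> : zeta N ^+ j = 1 by rewrite -zeta_mod // (eqP dv).
  by under eq_bigr do rewrite expr1n; rewrite sumr_const card_ord.
have z1 : zeta N ^+ j != 1.
  by rewrite -zeta_mod // zeta_neq1 // lt0n ltn_mod N0 -/(N %| j)%N dv.
have : (zeta N ^+ j - 1) * \sum_(k < N) (zeta N ^+ j) ^+ k = 0.
  by rewrite -subrX1 -exprM mulnC exprM zetaN // expr1n subrr.
by move/eqP; rewrite mulf_eq0 subr_eq0 (negbTE z1) => /eqP.
Qed.

Lemma zeta_orth N (i i' : 'I_N) :
  \sum_(k < N) zeta N ^+ (i * k) * conjc (zeta N ^+ (i' * k)) = if i == i' then (N%:R : R)%:C else 0.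
Proof.
have N0 : (0 < N)%N by apply: leq_ltn_trans (ltn_ord i).
transitivity (\sum_(k < N) (zeta N ^+ (i + (N - i'))) ^+ k).
  apply: eq_bigr => k _; rewrite conj_unimod; last by rewrite cabsX cabs_zeta expr1n.
  rewrite -exprM mulnDl exprD; congr (_ * _).
  apply: (mulfI (expf_neq0 (i' * k) (zeta_neq0 N))).
  rewrite divff ?expf_neq0 ?zeta_neq0 // -exprD -mulnDl subnKC; last by apply: ltnW.
  by rewrite exprM zetaN // expr1n.
rewrite sum_zeta // rmorph_nat; congr (if _ then _ else _).
apply/idP/eqP => [|->]; last by rewrite subnKC ?dvdnn // ltnW.
move=> dv; apply/val_inj => /=.
have : (i + (N - i') == 0 + 0 %[mod N])%N by rewrite mod0n.
have := ltn_ord i; have := ltn_ord i'; move: dv => /dvdnP[q hq] h1 h2 _.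
by case: q hq => [|[|q]]; nia.
Qed.

Lemma parseval_zeta N (a : 'I_N -> C) :
  \sum_(k < N) cabs (\sum_(i < N) a i * zeta N ^+ (i * k)) ^+ 2 = N%:R * \sum_i cabs (a i) ^+ 2.
Proof. by apply: parseval_gen => i i'; apply: zeta_orth. Qed.

End Roots.
Arguments zeta {R} N.

Section Characters.
Variables (R : realType) (p : nat).
Hypothesis p_pr : prime p.
Local Notation C := (complex R).
Implicit Types (x y h g : 'F_p) (f phi : 'F_p -> C).

Let p_gt0 : (0 < p)%N. Proof. exact: prime_gt0. Qed.
Let pR_neq0 : (p%:R : R) != 0. Proof. by rewrite pnatr_eq0 -lt0n. Qed.
Let pC_neq0 : (p%:R : C) != 0. Proof. by rewrite pnatr_eq0 -lt0n. Qed.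

Lemma val_FpD x y : val (x + y) = ((val x + val y) %% p)%N.
Proof. by congr (_ %% _)%N; apply: Fp_cast. Qed.

Lemma val_FpM x y : val (x * y) = ((val x * val y) %% p)%N.
Proof. by congr (_ %% _)%N; apply: Fp_cast. Qed.

Lemma val_Fp_lt x : (val x < p)%N.
Proof. by have := ltn_ord x; rewrite {2}(Fp_cast p_pr). Qed.

Definition chi x : C := zeta p ^+ val x.

Lemma chiD x y : chi (x + y) = chi x * chi y.
Proof. by rewrite /chi val_FpD zeta_mod // exprD. Qed.

Lemma chi0 : chi 0 = 1. Proof. by rewrite /chi expr0. Qed.

Lemma cabs_chi x : cabs (chi x) = 1.
Proof. by rewrite cabsX cabs_zeta expr1n. Qed.

Lemma chi_neq0 x : chi x != 0.
Proof. by rewrite -cabs_eq0 cabs_chi oner_eq0. Qed.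

Lemma chiN x : chi (- x) = conjc (chi x).
Proof.
rewrite conj_unimod ?cabs_chi //; apply: (mulfI (chi_neq0 x)).
by rewrite -chiD subrr chi0 divff // chi_neq0.
Qed.

Lemma chi_neq1 x : x != 0 -> chi x != 1.
Proof.
move=> x0; apply: zeta_neq1; rewrite val_Fp_lt andbT lt0n.
by apply: contra x0 => /eqP h; apply/eqP/val_inj.
Qed.

Lemma sum_chi x : \sum_y chi (y * x) = if x == 0 then p%:R else 0.
Proof.
case: eqVneq => [->|x0].
  under eq_bigr do rewrite mulr0 chi0.
  by rewrite sumr_const card_Fp.
have : (chi x - 1) * \sum_y chi (y * x) = 0.
  rewrite mulrBl mul1r mulr_sumr.
  rewrite [X in _ - X](reindex_inj (addIr 1)) /= -sumrB big1 // => y _.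
  by rewrite mulrDl mul1r chiD mulrC subrr.
by move/eqP; rewrite mulf_eq0 subr_eq0 (negbTE (chi_neq1 x0)) => /eqP.
Qed.

Lemma chi_orth x y : \sum_g chi (g * x) * conjc (chi (g * y)) = if x == y then (p%:R : R)%:C else 0.
Proof.
under eq_bigr => g _ do rewrite -chiN -chiD -mulrBr.
by rewrite sum_chi subr_eq0 rmorph_nat.
Qed.

(** The transform of a test function, unnormalised and with the sign opposite to that of
    [fourier]: this is what [fourier] is paired with. *)
Definition ft phi g : C := \sum_x phi x * chi (g * x).

Lemma fourierE f g : fourier f g = p%:R^-1 * \sum_x f x * conjc (chi (g * x)).
Proof.
congr (_ * _); apply: eq_bigr => x _; congr (_ * _).
rewrite expiN /chi val_FpM zeta_mod // expiX; congr (conjc (expi _)).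
by rewrite natrM; field.
Qed.

Lemma fourier_inv f x : f x = \sum_g fourier f g * chi (g * x).
Proof.
under eq_bigr => g _ do rewrite fourierE -mulrA mulr_suml.
rewrite -mulr_sumr exchange_big (bigD1 x) //= [X in _ + X]big1 => [|y ne].
  under eq_bigr => g _ do rewrite -mulrA (mulrC (conjc _)).
  by rewrite -mulr_sumr chi_orth eqxx rmorph_nat addr0 mulrCA mulVf // mulr1.
under eq_bigr => g _ do rewrite -mulrA (mulrC (conjc _)).
by rewrite -mulr_sumr chi_orth eq_sym (negbTE ne) mulr0.
Qed.

Lemma pairing f phi : \sum_x f x * phi x = \sum_g fourier f g * ft phi g.
Proof.
under eq_bigr => x _ do rewrite (fourier_inv f x) mulr_suml.
rewrite exchange_big; apply: eq_bigr => g _; rewrite mulr_sumr; apply: eq_bigr => x _.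
by rewrite -mulrA (mulrC (phi x)).
Qed.

Lemma wiener_ge0 f : 0 <= wiener_norm f.
Proof. by apply: sumr_ge0 => g _; apply: cabs_ge0. Qed.

Lemma cabs_le_wiener f x : cabs (f x) <= wiener_norm f.
Proof.
rewrite {1}(fourier_inv f x); apply: le_trans (cabs_sum _ _ _) _.
by apply: ler_sum => g _; rewrite cabsM cabs_chi mulr1.
Qed.

Lemma max_le_wiener f : max_abs f <= wiener_norm f.
Proof. by apply: bigmax_le => [|x _]; [exact: wiener_ge0|exact: cabs_le_wiener]. Qed.

(** The dual form of the Wiener norm: a test function with a bounded transform gives a lower
    bound. *)
Lemma wiener_pairing f phi (B : R) : (forall g, cabs (ft phi g) <= B) ->
  cabs (\sum_x f x * phi x) <= wiener_norm f * B.
Proof.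
move=> hB; rewrite pairing; apply: le_trans (cabs_sum _ _ _) _.
by rewrite mulr_suml; apply: ler_sum => g _; rewrite cabsM ler_wpM2l ?cabs_ge0.
Qed.

Lemma parseval_fourier f : \sum_x cabs (f x) ^+ 2 = p%:R * \sum_g cabs (fourier f g) ^+ 2.
Proof.
rewrite -(@parseval_gen R _ _ (fun g x => chi (g * x)) p%:R (fourier f)).
  by apply: eq_bigr => x _; rewrite {1}(fourier_inv f x).
move=> g g'; rewrite -chi_orth; apply: eq_bigr => x _; by rewrite !(mulrC x).
Qed.

Lemma parseval_ft phi : \sum_g cabs (ft phi g) ^+ 2 = p%:R * \sum_x cabs (phi x) ^+ 2.
Proof.
rewrite -(@parseval_gen R _ _ (fun x g => chi (g * x)) p%:R phi) //.
by move=> x y; apply: chi_orth.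
Qed.

(** An affine change of variable permutes the frequencies and multiplies the coefficients by
    unimodular numbers. *)
Lemma wiener_affine f (a b : 'F_p) : a != 0 ->
  wiener_norm (fun x => f (a * x + b)) = wiener_norm f.
Proof.
move=> a0; rewrite /wiener_norm.
have E g : fourier (fun x => f (a * x + b)) g = fourier f (g / a) * chi (g / a * b).
  rewrite !fourierE -[RHS]mulrA; congr (_ * _); rewrite mulr_suml.
  have inj : injective (fun x => a * x + b) by move=> x y /addIr/(mulfI a0).
  rewrite [RHS](reindex_inj inj) /=; apply: eq_bigr => x _.
  rewrite -mulrA; congr (_ * _).
  rewrite -!chiN -chiD; congr chi.
  by field.
under eq_bigr => g _ do rewrite E cabsM cabs_chi mulr1.
have inj : injective (fun g : 'F_p => g * a) by move=> x y /(mulIf a0).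
rewrite (reindex_inj inj) /=; apply: eq_bigr => g _; by rewrite mulfK.
Qed.

(** The coefficients of a product are convolutions. *)
Lemma wiener_mul f phi : wiener_norm (fun x => f x * phi x) <= wiener_norm f * wiener_norm phi.
Proof.
have E g : fourier (fun x => f x * phi x) g = \sum_h fourier f h * fourier phi (g - h).
  rewrite fourierE; under eq_bigr => x _ do rewrite /= (fourier_inv f x) !mulr_suml.
  rewrite exchange_big mulr_sumr; apply: eq_bigr => h _.
  rewrite (fourierE phi) [RHS]mulrCA; congr (_ * _); rewrite mulr_sumr; apply: eq_bigr => x _.
  have -> : conjc (chi ((g - h) * x)) = conjc (chi (g * x)) * chi (h * x).
    by rewrite -!chiN -chiD; congr chi; ring.
  by ring.
rewrite {1}/wiener_norm; under eq_bigr => g _ do rewrite E.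
apply: (@le_trans _ _ (\sum_g \sum_h cabs (fourier f h) * cabs (fourier phi (g - h)))).
  apply: ler_sum => g _; apply: le_trans (cabs_sum _ _ _) _.
  by apply: ler_sum => h _; rewrite cabsM.
rewrite exchange_big /= mulr_suml; apply: ler_sum => h _; rewrite -mulr_sumr.
by rewrite [X in _ <= _ * X](reindex_inj (addIr (- h))) /= le_eqVlt eqxx.
Qed.

Lemma cabs_fourier_le f g : cabs (fourier f g) <= p%:R^-1 * \sum_x cabs (f x).
Proof.
rewrite fourierE cabsM cabsV cabs_nat ler_pM2l ?invr_gt0 ?ltr0n //.
apply: le_trans (cabs_sum _ _ _) _; apply: ler_sum => x _.
by rewrite cabsM cabs_conj cabs_chi mulr1.
Qed.
End Characters.
Arguments chi {R p} x.

(** * Additive structure in the support *)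

Section Structure.
Import mathcomp.boot.fintype mathcomp.boot.finset.
Variables (R : realType) (p : nat).
Hypothesis p_pr : prime p.
Local Notation C := (complex R).
Local Notation F := 'F_p.
Implicit Types (f : F -> C) (X Y Z S : {set F}).

Let p_gt0 : (0 < p)%N. Proof. exact: prime_gt0. Qed.

Definition ind X (x : F) : C := (x \in X)%:R.

Lemma sum_ind X (phi : F -> C) : \sum_x ind X x * phi x = \sum_(x in X) phi x.
Proof.
rewrite [RHS]big_mkcond; apply: eq_bigr => x _; rewrite /ind.
by case: (x \in X); rewrite ?mul1r ?mul0r.
Qed.

Lemma cabs_ind X x : cabs (ind X x) ^+ 2 = (x \in X)%:R.
Proof. by rewrite cabs_nat -natrX; case: (_ \in _). Qed.

Lemma sum_cabs_ind X : \sum_x cabs (ind X x) ^+ 2 = #|X|%:R.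
Proof.
under eq_bigr => x _ do rewrite cabs_ind.
by rewrite -natr_sum -sum1_card [in RHS]big_mkcond; congr (_%:R); apply: eq_bigr => x _; case: (_ \in _).
Qed.

Lemma ft_ind0 X : ft (ind X) 0 = #|X|%:R.
Proof.
rewrite /ft sum_ind; under eq_bigr do rewrite mul0r chi0.
by rewrite sumr_const.
Qed.

Lemma supp_norm2 f (k : R) : wiener_norm f <= k ->
  \sum_x cabs (f x) ^+ 2 <= k ^+ 2 * #|supp f|%:R.
Proof.
move=> fk; have k0 : 0 <= k := le_trans (wiener_ge0 f) fk.
rewrite -sum_cabs_ind mulr_sumr; apply: ler_sum => x _; rewrite cabs_ind inE.
case: eqVneq => [->|_]; first by rewrite cabs0 expr0n mulr0.
rewrite mulr1; apply: lerXn2r; rewrite ?nnegrE ?cabs_ge0 //.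
exact: le_trans (cabs_le_wiener p_pr f x) fk.
Qed.

(** Let [Fc] be the function with transform [|fourier f|], and [P] the set where it exceeds
    [1 / (2 k)].  The bound on the size of [P] is Parseval's identity.  Pairing [f] with its
    phase and applying the Cauchy-Schwarz inequality with weights [|fourier f|] gives
    [|S| ^ 2 <= k * sum of |Fc (x - y)|] over all pairs of [S]; the pairs with [x - y]
    outside [P] account for at most half of this. *)
Lemma correlation_graph f (k : nat) : (0 < k)%N -> wiener_norm f <= k%:R ->
  (forall x, x \in supp f -> 1 <= cabs (f x)) ->
  exists P : {set F}, [/\ forall x, x \in P -> - x \in P,
    (#|P| <= 4 * k ^ 4 * #|supp f|)%N &
    (#|supp f| ^ 2 <= 2 * k ^ 2 * #|[set q in setX (supp f) (supp f) | (q.1 - q.2)%R \in P]|)%N].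
Proof.
move=> k_gt0 fk f1; set S := supp f.
have kp : 0 < k%:R :> R by rewrite ltr0n.
pose a g := cabs (fourier f g).
pose Fc h : C := \sum_g (a g)%:C * chi (g * h).
pose P := [set h | 1 <= 2 * k%:R * cabs (Fc h)].
exists P.
have FN h : Fc (- h) = conjc (Fc h).
  rewrite /Fc rmorph_sum; apply: eq_bigr => g _.
  by rewrite mulrN chiN // rmorphM /= oppr0.
have Fsum : \sum_h cabs (Fc h) ^+ 2 <= k%:R ^+ 2 * #|S|%:R.
  have -> : \sum_h cabs (Fc h) ^+ 2 = p%:R * \sum_g cabs ((a g)%:C : C) ^+ 2.
    rewrite -(@parseval_gen R _ _ (fun g x => chi (g * x)) p%:R) //.
    by move=> g g'; rewrite -(chi_orth _ p_pr); apply: eq_bigr => x _; rewrite !(mulrC x).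
  under eq_bigr => g _ do rewrite cabs_real ger0_norm ?cabs_ge0 // /a.
  by rewrite -parseval_fourier //; apply: supp_norm2.
have Fle h : cabs (Fc h) <= k%:R.
  apply: le_trans fk; apply: le_trans (cabs_sum _ _ _) _; apply: ler_sum => g _.
  by rewrite cabsM cabs_chi // mulr1 cabs_real ger0_norm ?cabs_ge0.
split.
- by move=> h; rewrite !inE FN cabs_conj.
- rewrite -(ler_nat R) natrM natrM natrX.
  have h1 : #|P|%:R <= \sum_h (2 * k%:R * cabs (Fc h)) ^+ 2.
    rewrite -sum_cabs_ind; apply: ler_sum => h _; rewrite cabs_ind inE.
    case: (leP 1 (2 * k%:R * cabs (Fc h))) => [h1|_]; last exact: sqr_ge0.
    by rewrite -[1%:R](expr1n _ 2) lerXn2r ?nnegrE ?mulr_ge0 ?cabs_ge0.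
  apply: le_trans h1 _; under eq_bigr => h _ do rewrite exprMn.
  rewrite -mulr_sumr; apply: le_trans (ler_wpM2l _ Fsum) _; first exact: sqr_ge0.
  by rewrite le_eqVlt; apply/orP; left; apply/eqP; ring.
pose u x := phase (f x).
have Su : #|S|%:R <= \sum_g a g * cabs (ft u g).
  apply: (@le_trans _ _ (Re (\sum_x f x * u x))).
    rewrite cRe_sum -sum_cabs_ind; apply: ler_sum => x _; rewrite cabs_ind /u phaseM /=.
    by case: (boolP (x \in S)) => [/f1|_] //; rewrite cabs_ge0.
  rewrite pairing //; apply: le_trans (Re_le_cabs _) _; apply: le_trans (cabs_sum _ _ _) _.
  by apply: ler_sum => g _; rewrite cabsM.
have uS x : x \notin S -> u x = 0 by rewrite inE negbK /u /phase => ->.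
have sqa g : Num.sqrt (a g) * Num.sqrt (a g) = a g by rewrite -expr2 sqr_sqrtr ?cabs_ge0.
have S2 : #|S|%:R ^+ 2 <= k%:R * \sum_(x in S) \sum_(y in S) cabs (Fc (x - y)).
  apply: (@le_trans _ _ ((\sum_g Num.sqrt (a g) * (Num.sqrt (a g) * cabs (ft u g))) ^+ 2)).
    rewrite lerXn2r ?nnegrE ?sumr_ge0 //.
      by move=> g _; rewrite !mulr_ge0 ?sqrtr_ge0 ?cabs_ge0.
    by rewrite (eq_bigr (fun g => a g * cabs (ft u g))) // => g _; rewrite mulrA sqa.
  apply: le_trans (cauchy_schwarz _ _) _.
  under eq_bigr => g _ do rewrite expr2 sqa.
  under [X in _ * X <= _]eq_bigr => g _ do rewrite exprMn expr2 sqa.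
  apply: ler_pM => //; [by apply: sumr_ge0 => g _; apply: cabs_ge0| |].
    by apply: sumr_ge0 => g _; rewrite mulr_ge0 ?cabs_ge0 ?sqr_ge0.
  have -> : \sum_g a g * cabs (ft u g) ^+ 2 =
      Re (\sum_(x in S) \sum_(y in S) u x * conjc (u y) * Fc (x - y)).
    transitivity (Re (\sum_g (a g)%:C * (ft u g * conjc (ft u g)))).
      by rewrite cRe_sum; apply: eq_bigr => g _; rewrite mul_conj -rmorphM.
    congr (Re _).
    have ftS g : ft u g = \sum_(x in S) u x * chi (g * x).
      rewrite /ft [RHS]big_mkcond; apply: eq_bigr => x _.
      by case: ifPn => // /uS ->; rewrite mul0r.
    under eq_bigr => g _ do rewrite ftS rmorph_sum big_distrlr mulr_sumr /=.
    rewrite exchange_big; apply: eq_bigr => x _.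
    under eq_bigr => g _ do rewrite mulr_sumr.
    rewrite exchange_big; apply: eq_bigr => y _; rewrite /Fc mulr_sumr.
    apply: eq_bigr => g _; rewrite mulrBr chiD // chiN // rmorphM /=; ring.
  apply: le_trans (Re_le_cabs _) _; apply: le_trans (cabs_sum _ _ _) _.
  apply: ler_sum => x _; apply: le_trans (cabs_sum _ _ _) _.
  apply: ler_sum => y _; rewrite !cabsM cabs_conj.
  rewrite -[leRHS]mul1r ler_wpM2r ?cabs_ge0 // -[leRHS]mul1r.
  by rewrite ler_pM ?cabs_ge0 ?phase_le1.
rewrite -(ler_nat R) natrM natrM !natrX; set N := #|[set q in _ | _]|.
have S3 : \sum_(x in S) \sum_(y in S) cabs (Fc (x - y)) <=
   k%:R * N%:R + (2 * k%:R)^-1 * #|S|%:R ^+ 2.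
  have -> : N%:R = \sum_(x in S) \sum_(y in S) (((x - y) \in P)%:R : R).
    rewrite pair_big /= /N -sum1_card natr_sum big_mkcond [RHS]big_mkcond /=.
    apply: eq_bigr => -[x y] _; rewrite inE in_setX /=. by case: ((x \in S) && (y \in S)) => //=; case: (x - y \in P).
  have -> : (2 * k%:R)^-1 * #|S|%:R ^+ 2 = \sum_(x in S) \sum_(y in S) ((2 * k%:R)^-1 : R).
    by rewrite !sumr_const -mulrnA -[RHS]mulr_natr natrM; ring.
  rewrite mulr_sumr -big_split; apply: ler_sum => x _; rewrite mulr_sumr -big_split /=.
  apply: ler_sum => y _; rewrite inE; case: (leP 1 (2 * k%:R * cabs (Fc (x - y)))) => h.
    by rewrite mulr1; apply: le_trans (Fle _) _; rewrite lerDl invr_ge0 mulr_ge0.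
  rewrite mulr0 add0r -[leRHS]mul1r ler_pdivlMr ?mulr_gt0 // mulrC; exact: ltW.
have := le_trans S2 (ler_wpM2l (ltW kp) S3).
have -> : k%:R * (k%:R * N%:R + (2 * k%:R)^-1 * #|S|%:R ^+ 2) =
  k%:R ^+ 2 * N%:R + #|S|%:R ^+ 2 / 2 :> R by field; rewrite gt_eqF.
lra.
Qed.
End Structure.

(** * Concentration of a structured set under a dilation *)

Lemma cabs_sub1_sqr (R : realType) (z : complex R) : cabs z = 1 ->
  cabs (1 - z) ^+ 2 = 2 * (1 - Re z).
Proof.
move=> z1; have : cabs z ^+ 2 = 1 by rewrite z1 expr1n.
rewrite !cabsE; case: z {z1} => a b /= h.
have -> : (1 - a) ^+ 2 + (0 - b) ^+ 2 = 1 - 2 * a + (a ^+ 2 + b ^+ 2) by ring.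
by rewrite h; ring.
Qed.

Lemma Re_zeta_obtuse (R : realType) N v : (0 < N)%N -> (N <= 4 * v)%N -> (2 * v <= N)%N ->
  Re (zeta N ^+ v : complex R) <= 0.
Proof.
move=> N0 h1 h2; rewrite expiX /=.
have Np : 0 < N%:R :> R by rewrite ltr0n.
have -> : v%:R * (2 * pi / N%:R) = (v%:R * 4 - N%:R) / N%:R * (pi / 2) + pi / 2 :> R.
  by field; rewrite gt_eqF.
rewrite cosDpihalf oppr_le0; apply: sin_ge0_pi.
have pi0 := pi_gt0 R.
have q0 : 0 <= (v%:R * 4 - N%:R) / N%:R :> R.
  by rewrite divr_ge0 ?(ltW Np) // subr_ge0 -natrM ler_nat mulnC.
have q1 : (v%:R * 4 - N%:R) / N%:R <= 1 :> R.
  rewrite ler_pdivrMr // mul1r lerBlDr -natrD -natrM ler_nat; lia.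
apply/andP; split; first by rewrite mulr_ge0 // divr_ge0 // ltW.
by apply: (@le_trans _ _ (1 * (pi / 2))); [rewrite ler_pM2r // divr_gt0|lra].
Qed.

(** A quadratic lower bound for [1 - cos] that needs no calculus: some multiple [j v] of [v] has
    a nonpositive cosine, hence [zeta ^ (j v)] is far from [1], and the distance of a power
    [z ^ j] from [1] is at most [j] times that of [z]. *)
Lemma one_sub_Re_zeta (R : realType) N v w : (0 < w)%N -> (w <= v)%N -> (v + w <= N)%N ->
  4 * (w%:R / N%:R) ^+ 2 <= 1 - Re (zeta N ^+ v : complex R).
Proof.
move=> w0; wlog vN : v / (2 * v <= N)%N => [hw wv vw|wv _].
  have [h|h] := leqP (2 * v) N; first exact: hw.
  have vN : (v <= N)%N by apply: leq_trans vw; rewrite leq_addr.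
  have := hw (N - v)%N; have -> : Re (zeta N ^+ (N - v) : complex R) = Re (zeta N ^+ v : complex R).
    rewrite -(cRe_conj (zeta N ^+ v)) conj_unimod; last by rewrite cabsX cabs_zeta expr1n.
    have N0 : (0 < N)%N by lia.
    congr (Re _); apply: (mulfI (expf_neq0 v (zeta_neq0 R N))).
    by rewrite -exprD subnKC // zetaN // divff // expf_neq0 // zeta_neq0.
  by apply; lia.
have v0 : (0 < v)%N by apply: leq_trans wv.
have N0 : (0 < N)%N by lia.
have Np : 0 < N%:R :> R by rewrite ltr0n.
have [h|h] := leqP N (4 * v).
  have h1 := Re_zeta_obtuse R N0 h vN.
  have h2 : w%:R / N%:R <= 1 / 2 :> R.
    rewrite ler_pdivrMr // mul1r; have : (2 * w)%:R <= N%:R :> R by rewrite ler_nat; lia.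
    by rewrite natrM; lra.
  have h3 : 0 <= w%:R / N%:R :> R by rewrite divr_ge0.
  nra.
pose j := (N %/ (4 * v)).+1.
have jN : (N <= 4 * (v * j))%N.
  by rewrite mulnA mulnC ltnW // /j ltn_ceil ?muln_gt0.
have jN2 : (2 * (v * j) <= N)%N.
  have := leq_trunc_div N (4 * v); rewrite /j mulnS => h1; nia.
have h1 := Re_zeta_obtuse R N0 jN jN2.
set z : complex R := zeta N ^+ v.
have z1 : cabs z = 1 by rewrite cabsX cabs_zeta expr1n.
have h2 : cabs (1 - z ^+ j) <= j%:R * cabs (1 - z).
  rewrite -opprB cabsN subrX1 -opprB mulNr cabsN cabsM mulrC ler_wpM2r ?cabs_ge0 //.
  apply: le_trans (cabs_sum _ _ _) _.
  apply: (@le_trans _ _ (\sum_(i < j) 1)); last by rewrite sumr_const card_ord.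
  by apply: ler_sum => i _; rewrite cabsX z1 expr1n.
have h3 : cabs (1 - z ^+ j) ^+ 2 <= (j%:R * cabs (1 - z)) ^+ 2.
  by rewrite lerXn2r ?nnegrE ?mulr_ge0 ?cabs_ge0.
have zj1 : cabs (z ^+ j) = 1 by rewrite cabsX z1 expr1n.
rewrite exprMn (cabs_sub1_sqr z1) (cabs_sub1_sqr zj1) in h3.
rewrite -exprM in h3.
have h4 : 1 <= j%:R ^+ 2 * (1 - Re z) by move: h1 h3; lra.
have j0 : 0 < j%:R :> R by rewrite ltr0n.
have h5 : 2 * (w%:R / N%:R) <= j%:R^-1 :> R.
  rewrite -[leRHS]mul1r ler_pdivlMr // -(ler_pM2r Np) mul1r.
  have -> : 2 * (w%:R / N%:R) * j%:R * N%:R = (2 * (w * j))%:R :> R.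
    by rewrite !natrM; field; rewrite gt_eqF.
  by rewrite ler_nat; nia.
have h6 : 1 - Re z >= (j%:R^-1) ^+ 2.
  by rewrite exprVn -[leLHS]mul1r ler_pdivrMr ?exprn_gt0 // mulrC.
have h7 : 0 <= w%:R / N%:R :> R by rewrite divr_ge0.
apply: le_trans h6; rewrite (_ : 4 * _ = (2 * (w%:R / N%:R)) ^+ 2); last by ring.
by rewrite lerXn2r ?nnegrE ?invr_ge0 ?mulr_ge0.
Qed.

Lemma leq_exp2r_weak m n k : (m <= n)%N -> (m ^ k <= n ^ k)%N.
Proof. by case: k => // k mn; rewrite leq_exp2r. Qed.

Lemma bernoulli_nat H : (0 < H)%N -> (2 * H ^ H <= H.+1 ^ H)%N.
Proof.
move=> H0; suff h k : (0 < k)%N -> (H ^ k + k * H ^ k.-1 <= H.+1 ^ k)%N.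
  by have := h H H0; rewrite -expnS prednK // addnn mul2n.
elim: k => // -[|k] IH _; first by rewrite !expn1 expn0 addn1.
have {}IH := IH isT; rewrite (expnS H.+1); apply: leq_trans (leq_mul (leqnn _) IH).
by rewrite /= !(expnS H); move: (H ^ k)%N => q; nia.
Qed.

Section Concentration.
Import mathcomp.boot.fintype mathcomp.boot.finset.
Variables (R : realType) (p : nat).
Hypothesis p_pr : prime p.
Local Notation C := (complex R).
Local Notation F := 'F_p.
Implicit Types (f : F -> C) (X Y Z S : {set F}).

Let p_gt0 : (0 < p)%N. Proof. exact: prime_gt0. Qed.

(** The graph of [correlation_graph] satisfies the hypotheses of [bsg]; all losses are powers
    of [2 ^ e]. *)
Lemma small_difference_set f e : (0 < e)%N -> wiener_norm f <= (2 ^ e)%:R ->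
  supp f != set0 -> (forall x, x \in supp f -> 1 <= cabs (f x)) ->
  exists A : {set F}, [/\ A \subset supp f, A != set0,
    (#|supp f| <= 2 ^ (2 * e + 3) * #|A|)%N &
    (#|diffset A A| <= 2 ^ (56 * e) * #|A|)%N].
Proof.
move=> e0 fe S0 f1; set S := supp f in S0 *.
have k0 : (0 < 2 ^ e)%N by rewrite expn_gt0.
have [P [Psym cardP dense]] := correlation_graph p_pr k0 fe f1.
have [A AS [hA1 hA2]] := bsg Psym S0 dense.
have S_gt0 : (0 < #|S|)%N by rewrite card_gt0.
have kk : ((2 ^ e) ^ 2 = 2 ^ (2 * e))%N by rewrite -expnM mulnC.
have hA3 : (#|S| <= 2 ^ (2 * e + 3) * #|A|)%N.
  by apply: leq_trans hA1 _; rewrite leq_mul2r kk expnD; apply/orP; right; lia.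
have A0 : A != set0.
  by rewrite -card_gt0; move: hA3 S_gt0; case: #|A| => //; rewrite muln0; lia.
exists A; split => //.
have S3 : (0 < #|S| ^ 3)%N by rewrite expn_gt0 S_gt0.
rewrite -(leq_pmul2r S3); apply: leq_trans hA2 _.
have hP4 : (#|P| ^ 4 <= (4 * (2 ^ e) ^ 4 * #|S|) ^ 4)%N by rewrite leq_exp2r.
apply: leq_trans (leq_mul (leqnn _) hP4) _.
have main : (4096 * (2 * (2 ^ e) ^ 2) ^ 5 * (4 * (2 ^ e) ^ 4) ^ 4 * #|S| <= 2 ^ (56 * e) * #|A|)%N.
  apply: leq_trans (leq_mul (leqnn _) hA3) _.
  rewrite mulnA leq_mul2r; apply/orP; right.
  have -> : (4096 = 2 ^ 12)%N by [].
  have -> : (2 * (2 ^ e) ^ 2 = 2 ^ (2 * e + 1))%N by rewrite -expnM -expnS; congr (2 ^ _)%N; lia.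
  have -> : (4 * (2 ^ e) ^ 4 = 2 ^ (4 * e + 2))%N.
    by rewrite -expnM (_ : 4 = 2 ^ 2)%N // -expnD; congr (2 ^ _)%N; lia.
  rewrite -!expnM -!expnD leq_exp2l //; lia.
move: main; rewrite (expnMn _ #|S|) (expnS #|S| 3).
move: (4096 * (2 * (2 ^ e) ^ 2) ^ 5)%N ((4 * (2 ^ e) ^ 4) ^ 4)%N (2 ^ (56 * e))%N => b c w main.
by have := leq_mul main (leqnn (#|S| ^ 3)); rewrite -!mulnA.
Qed.

(** The sets [N A - N A] grow at most exponentially in [N] by [iterated_diffset], which is
    what [bohr_structure] takes as its input. *)
Lemma structured_part f e v n : (0 < e)%N -> wiener_norm f <= (2 ^ e)%:R ->
  supp f != set0 -> (forall x, x \in supp f -> 1 <= cabs (f x)) ->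
  (16 * (112 * e * (2 * n).+2) <= 2 ^ n)%N ->
  v = (40000 * (112 * e) ^ 2 * n.+1 ^ 2)%N ->
  exists Y a, [/\ 0 \in Y, sumset [set a] Y \subset supp f,
    (#|supp f| <= 2 ^ (2 * e + 3 + v * 2 ^ n) * #|Y|)%N,
    (#|diffset Y Y| <= 2 ^ (56 * e) * #|supp f|)%N &
    forall k, (#|nsum k (diffset Y Y)| <= #|diffset Y Y| * (2 * k).+1 ^ (2 ^ n.+1 * v.+1))%N].
Proof.
move=> e0 fe S0 f1 hn ->; have [A [AS A0 hA1 hA2]] := small_difference_set e0 fe S0 f1.
have D0 : (0 < 112 * e)%N by rewrite muln_gt0.
have Agrowth N : (#|diffset (nsum N A) (nsum N A)| <= 2 ^ (112 * e * N) * #|A|)%N.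
  apply: leq_trans (iterated_diffset N A0 hA2) _.
  by rewrite -expnM leq_mul2r leq_exp2l //; apply/orP; right; lia.
have [Y [a [Y0 YA hY kY]]] := bohr_structure R A0 D0 Agrowth hn.
exists Y, a; split => //; first exact: subset_trans AS.
  apply: leq_trans hA1 _; rewrite [in leqRHS]expnD -mulnA leq_mul2l hY orbT //.
rewrite -(diffset_shift a); apply: leq_trans (subset_leq_card (diffsetSS YA YA)) _.
by apply: leq_trans hA2 _; rewrite leq_mul2l subset_leq_card ?orbT.
Qed.

(** If [X + Y] is hardly larger than [X] and much smaller than the group, some nontrivial
    character is nearly constant on [Y].  Write the number of pairs of [X] and [Y] as a sum
    over the characters of the transforms of [X], [Y] and [X + Y].  The trivial character
    contributes little; if the transform of [Y] were small at all others, Parseval's identity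
    for [X] and [X + Y] would bound the rest. *)
Lemma nontrivial_character X Y (H : nat) : (4 <= H)%N -> X != set0 -> Y != set0 ->
  (H * #|sumset X Y| <= H.+1 * #|X|)%N -> (#|sumset X Y| * H <= p)%N ->
  exists2 g : F, g != 0 & exists2 y0, y0 \in Y &
    \sum_(y in Y) (1 - Re (chi (g * (y - y0)))) <= 4 / H%:R * #|Y|%:R :> R.
Proof.
move=> H4 X0 Y0 h1 h2; set Z := sumset X Y in h1 h2.
have Xp : 0 < #|X|%:R :> R by rewrite ltr0n card_gt0.
have Yp : 0 < #|Y|%:R :> R by rewrite ltr0n card_gt0.
have Hp : 4 <= H%:R :> R by rewrite ler_nat.
have pp : 0 < p%:R :> R by rewrite ltr0n.
pose b : R := (1 - 2 / H%:R) * #|Y|%:R.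
have [g g0 hg] : exists2 g : F, g != 0 & b < cabs (ft (ind R Y) g).
  apply: contrapT => /forall2NP hn.
  have {}hn g : g != 0 -> cabs (ft (ind R Y) g) <= b.
    by move=> g0; case: (hn g) => // /negP; rewrite -leNgt.
  have E : \sum_g ft (ind R X) g * ft (ind R Y) g * conjc (ft (ind R Z) g) = (p%:R * #|X|%:R * #|Y|%:R)%:C.
    transitivity (\sum_(x in X) \sum_(y in Y) \sum_(z in Z) \sum_g chi (g * (x + y - z)) : C).
      under eq_bigr => g _.
        rewrite /ft !sum_ind rmorph_sum big_distrlr mulr_suml /=.
        under eq_bigr => x _.
          rewrite big_distrlr /=.
          under eq_bigr => y _.
            under eq_bigr => z _ do rewrite -chiN // -!chiD // -mulrN -!mulrDr.
            over.
          over.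
        over.
      rewrite exchange_big; apply: eq_bigr => x _.
      rewrite exchange_big; apply: eq_bigr => y _.
      by rewrite exchange_big.
    transitivity (\sum_(x in X) \sum_(y in Y) (p%:R : C)).
      apply: eq_bigr => x xX; apply: eq_bigr => y yY.
      rewrite (bigD1 (x + y)) ?mem_sumset //= subrr sum_chi // eqxx big1 ?addr0 // => z /andP[_ ne].
      by rewrite sum_chi // subr_eq0 eq_sym (negbTE ne).
    rewrite !sumr_const -mulrnA -[LHS]mulr_natr natrM !rmorphM /= !rmorph_nat; ring.
  have Ec : p%:R * #|X|%:R * #|Y|%:R <=
     #|X|%:R * #|Y|%:R * #|Z|%:R + b * (p%:R * (#|X|%:R + #|Z|%:R) / 2).
    have -> : p%:R * #|X|%:R * #|Y|%:R = cabs ((p%:R * #|X|%:R * #|Y|%:R)%:C : C).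
      by rewrite cabs_real ger0_norm // !mulr_ge0 // ltW.
    rewrite -E; apply: le_trans (cabs_sum _ _ _) _.
    rewrite (bigD1 0) //=; apply: lerD.
      by rewrite !cabsM cabs_conj !ft_ind0 // !cabs_nat.
    apply: (@le_trans _ _ (\sum_g b * ((cabs (ft (ind R X) g) ^+ 2 + cabs (ft (ind R Z) g) ^+ 2) / 2))).
      rewrite [leRHS](bigD1 0) //= -[leLHS]add0r; apply: lerD.
        rewrite mulr_ge0 ?divr_ge0 ?addr_ge0 ?sqr_ge0 // /b mulr_ge0 ?(ltW Yp) //.
        by rewrite subr_ge0 ler_pdivrMr ?mul1r; lra.
      apply: ler_sum => g g0; rewrite !cabsM cabs_conj mulrAC mulrC.
      apply: ler_pM; rewrite ?mulr_ge0 ?cabs_ge0 ?hn //.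
      have := sqr_ge0 (cabs (ft (ind R X) g) - cabs (ft (ind R Z) g)).
      rewrite sqrrB; lra.
    rewrite -mulr_sumr -mulr_suml big_split /= !parseval_ft // !sum_cabs_ind.
    by rewrite -mulrDr.
  have z1 : #|Z|%:R * H%:R <= p%:R :> R by rewrite -natrM ler_nat.
  have z2 : H%:R * #|Z|%:R <= (H%:R + 1) * #|X|%:R :> R.
    by rewrite natr1 -!natrM ler_nat.
  have H0 : 0 < H%:R :> R by lra.
  have z1' : #|Z|%:R <= p%:R / H%:R :> R by rewrite ler_pdivlMr.
  have z2' : #|Z|%:R <= (1 + 1 / H%:R) * #|X|%:R :> R.
    rewrite -(ler_pM2l H0); apply: le_trans z2 _.
    by rewrite mulrA mulrDr mulr1 mul1r divff // gt_eqF.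
  have i0 : 0 < H%:R^-1 :> R by rewrite invr_gt0.
  have i1 : H%:R^-1 <= 1 / 4 :> R by rewrite mul1r lef_pV2 ?posrE.
  move: Ec z1' z2'; rewrite /b mul1r; move: Xp Yp pp i0 i1.
  move: (#|X|%:R : R) (#|Y|%:R : R) (#|Z|%:R : R) (p%:R : R) (H%:R^-1 : R) => x y z q i x0 y0 q0 i0 i1.
  move=> Ec z1' z2'.
  have u1 : x * y * z <= x * y * (q * i) by rewrite ler_pM2l // mulr_gt0.
  have u2 : (1 - 2 * i) * y * (q * (x + z) / 2) <= (1 - 2 * i) * y * (q * (x + (1 + i) * x) / 2).
    rewrite ler_wpM2l //; first by rewrite mulr_ge0 ?(ltW y0) //; lra.
    by rewrite ler_pM2r // ler_pM2l // lerD2l.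
  have u3 : 0 < q * x * y * (i / 2 + i * i) by rewrite !mulr_gt0 // addr_gt0 ?mulr_gt0.
  have u4 : x * y * (q * i) + (1 - 2 * i) * y * (q * (x + (1 + i) * x) / 2) =
     q * x * y - q * x * y * (i / 2 + i * i) by field.
  lra.
exists g => //.
have ftY : ft (ind R Y) g = \sum_(y in Y) chi (g * y) by rewrite /ft sum_ind.
have E2 : cabs (ft (ind R Y) g) ^+ 2 = \sum_(y0 in Y) \sum_(y in Y) Re (chi (g * (y - y0)) : C).
  transitivity (Re (ft (ind R Y) g * conjc (ft (ind R Y) g))); first by rewrite mul_conj.
  rewrite ftY rmorph_sum big_distrlr cRe_sum exchange_big /=; apply: eq_bigr => y _.
  rewrite cRe_sum; apply: eq_bigr => y' _; congr (Re _).
  by rewrite mulrBr chiD // chiN.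
apply: contrapT => hn.
have {}hn y0 : y0 \in Y -> \sum_(y in Y) (4 / H%:R) < \sum_(y in Y) (1 - Re (chi (g * (y - y0)) : C)).
  move=> y0Y; rewrite ltNge; apply/negP => h; apply: hn; exists y0 => //.
  by apply: le_trans h _; rewrite sumr_const mulr_natr.
have h3 : \sum_(y0 in Y) \sum_(y in Y) (4 / H%:R) <=
    \sum_(y0 in Y) \sum_(y in Y) (1 - Re (chi (g * (y - y0)) : C)) :> R.
  by apply: ler_sum => y0 /hn/ltW.
have sumc (c : R) : \sum_(y0 in Y) \sum_(y in Y) c = c * #|Y|%:R ^+ 2.
  by rewrite !sumr_const -mulrnA -[LHS]mulr_natr natrM expr2.
have h4 : \sum_(y0 in Y) \sum_(y in Y) (1 - Re (chi (g * (y - y0)) : C)) =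
    1 * #|Y|%:R ^+ 2 - cabs (ft (ind R Y) g) ^+ 2.
  by rewrite E2 -sumc -sumrB; apply: eq_bigr => y _; rewrite sumrB.
have b0 : 0 < b by rewrite /b mulr_gt0 // subr_gt0 ltr_pdivrMr; lra.
have h5 : b ^+ 2 < cabs (ft (ind R Y) g) ^+ 2 by rewrite ltrXn2r ?nnegrE ?(ltW b0) ?cabs_ge0.
move: h3; rewrite sumc h4.
have : b ^+ 2 = #|Y|%:R ^+ 2 - 4 / H%:R * #|Y|%:R ^+ 2 + (2 / H%:R * #|Y|%:R) ^+ 2 by rewrite /b; field; lra.
have : 0 <= (2 / H%:R * #|Y|%:R) ^+ 2 :> R by rewrite sqr_ge0.
lra.
Qed.

(** Residues are represented in [0 .. p - 1], so those just below [p] stand for small negative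
    numbers. *)
Definition near0 w (x : F) := (val x < w)%N || (p < val x + w)%N.

(** As the multiples of [E = Y - Y] grow only polynomially, the ratio of the sizes of [i E]
    and [(i + 1) E] is at most [1 + 1 / H] for some [i], with [H] of order [4 ^ h].  So
    [nontrivial_character] applies to [X = i E], and a character that is so close to constant
    on [Y] maps half of [Y] near the image of one of its points. *)
Lemma concentration Y h r : 0 \in Y -> (0 < h)%N ->
  (forall k, (#|nsum k (diffset Y Y)| <= #|diffset Y Y| * (2 * k).+1 ^ r)%N) ->
  (r * (4 * h + 3) <= 2 ^ (2 * h))%N ->
  (#|diffset Y Y| * 2 ^ ((4 * h + 3) * r + (2 * h).+1) <= p)%N ->
  forall w, (p <= 2 ^ h * w)%N ->
  exists2 g : F, g != 0 & exists2 y0, y0 \in Y &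
    (#|Y| <= 2 * #|[set y in Y | near0 w (g * (y - y0))%R]|)%N.
Proof.
move=> Y0 h0 growth hr hp w hw; set E := diffset Y Y in growth hp.
have Yne : Y != set0 by apply/set0Pn; exists 0.
have E0 : 0 \in E by apply: mem0_diffset.
have Ene : E != set0 by apply/set0Pn; exists 0.
have YE : Y \subset E by apply: subset_sumset0; rewrite mem_oppset oppr0.
have [H HE] : exists H, H = (2 ^ (2 * h).+1)%N by exists (2 ^ (2 * h).+1)%N.
pose kappa := (2 ^ (2 * h) * H)%N.
have kE : kappa = (2 ^ (4 * h).+1)%N by rewrite /kappa HE -expnD; congr (2 ^ _)%N; lia.
have k0 : (0 < kappa)%N by rewrite kE expn_gt0.
have bnd i : (i <= kappa)%N -> (#|nsum i.+1 E| <= 2 ^ ((4 * h + 3) * r) * #|E|)%N.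
  move=> ik; apply: leq_trans (growth _) _; rewrite mulnC leq_mul2r; apply/orP; right.
  rewrite expnM leq_exp2r_weak //.
  have : (kappa <= 2 ^ (4 * h).+1)%N by rewrite kE.
  have -> : (4 * h + 3 = (4 * h).+3)%N by lia.
  rewrite !expnS; have := expn_gt0 2 (4 * h); move: (2 ^ _)%N => q; lia.
have [|||i ik hi] := @ratio_pigeonhole (fun i => #|nsum i.+1 E|) kappa (2 ^ ((4 * h + 3) * r)).
- exact: k0.
- by rewrite nsum1 card_gt0.
- by rewrite nsum1 bnd.
have H4 : (4 <= H)%N by rewrite HE (_ : 4 = 2 ^ 2)%N // leq_exp2l //; lia.
set X := nsum i.+1 E.
have X0 : X != set0 by rewrite nsum_neq0.
have XY : sumset X Y \subset nsum i.+2 E by rewrite nsumS sumsetC sumsetSS.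
have ratio : (H * #|nsum i.+2 E| <= H.+1 * #|X|)%N.
  rewrite leqNgt; apply/negP => hlt.
  have e1 : ((H.+1 * #|X|) ^ kappa < (H * #|nsum i.+2 E|) ^ kappa)%N by rewrite ltn_exp2r.
  have e2 : ((2 * H ^ H) ^ (2 ^ (2 * h)) <= (H.+1 ^ H) ^ (2 ^ (2 * h)))%N.
    by apply/leq_exp2r_weak/bernoulli_nat; rewrite HE expn_gt0.
  rewrite expnMn -!expnM [(H * 2 ^ _)%N]mulnC -/kappa in e2.
  have e3 : (2 ^ ((4 * h + 3) * r) <= 2 ^ (2 ^ (2 * h)))%N by rewrite leq_exp2l // mulnC.
  rewrite !expnMn in e1.
  have e4 : (H ^ kappa * #|nsum i.+2 E| ^ kappa <= H ^ kappa * (2 ^ 2 ^ (2 * h) * #|X| ^ kappa))%N.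
    rewrite leq_mul2l; apply/orP; right; apply: leq_trans hi _.
    by rewrite leq_mul2r e3 orbT.
  have := leq_trans e1 e4; rewrite mulnA (mulnC (H ^ kappa)%N) ltnNge => /negP; apply.
  by rewrite leq_mul2r e2 orbT.
have size : (#|nsum i.+2 E| * H <= p)%N.
  apply: leq_trans hp; rewrite expnD -HE mulnA leq_mul2r (mulnC #|E|); apply/orP; right.
  exact: bnd.
have cXY := subset_leq_card XY.
have [||g g0 [y0 y0Y hs]] := nontrivial_character H4 X0 Yne.
- by apply: leq_trans ratio; rewrite leq_mul2l cXY orbT.
- by apply: leq_trans size; rewrite leq_mul2r cXY orbT.
exists g => //; exists y0 => //.
set Z := [set y in Y | _].
have pp : 0 < p%:R :> R by rewrite ltr0n.
have w0 : (0 < w)%N by rewrite lt0n; apply: contraTneq hw => ->; rewrite muln0 -ltnNge.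
have wp : 0 < w%:R :> R by rewrite ltr0n.
have Hp : 0 < H%:R :> R by rewrite ltr0n HE expn_gt0.
have h1 : #|Y :\: Z|%:R * (4 * (w%:R / p%:R) ^+ 2) <= 4 / H%:R * #|Y|%:R :> R.
  apply: le_trans hs; rewrite [leRHS](big_setID (Y :\: Z)) /= (setIidPr (subsetDl _ _)).
  rewrite -[leLHS]addr0; apply: lerD.
    rewrite mulr_natl -sumr_const; apply: ler_sum => y.
    rewrite !inE => /andP[+ yY]; rewrite yY /= /near0 negb_or -!leqNgt => /andP[n1 n2].
    exact: one_sub_Re_zeta.
  apply: sumr_ge0 => y _; rewrite subr_ge0.
  by apply: le_trans (Re_le_cabs _) _; rewrite cabs_chi.
have h2 : (2 * #|Y :\: Z| <= #|Y|)%N.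
  have h3 : 2 * (p%:R : R) ^+ 2 <= H%:R * w%:R ^+ 2.
    have : (2 * p ^ 2 <= H * w ^ 2)%N.
      apply: leq_trans (leq_mul (leqnn 2) (leq_exp2r_weak 2 hw)) _.
      by rewrite expnMn mulnA HE -expnM -expnS (mulnC h).
    by rewrite -(ler_nat R) (natrM _ 2) (natrM _ H) !natrX.
  rewrite -(ler_nat R) natrM.
  have h4 : 0 < 2 * (p%:R : R) ^+ 2 by rewrite mulr_gt0 // exprn_gt0.
  have y0' : 0 <= #|Y :\: Z|%:R :> R by [].
  have h5 : #|Y :\: Z|%:R * (4 * (w%:R / p%:R) ^+ 2) * (H%:R * p%:R ^+ 2) <= 4 / H%:R * #|Y|%:R * (H%:R * p%:R ^+ 2) :> R.
    by rewrite ler_wpM2r // mulr_ge0 ?(ltW Hp) // sqr_ge0.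
  have e5 : #|Y :\: Z|%:R * (4 * (w%:R / p%:R) ^+ 2) * (H%:R * p%:R ^+ 2) = 4 * #|Y :\: Z|%:R * (H%:R * w%:R ^+ 2) :> R.
    by field; rewrite gt_eqF.
  have e6 : 4 / H%:R * #|Y|%:R * (H%:R * p%:R ^+ 2) = 2 * #|Y|%:R * (2 * p%:R ^+ 2) :> R.
    by field; rewrite gt_eqF.
  rewrite e5 e6 in h5.
  have h6 : 4 * #|Y :\: Z|%:R * (2 * p%:R ^+ 2) <= 4 * #|Y :\: Z|%:R * (H%:R * w%:R ^+ 2) :> R.
    by rewrite ler_wpM2l // mulr_ge0.
  have := le_trans h6 h5; rewrite ler_pM2r //; lra.
have h3 := cardsD Y Z; have ZY : Z \subset Y by apply/subsetP => y; rewrite inE => /andP[].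
rewrite (setIidPr ZY) in h3; move: h2 h3 (subset_leq_card ZY).
by move: #|Y| #|Z| #|Y :\: Z| => a b c; clear; lia.
Qed.
End Concentration.

(** * Polynomials on the unit circle *)

Section Circle.
Variable R : realType.
Local Notation C := (complex R).
Implicit Types (h g f M P Q : {poly C}) (z : C) (w : C -> R).

Lemma poly_parseval P N : (size P <= N)%N ->
  \sum_(k < N) cabs P.[zeta N ^+ k] ^+ 2 = N%:R * \sum_(i < N) cabs P`_i ^+ 2.
Proof.
move=> sP; rewrite -(parseval_zeta (fun i : 'I_N => P`_i)); apply: eq_bigr => k _.
by rewrite (horner_coef_wide _ sP); congr (cabs _ ^+ 2); apply: eq_bigr => i _; rewrite -exprM mulnC.
Qed.

(** Sums over [N]-th roots of unity replace integrals over the circle; this is exact for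
    polynomials of size at most [N]. *)
Lemma hadamard P Q z N : (size P <= N)%N -> (size Q <= N)%N ->
  \sum_(k < N) P.[z * zeta N ^+ k] * conjc Q.[zeta N ^+ k] =
  N%:R * \sum_(i < N) P`_i * conjc Q`_i * z ^+ i.
Proof.
move=> sP sQ.
under eq_bigr => k _ do rewrite (horner_coef_wide _ sP) (horner_coef_wide _ sQ) rmorph_sum big_distrlr /=.
rewrite exchange_big mulr_sumr; apply: eq_bigr => i _ /=.
have E j : \sum_(k < N) P`_i * (z * zeta N ^+ k) ^+ i * conjc (Q`_j * (zeta N ^+ k) ^+ j) =
    P`_i * z ^+ i * conjc Q`_j * \sum_(k < N) zeta N ^+ (i * k) * conjc (zeta N ^+ (j * k)).
  rewrite mulr_sumr; apply: eq_bigr => k _.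
  by rewrite exprMn rmorphM -!exprM !(mulnC k) /=; ring.
rewrite exchange_big (bigD1 i) //= [X in _ + X]big1 => [|j ne].
  by rewrite addr0 E zeta_orth eqxx rmorph_nat /=; ring.
by rewrite E zeta_orth eq_sym (negbTE ne) mulr0.
Qed.

Lemma coef_mean P N n : (size P <= N)%N -> (n < N)%N ->
  \sum_(k < N) P.[zeta N ^+ k] * conjc ((zeta N ^+ k) ^+ n) = N%:R * P`_n.
Proof.
move=> sP nN; have := @hadamard P 'X^n 1 N sP; rewrite size_polyXn => /(_ nN).
under eq_bigr => k _ do rewrite mul1r hornerXn.
move=> ->; congr (_ * _); rewrite (bigD1 (Ordinal nN)) //= coefXn eqxx big1 => [|i ne].
  by rewrite rmorph1 expr1n !mulr1 addr0.
rewrite coefXn (_ : (i == n :> nat) = false); last by apply: contraNF ne => /eqP h; apply/eqP/val_inj.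
by rewrite rmorph0 mulr0 mul0r.
Qed.

(** Multiplying the coefficients of [F] by those of [B ^ 2] amounts to averaging [F] against
    [conjc B ^ 2], whose mean modulus is the sum of the [|B`_i| ^ 2]. *)
Lemma hadamard_square_le (F B : {poly C}) z (m : R) : (forall x : C, cabs x = 1 -> cabs F.[x] <= m) -> 0 <= m ->
  cabs z = 1 ->
  cabs (\sum_(i < maxn (size F) (size (B ^+ 2))) F`_i * conjc (B ^+ 2)`_i * z ^+ i)
    <= m * \sum_(i < size B) cabs B`_i ^+ 2.
Proof.
move=> hF m0 z1; set N := maxn _ _.
have [N0|N0] := posnP N.
  rewrite big1 ?cabs0 => [|i _]; last by have := ltn_ord i; rewrite [X in (_ < X)%N]N0.
  by rewrite mulr_ge0 // sumr_ge0 // => i _; apply: sqr_ge0.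
have Np : 0 < N%:R :> R by rewrite ltr0n.
have sF : (size F <= N)%N by rewrite leq_maxl.
have sB2 : (size (B ^+ 2) <= N)%N by rewrite leq_maxr.
have sB : (size B <= N)%N.
  have [->|B0] := eqVneq B 0; first by rewrite size_poly0.
  apply: leq_trans sB2; rewrite expr2 size_mul //; have : (0 < size B)%N by rewrite size_poly_gt0.
  by case: (size B) => // n _; rewrite addSn /= leq_addl.
rewrite -(ler_pM2l Np) -[X in X * cabs _](cabs_nat R) -cabsM -hadamard //.
apply: le_trans (cabs_sum _ _ _) _; rewrite mulrCA.
have -> : N%:R * \sum_(i < size B) cabs B`_i ^+ 2 = \sum_(k < N) cabs B.[zeta N ^+ k] ^+ 2.
  rewrite poly_parseval //; congr (_ * _).
  rewrite (big_ord_widen N (fun i => cabs B`_i ^+ 2) sB) big_mkcond; apply: eq_bigr => i _ /=.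
  by case: ltnP => // h; rewrite nth_default // cabs0 expr0n.
rewrite mulr_sumr; apply: ler_sum => k _; rewrite cabsM cabs_conj horner_exp cabsX.
by rewrite ler_wpM2r ?sqr_ge0 // hF // cabsM z1 cabsX cabs_zeta expr1n mulr1.
Qed.

(** Real trigonometric polynomials, presented as real parts of polynomials. *)
Definition trig w := exists h, forall z, cabs z = 1 -> w z = Re h.[z].

Lemma trig_cst (c : R) : trig (fun=> c).
Proof. by exists (c%:C)%:P => z _; rewrite hornerC. Qed.

Lemma trigD w1 w2 : trig w1 -> trig w2 -> trig (fun z => w1 z + w2 z).
Proof. by move=> [h1 e1] [h2 e2]; exists (h1 + h2) => z z1; rewrite hornerD cReD e1 ?e2. Qed.

Lemma trigZ (c : R) w : trig w -> trig (fun z => c * w z).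
Proof. by move=> [h e]; exists (c%:C *: h) => z z1; rewrite hornerZ cRe_realM e. Qed.

Lemma trig_sum (I : Type) (r : seq I) (u : I -> C -> R) : (forall i, trig (u i)) ->
  trig (fun z => \sum_(i <- r) u i z).
Proof.
move=> hu; elim: r => [|i r IH].
  by have [h e] := trig_cst 0; exists h => z z1; rewrite big_nil -(e z z1).
by have [h e] := trigD (hu i) IH; exists h => z z1; rewrite big_cons -(e z z1).
Qed.

Lemma trig_ext w1 w2 : (forall z, cabs z = 1 -> w1 z = w2 z) -> trig w2 -> trig w1.
Proof. by move=> e [h eh]; exists h => z z1; rewrite e ?eh. Qed.

Lemma unimod_neq0 z : cabs z = 1 -> z != 0.
Proof. by move=> z1; rewrite -cabs_eq0 z1 oner_eq0. Qed.

Lemma trig_mul_conj h g : trig (fun z => Re (h.[z] * conjc g.[z])).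
Proof.
pose u (i j : nat) z : R := Re (h`_i * conjc g`_j * (z ^+ i * conjc (z ^+ j))).
apply: (@trig_ext _ (fun z => \sum_(i < size h) \sum_(j < size g) u i j z)).
  move=> z z1; rewrite !horner_coef rmorph_sum big_distrlr cRe_sum; apply: eq_bigr => i _.
  by rewrite cRe_sum; apply: eq_bigr => j _; rewrite /u rmorphM mulrACA.
apply: trig_sum => i; apply: trig_sum => j.
have [ji|ij] := leqP j i.
  exists (h`_i * conjc g`_j *: 'X^(i - j)) => z z1; rewrite /u hornerZ hornerXn.
  congr (Re (_ * _)); rewrite conj_unimod ?cabsX ?z1 ?expr1n //.
  by rewrite -{1}(subnK ji) exprD mulfK // expf_neq0 // unimod_neq0.
exists (conjc (h`_i * conjc g`_j) *: 'X^(j - i)) => z z1; rewrite /u hornerZ hornerXn.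
rewrite -[LHS]cRe_conj rmorphM; congr (Re (_ * _)); rewrite rmorphM /= conjcK.
rewrite conj_unimod ?cabsX ?z1 ?expr1n // -{1}(subnK (ltnW ij)) exprD mulrCA mulVf ?mulr1 //.
by rewrite expf_neq0 // unimod_neq0.
Qed.

Lemma trigM w1 w2 : trig w1 -> trig w2 -> trig (fun z => w1 z * w2 z).
Proof.
move=> [h1 e1] [h2 e2].
have t1 : trig (fun z => Re (h1 * h2).[z]) by exists (h1 * h2).
apply: (trig_ext _ (trigZ (1 / 2) (trigD t1 (trig_mul_conj h1 h2)))) => z z1.
rewrite e1 // e2 // hornerM; case: h1.[z] => a b; case: h2.[z] => c d /=; by field.
Qed.

Lemma trig_sqr_cabs f : trig (fun z => cabs f.[z] ^+ 2).
Proof.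
apply: (trig_ext _ (trig_mul_conj f f)) => z _.
by rewrite mul_conj.
Qed.

(** The Newton-like iteration for the square root: it approximates [|f|] by a trigonometric
    polynomial in [|f| ^ 2]. *)
Fixpoint sqrt_approx k (x : R) : R :=
  if k is k'.+1 then sqrt_approx k' x + (x - sqrt_approx k' x ^+ 2) / 2 else 0.

Lemma trig_sqrt_approx k w : trig w -> trig (fun z => sqrt_approx k (w z)).
Proof.
move=> tw; elim: k => [|k IH] /=; first exact: trig_cst.
have t2 := trigD IH (trigZ (1 / 2) (trigD tw (trigZ (-1) (trigM IH IH)))).
by apply: (trig_ext _ t2) => z _; field.
Qed.

Lemma bernoulli_inv (x : R) n : 0 <= x <= 1 -> (1 - x) ^+ n * (1 + n%:R * x) <= 1.
Proof.
move=> /andP[x0 x1]; elim: n => [|n IH]; first by rewrite mul0r addr0 mulr1.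
have a0 : 0 <= (1 - x) ^+ n by rewrite exprn_ge0 //; lra.
have n0 : 0 <= n%:R :> R by [].
have key : (1 - x) * (1 + (n%:R + 1) * x) <= 1 + n%:R * x by nra.
rewrite exprS -[n.+1%:R]natr1; apply: le_trans IH.
by rewrite (mulrC (1 - x)) -mulrA ler_wpM2l.
Qed.

Lemma sqrt_approx_bounds k (u : R) : 0 <= u <= 1 ->
  0 <= u - sqrt_approx k (u ^+ 2) /\ (k.+1%:R * (u - sqrt_approx k (u ^+ 2)) <= 2).
Proof.
move=> /andP[u0 u1].
suff [h1 h2] : 0 <= sqrt_approx k (u ^+ 2) <= u /\ u - sqrt_approx k (u ^+ 2) <= u * (1 - u / 2) ^+ k.
  split; first by rewrite subr_ge0; case/andP: h1.
  have b : (1 - u / 2) ^+ k * (1 + k%:R * (u / 2)) <= 1.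
    by apply: bernoulli_inv; apply/andP; split; lra.
  have a0 : 0 <= (1 - u / 2) ^+ k by rewrite exprn_ge0 //; lra.
  have a1 : (1 - u / 2) ^+ k <= 1 by rewrite exprn_ile1 //; lra.
  rewrite -natr1; have kn : 0 <= k%:R :> R by [].
  have h3 : (k%:R + 1) * (u - sqrt_approx k (u ^+ 2)) <= (k%:R + 1) * (u * (1 - u / 2) ^+ k).
    by rewrite ler_wpM2l // addr_ge0.
  apply: le_trans h3 _; move: b a0 a1 kn; move: ((1 - u / 2) ^+ k) (k%:R : R) => a q; nra.
elim: k => [|k [IH1 IH2]] /=; first by split; rewrite ?subr0 ?expr0 ?mulr1 ?lexx ?u0.
set q := sqrt_approx k (u ^+ 2) in IH1 IH2 *; case/andP: IH1 => q0 qu.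
have E : u - (q + (u ^+ 2 - q ^+ 2) / 2) = (u - q) * (1 - (u + q) / 2) by field.
split.
  by apply/andP; split; [nra|rewrite -subr_ge0 E mulr_ge0 //; lra].
rewrite E exprSr mulrA; apply: ler_pM => //; lra.
Qed.
End Circle.

(** * Multipliers that make room for a test function *)

Section Multiplier.
Variable R : realType.
Local Notation C := (complex R).
Implicit Types (h g f M P : {poly C}) (z : C) (w : C -> R).

Lemma sqr_cabs_Re z : cabs z ^+ 2 = 2 * Re z ^+ 2 - Re (z ^+ 2).
Proof. by rewrite cabsE expr2; case: z => a b /=; ring. Qed.

(** A trigonometric polynomial is the real part of a polynomial [h] with real constant
    coefficient.  As [h ^ 2] has a nonnegative mean, the imaginary part of [h] has at most
    the quadratic mean of its real part. *)
Lemma trig_completion w : trig w ->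
  exists h, (forall z, cabs z = 1 -> w z = Re h.[z]) /\
    forall N, (size (h ^+ 2) < N)%N ->
      \sum_(k < N) cabs h.[zeta N ^+ k] ^+ 2 <= 2 * \sum_(k < N) w (zeta N ^+ k) ^+ 2.
Proof.
move=> [h0 e0]; pose h := h0 - ('i%C * (Im h0`_0)%:C)%:P; exists h.
have e z : cabs z = 1 -> w z = Re h.[z].
  by move=> z1; rewrite e0 // /h hornerD hornerN hornerC; case: h0.[z] => a b /=; ring.
split => // N hN.
have N0 : (0 < N)%N by apply: leq_ltn_trans hN.
have hc : Re (\sum_(k < N) (h ^+ 2).[zeta N ^+ k]) = N%:R * Re h`_0 ^+ 2.
  have := @coef_mean R (h ^+ 2) N 0 (ltnW hN) N0.
  under eq_bigr => k _ do rewrite expr0 rmorph1 mulr1.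
  move=> ->; rewrite expr2 coef0M.
  have : Im h`_0 = 0 by rewrite /h coefB coefC eqxx; case: h0`_0 => a b /=; ring.
  have -> : (N%:R : C) = (N%:R)%:C by rewrite rmorph_nat.
  by rewrite cRe_realM; case: h`_0 => a b /= ->; ring.
under eq_bigr => k _ do rewrite sqr_cabs_Re -horner_exp.
rewrite sumrB -mulr_sumr -cRe_sum hc.
under [in leRHS]eq_bigr => k _ do rewrite e ?cabsX ?cabs_zeta ?expr1n //.
by rewrite lerBlDr lerDl mulr_ge0 ?sqr_ge0.
Qed.

Lemma geometric_small (x d : R) : 0 <= x < 1 -> 0 < d -> exists n, x ^+ n <= d.
Proof.
move=> /andP[x0 x1] d0; pose y := 1 - x.
have y0 : 0 < y by rewrite subr_gt0.
exists (Num.bound (1 / (d * y))).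
have h0 : 0 <= 1 / (d * y) by rewrite divr_ge0 // mulr_ge0 // ltW.
have := archi_boundP h0; set n := Num.bound _ => hn.
have hy : 0 <= y <= 1 by rewrite (ltW y0) /= /y; lra.
have := bernoulli_inv n hy; rewrite /y subKr -/y => hb.
have hn2 : 1 / d < n%:R * y.
  by rewrite -(ltr_pM2r (x := y^-1)) ?invr_gt0 // mulfK ?gt_eqF // -mulrA -invfM.
have p0 : 0 < 1 + n%:R * y by have : 0 < 1 / d by [rewrite divr_gt0]; lra.
rewrite -(ler_pM2r p0); apply: le_trans hb _.
have : d * (1 / d) <= d * (1 + n%:R * y) by rewrite ler_wpM2l ?(ltW d0) //; lra.
by rewrite mulrC divfK // gt_eqF.
Qed.

Lemma horner_bound h : exists2 B : R, 0 <= B & forall z, cabs z = 1 -> cabs h.[z] <= B.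
Proof.
exists (\sum_(i < size h) cabs h`_i); first by apply: sumr_ge0 => i _; apply: cabs_ge0.
move=> z z1; rewrite horner_coef; apply: le_trans (cabs_sum _ _ _) _.
by apply: ler_sum => i _; rewrite cabsM cabsX z1 expr1n mulr1.
Qed.

(** A Neumann series: when [r] is large compared with [|h| ^ 2], the values of [1 + h] lie in
    the disc where [|1 - (1 + h) / r| < 1]. *)
Lemma approx_inverse h (d : R) : 0 < d -> (forall z, cabs z = 1 -> 0 <= Re h.[z]) ->
  exists M, forall z, cabs z = 1 -> cabs (M.[z] - (1 + h.[z])^-1) <= d.
Proof.
move=> d0 hpos; have [B B0 hB] := horner_bound h.
pose r := B ^+ 2 + 1; have r1 : 1 <= r by rewrite lerDr sqr_ge0.
have r0 : 0 < r by lra.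
have [|m hm] := @geometric_small (1 - r^-1) d _ d0.
  have h1 : r^-1 <= 1 by rewrite invf_le1.
  have h2 : 0 < r^-1 by rewrite invr_gt0.
  by apply/andP; split; lra.
pose n := (2 * m)%N; pose y := 1 - (r^-1)%:C%:P * (1 + h).
exists ((r^-1)%:C%:P * \sum_(k < n) y ^+ k) => z z1.
have yz : y.[z] = 1 - (r^-1)%:C * (1 + h.[z]).
  by rewrite /y hornerD hornerN hornerM !hornerC hornerD hornerC.
have rC : (r%:C : C) != 0 by rewrite -cabs_eq0 cabs_real normr_eq0 gt_eqF.
have h1ge : 1 <= cabs (1 + h.[z]).
  apply: le_trans (Re_le_cabs _); rewrite cReD /= lerDl; exact: hpos.
have h1n0 : 1 + h.[z] != 0 by rewrite -cabs_eq0 gt_eqF //; lra.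
have E : ((r^-1)%:C%:P * \sum_(k < n) y ^+ k).[z] - (1 + h.[z])^-1 = - (y.[z] ^+ n / (1 + h.[z])).
  rewrite hornerM hornerC horner_sum; under eq_bigr => k _ do rewrite horner_exp.
  apply: (mulIf h1n0); rewrite mulrBl mulVf // mulNr divfK //.
  have -> : (r^-1)%:C * (\sum_(k < n) y.[z] ^+ k) * (1 + h.[z]) =
     (1 - y.[z]) * \sum_(k < n) y.[z] ^+ k by rewrite yz; ring.
  have -> : (1 - y.[z]) * (\sum_(k < n) y.[z] ^+ k) = - ((y.[z] - 1) * \sum_(k < n) y.[z] ^+ k) by ring.
  by rewrite -subrX1; ring.
rewrite E cabsN cabsM cabsV.
have yb : cabs y.[z] ^+ 2 <= 1 - r^-1.
  rewrite yz cabsE; have := hpos _ z1; have := hB _ z1.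
  have := cabs_ge0 h.[z]; have := cabsE h.[z].
  move: (cabs h.[z]) => q; case: h.[z] => u v /= qE q0 qB u0.
  have qB2 : q ^+ 2 <= B ^+ 2 by rewrite lerXn2r ?nnegrE.
  have i0 : 0 < r^-1 by rewrite invr_gt0.
  have -> : 1 - r^-1 = r^-1 ^+ 2 * (r * (r - 1)) by field; rewrite gt_eqF.
  have -> : (1 - (r^-1 * (1 + u) - 0 * (0 + v))) ^+ 2 + (0 - (r^-1 * (0 + v) + 0 * (1 + u))) ^+ 2
     = r^-1 ^+ 2 * ((r - 1 - u) ^+ 2 + v ^+ 2) by field; rewrite gt_eqF.
  rewrite ler_wpM2l ?sqr_ge0 //.
  have rB : B ^+ 2 = r - 1 by rewrite /r; ring.
  rewrite qE rB in qB2; have : 0 <= (r - 1) * u by rewrite mulr_ge0 //; lra.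
  nra.
apply: (@le_trans _ _ (cabs y.[z] ^+ n)).
  rewrite cabsX ler_piMr ?exprn_ge0 ?cabs_ge0 // invf_le1 //; lra.
apply: le_trans hm; rewrite /n exprM lerXn2r ?nnegrE ?sqr_ge0 //.
by rewrite subr_ge0 invf_le1.
Qed.

(** The multiplier of McGehee, Pigno and Smith, within the polynomials: [M] approximates
    [1 / (1 + h)], where the real part of [h] is about [|f| / 8].  Its modulus leaves room for
    adding [f / 10], and since [h] is small in quadratic mean with [f], it is close to [1] in
    quadratic mean.  The parameter [d] bounds the errors of the approximations. *)
Lemma multiplier f (a : R) : 0 < a <= 1 -> (forall z, cabs z = 1 -> cabs f.[z] <= 1) ->
  \sum_(i < size f) cabs f`_i ^+ 2 <= a ^+ 2 ->
  exists M N0, (forall z, cabs z = 1 -> cabs M.[z] <= 1 - cabs f.[z] / 10) /\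
    forall N, (N0 <= N)%N ->
      \sum_(k < N) cabs (M.[zeta N ^+ k] - 1) ^+ 2 <= N%:R * (9 / 64 * a ^+ 2).
Proof.
move=> /andP[a0 a1] f1 f2; pose d := a / 48.
have d0 : 0 < d by rewrite divr_gt0.
have d1 : d <= 1 / 48 by rewrite /d; lra.
pose k := Num.bound (1 / (4 * d)).
have hk : 2 <= k.+1%:R * (8 * d).
  have h0 : 0 <= 1 / (4 * d) by rewrite divr_ge0 // mulr_ge0 // ltW.
  have := archi_boundP h0; rewrite -/k ltr_pdivrMr ?mulr_gt0 // -natr1; nra.
pose w z := 1 / 8 * sqrt_approx k (cabs f.[z] ^+ 2) + 2 * d.
have tw : trig w.
  exact: trigD (trigZ (1 / 8) (trig_sqrt_approx k (trig_sqr_cabs f))) (trig_cst (2 * d)).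
have wb z : cabs z = 1 -> cabs f.[z] / 8 + d <= w z <= cabs f.[z] / 8 + 2 * d.
  move=> z1; have u01 : 0 <= cabs f.[z] <= 1 by rewrite cabs_ge0 f1.
  have [h1 h2] := sqrt_approx_bounds k u01.
  have h3 : cabs f.[z] - sqrt_approx k (cabs f.[z] ^+ 2) <= 8 * d.
    have kp : 0 < k.+1%:R :> R by rewrite ltr0n.
    by rewrite -(ler_pM2l kp); apply: le_trans h2 hk.
  by rewrite /w; apply/andP; split; lra.
have [h [hRe hL2]] := trig_completion tw.
have hpos z : cabs z = 1 -> 0 <= Re h.[z].
  move=> z1; rewrite -hRe //; case/andP: (wb _ z1) => h1 _; apply: le_trans h1.
  by rewrite addr_ge0 ?divr_ge0 ?cabs_ge0 // ltW.
have d2 : 0 < d / 2 by rewrite divr_gt0.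
have [M hM] := approx_inverse d2 hpos.
have inv_le z : cabs z = 1 -> 1 <= cabs (1 + h.[z]) /\ cabs ((1 + h.[z])^-1) <= 1 - (cabs f.[z] / 10 + 4 / 5 * d).
  move=> z1; have /andP[w1 w2] := wb _ z1; have u0 := cabs_ge0 f.[z]; have u1 := f1 _ z1.
  have g1 : 1 + w z <= cabs (1 + h.[z]).
    by apply: le_trans (Re_le_cabs _); rewrite cReD hRe.
  split; first lra.
  rewrite cabsV; have p0 : 0 < cabs (1 + h.[z]) by lra.
  rewrite -(ler_pM2r p0) mulVf ?gt_eqF //; nra.
exists M, (maxn (size f) (size (h ^+ 2)).+1); split.
  move=> z z1; have [_ h1] := inv_le _ z1; have h2 := hM _ z1.
  have -> : M.[z] = (M.[z] - (1 + h.[z])^-1) + (1 + h.[z])^-1 by rewrite subrK.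
  apply: le_trans (cabsD _ _) _; lra.
move=> N; rewrite geq_max => /andP[sf sh].
have z1 (j : 'I_N) : cabs (zeta N ^+ j : C) = 1 by rewrite cabsX cabs_zeta expr1n.
have step1 (j : 'I_N) : cabs (M.[zeta N ^+ j] - 1) ^+ 2 <= 2 * cabs h.[zeta N ^+ j] ^+ 2 + d ^+ 2 / 2.
  have [g1 _] := inv_le _ (z1 j); have g2 := hM _ (z1 j).
  have hn0 : 1 + h.[zeta N ^+ j] != 0 by rewrite -cabs_eq0 gt_eqF //; lra.
  have h3 : cabs (M.[zeta N ^+ j] - 1) <= d / 2 + cabs h.[zeta N ^+ j].
    have -> : M.[zeta N ^+ j] - 1 = (M.[zeta N ^+ j] - (1 + h.[zeta N ^+ j])^-1) - h.[zeta N ^+ j] / (1 + h.[zeta N ^+ j]).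
      by field.
    apply: le_trans (cabsB _ _) _; apply: lerD => //.
    by rewrite cabsM cabsV ler_piMr ?cabs_ge0 // invf_le1 //; lra.
  have h4 : cabs (M.[zeta N ^+ j] - 1) ^+ 2 <= (d / 2 + cabs h.[zeta N ^+ j]) ^+ 2.
    by rewrite lerXn2r ?nnegrE ?addr_ge0 ?cabs_ge0 // ltW.
  apply: le_trans h4 _; have := sqr_ge0 (d / 2 - cabs h.[zeta N ^+ j]); nra.
apply: (@le_trans _ _ (\sum_(j < N) (2 * cabs h.[zeta N ^+ j] ^+ 2 + d ^+ 2 / 2))).
  exact: ler_sum.
rewrite big_split /= -mulr_sumr sumr_const card_ord.
have step2 : \sum_(j < N) w (zeta N ^+ j) ^+ 2 <= N%:R * (a ^+ 2 / 32 + 8 * d ^+ 2).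
  apply: (@le_trans _ _ (\sum_(j < N) (cabs f.[zeta N ^+ j] ^+ 2 / 32 + 8 * d ^+ 2))).
    apply: ler_sum => j _; have /andP[w1 w2] := wb _ (z1 j); have u0 := cabs_ge0 f.[zeta N ^+ j].
    have : w (zeta N ^+ j) ^+ 2 <= (cabs f.[zeta N ^+ j] / 8 + 2 * d) ^+ 2.
      rewrite lerXn2r ?nnegrE //; lra.
    have := sqr_ge0 (cabs f.[zeta N ^+ j] / 8 - 2 * d); nra.
  rewrite big_split /= -mulr_suml sumr_const card_ord (poly_parseval sf).
  have hf : \sum_(i < N) cabs f`_i ^+ 2 <= a ^+ 2.
    apply: le_trans f2; rewrite (big_ord_widen N (fun i => cabs f`_i ^+ 2) sf) [leRHS]big_mkcond.
    apply: ler_sum => i _ /=; case: ltnP => // hi.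
    by rewrite nth_default // cabs0 expr0n.
  have Np : 0 <= N%:R :> R by [].
  have := ler_wpM2l Np hf; rewrite -(mulr_natl (8 * d ^+ 2)); lra.
have step3 := hL2 N sh.
have E : 9 / 64 * a ^+ 2 >= 4 * (a ^+ 2 / 32 + 8 * d ^+ 2) + d ^+ 2 / 2.
  have -> : d ^+ 2 = a ^+ 2 / 2304 by rewrite /d; field.
  have := sqr_ge0 a; lra.
have Np : 0 <= N%:R :> R by [].
have := ler_wpM2l Np E; rewrite -[_ *+ N]mulr_natl; lra.
Qed.
End Multiplier.

(** * The test polynomial *)

Section TestPolynomial.
Variable R : realType.
Local Notation C := (complex R).
Implicit Types (z : C).

Lemma geometric_tail (q : R) j J : 0 <= q <= 1 ->
  (1 - q) * \sum_(k < J | (j <= k)%N) q ^+ k <= q ^+ j.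
Proof.
move=> /andP[q0 q1].
suff h : (1 - q) * \sum_(k < J | (j <= k)%N) q ^+ k <= q ^+ j - (if (j <= J)%N then q ^+ J else q ^+ j).
  apply: le_trans h _; rewrite lerBlDr lerDl; case: ifP => _; exact: exprn_ge0.
elim: J => [|J IH].
  by rewrite big_ord0 mulr0; case: ifP => [|_]; rewrite ?subrr // leqn0 => /eqP ->; rewrite subrr.
rewrite big_mkcond big_ord_recr -big_mkcond /= mulrDr; case: (leqP j J) IH => jJ IH.
  rewrite (leqW jJ); apply: le_trans (lerD IH (lexx _)) _; rewrite exprS; lra.
rewrite mulr0 addr0; apply: le_trans IH _; rewrite subrr; case: ifP => [|_]; last by rewrite subrr.
by move=> h; have -> : j = J.+1 by [apply/eqP; rewrite eqn_leq h jJ]; rewrite subrr.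
Qed.

Lemma cabs_prod_sub1 (I : Type) (r : seq I) (P : pred I) (m : I -> C) :
  (forall i, P i -> cabs (m i) <= 1) ->
  cabs (\prod_(i <- r | P i) m i - 1) <= \sum_(i <- r | P i) cabs (m i - 1).
Proof.
move=> hm; suff [] : cabs (\prod_(i <- r | P i) m i) <= 1 /\ cabs (\prod_(i <- r | P i) m i - 1) <= \sum_(i <- r | P i) cabs (m i - 1) by [].
elim/big_rec2: _ => [|i s x Pi [x1 IH]]; first by rewrite subrr cabs0 cabs1.
split.
  by rewrite cabsM -[leRHS]mul1r ler_pM ?cabs_ge0 ?hm.
have -> : m i * x - 1 = (m i - 1) * x + (x - 1) by ring.
apply: le_trans (cabsD _ _) _; apply: lerD => //.
by rewrite cabsM ler_piMr ?cabs_ge0.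
Qed.

(** Starting from [0], repeatedly multiply by the multiplier of [f j] and add [f j / 10]: the
    modulus stays at most [1].  The multipliers are polynomials, so that multiplying does not
    move coefficients to lower degrees; hence a coefficient of the result at a degree [n] that
    belongs to block [i] is [(f i)`_n / 10] up to the effect of the later multipliers, which
    is small by the Cauchy-Schwarz inequality since their distances to [1] decay
    geometrically. *)
Lemma test_polynomial (J : nat) (f : nat -> {poly C}) :
  (forall j, (j < J)%N -> forall z, cabs z = 1 -> cabs (f j).[z] <= 1) ->
  (forall j, (j < J)%N -> \sum_(i < size (f j)) cabs (f j)`_i ^+ 2 <= (1 / 4) ^+ j) ->
  exists F : {poly C}, (forall z, cabs z = 1 -> cabs F.[z] <= 1) /\
    forall i n, (i < J)%N ->
      (forall j, (i < j < J)%N -> (f j)`_n = 0) ->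
      (forall j m, (j < i)%N -> (m <= n)%N -> (f j)`_m = 0) ->
      cabs (F`_n - (f i)`_n / 10) <= (1 / 4) ^+ i / 16.
Proof.
move=> f1 f2.
have q2 j : (1 / 4) ^+ j = ((1 / 2) ^+ j) ^+ 2 :> R.
  by rewrite -exprM mulnC exprM; congr (_ ^+ _); field.
have /boolp.choice[M hM] : forall j, exists M, (j < J)%N ->
    (forall z, cabs z = 1 -> cabs M.[z] <= 1 - cabs (f j).[z] / 10) /\
    exists N0, forall N, (N0 <= N)%N ->
      \sum_(k < N) cabs (M.[zeta N ^+ k] - 1) ^+ 2 <= N%:R * (9 / 64 * (1 / 4) ^+ j).
  move=> j; have [jJ|] := boolP (j < J)%N; last by exists 0.
  have a01 : 0 < (1 / 2 : R) ^+ j <= 1.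
    by rewrite exprn_gt0 ?exprn_ile1 //; lra.
  have := f2 _ jJ; rewrite q2 => f2j.
  have [M [N0 [h1 h2]]] := multiplier a01 (f1 _ jJ) f2j.
  by exists M => _; split => //; exists N0.
have M1 j z : (j < J)%N -> cabs z = 1 -> cabs (M j).[z] <= 1.
  move=> jJ z1; have [h _] := hM _ jJ; apply: le_trans (h _ z1) _.
  by rewrite lerBlDr lerDl divr_ge0 ?cabs_ge0.
have c10 : cabs (1 / 10 : C) = 1 / 10 by rewrite cabsM cabs1 cabsV cabs_nat.
pose T J' j := \prod_(k < J' | (j < k)%N) M k.
pose F J' := \sum_(j < J') (1 / 10) *: (f j * T J' j).
exists (F J); split.
  suff h J' : (J' <= J)%N -> forall z, cabs z = 1 -> cabs (F J').[z] <= 1 by apply: h.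
  elim: J' => [_ z _|J' IH J'J z z1]; first by rewrite /F big_ord0 horner0 cabs0.
  have -> : F J'.+1 = F J' * M J' + (1 / 10) *: f J'.
    rewrite /F big_ord_recr /= mulr_suml; congr (_ + _).
      apply: eq_bigr => j _; rewrite /T big_mkcond big_ord_recr -big_mkcond /= ltn_ord.
      by rewrite mulrA scalerAl.
    rewrite /T big1 ?mulr1 // => k; rewrite ltnNge -ltnS ltn_ord //.
  have [h _] := hM _ J'J; have {}h := h _ z1; have fz := f1 _ J'J _ z1.
  have {}IH := IH (ltnW J'J) _ z1.
  rewrite hornerD hornerM hornerZ; apply: le_trans (cabsD _ _) _.
  rewrite (cabsM (1 / 10)) c10 cabsM.
  have : cabs (F J').[z] * cabs (M J').[z] <= 1 * (1 - cabs (f J').[z] / 10).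
    by rewrite ler_pM ?cabs_ge0.
  lra.
move=> i n iJ hi1 hi2.
(* The weights (3/4)^k in the Cauchy-Schwarz inequality balance the decay of the quadratic
   means of M k - 1, which is (1/4)^k after squaring. *)
have err j : (j < J)%N -> cabs (f j * (T J j - 1))`_n <= 2 / 5 * (1 / 4) ^+ j.
  move=> jJ; have /boolp.choice[N0 hN0] : forall k : 'I_J, exists N0, forall N, (N0 <= N)%N ->
      \sum_(l < N) cabs ((M k).[zeta N ^+ l] - 1) ^+ 2 <= N%:R * (9 / 64 * (1 / 4) ^+ k).
    by move=> k; have [_ [N0 h]] := hM _ (ltn_ord k); exists N0.
  pose P := f j * (T J j - 1).
  pose N := (size P + size (f j) + n.+1 + \sum_(k < J) N0 k)%N.
  have sP : (size P <= N)%N by rewrite /N -!addnA leq_addr.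
  have sf : (size (f j) <= N)%N by rewrite /N -!addnA addnCA leq_addr.
  have nN : (n < N)%N by rewrite /N; lia.
  have N0N (k : 'I_J) : (N0 k <= N)%N.
    by rewrite /N (bigD1 k) //=; lia.
  have Np : 0 < N%:R :> R by rewrite ltr0n; apply: leq_ltn_trans nN.
  have z1 (k : 'I_N) : cabs (zeta N ^+ k : C) = 1 by rewrite cabsX cabs_zeta expr1n.
  have b1 : \sum_(k < N) cabs (f j).[zeta N ^+ k] ^+ 2 <= N%:R * (1 / 4) ^+ j.
    rewrite (poly_parseval sf) ler_pM2l //; apply: le_trans (f2 _ jJ).
    rewrite (big_ord_widen N (fun i => cabs (f j)`_i ^+ 2) sf) [leRHS]big_mkcond.
    apply: ler_sum => l _ /=; case: ltnP => // hl.
    by rewrite nth_default // cabs0 expr0n.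
  pose x (k : 'I_J) (l : 'I_N) := cabs ((M k).[zeta N ^+ l] - 1).
  have tail1 : \sum_(k < J | (j < k)%N) (9 / 16 : R) ^+ k <= 9 / 7 * (9 / 16) ^+ j.
    have := @geometric_tail (9 / 16) j.+1 J; rewrite exprS => /(_ _) h.
    have := h ltac:(lra); lra.
  have tail2 : \sum_(k < J | (j < k)%N) (4 / 9 : R) ^+ k <= 4 / 5 * (4 / 9) ^+ j.
    have := @geometric_tail (4 / 9) j.+1 J; rewrite exprS => /(_ _) h.
    have := h ltac:(lra); lra.
  have b2 : \sum_(l < N) cabs ((T J j - 1).[zeta N ^+ l]) ^+ 2 <=
      N%:R * (9 / 64 * (36 / 35) * (1 / 4) ^+ j).
    apply: (@le_trans _ _ (\sum_(l < N) (9 / 7 * (9 / 16) ^+ j) *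
       \sum_(k < J | (j < k)%N) (16 / 9) ^+ k * x k l ^+ 2)).
      apply: ler_sum => l _.
      have h1 : cabs ((T J j - 1).[zeta N ^+ l]) <= \sum_(k < J | (j < k)%N) x k l.
        rewrite hornerD hornerN hornerC /T horner_prod; apply: cabs_prod_sub1 => k _.
        by apply: M1 (ltn_ord k) (z1 l).
      have h2 : cabs ((T J j - 1).[zeta N ^+ l]) ^+ 2 <= (\sum_(k < J | (j < k)%N) x k l) ^+ 2.
        by rewrite lerXn2r ?nnegrE ?cabs_ge0 // sumr_ge0 // => k _; apply: cabs_ge0.
      apply: le_trans h2 _.
      have := @cauchy_schwarz R 'I_J (fun k => if (j < k)%N then (3 / 4) ^+ k else 0)
        (fun k => if (j < k)%N then (4 / 3) ^+ k * x k l else 0).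
      have -> : \sum_(k < J) (if (j < k)%N then (3 / 4) ^+ k else 0) *
         (if (j < k)%N then (4 / 3) ^+ k * x k l else 0) = \sum_(k < J | (j < k)%N) x k l.
        rewrite [RHS]big_mkcond; apply: eq_bigr => k _; case: ifP => _; last by rewrite mul0r.
        by rewrite mulrA -exprMn (_ : 3 / 4 * (4 / 3) = 1) ?expr1n ?mul1r //; field.
      have -> : \sum_(k < J) (if (j < k)%N then (3 / 4) ^+ k else 0) ^+ 2 = \sum_(k < J | (j < k)%N) (9 / 16 : R) ^+ k.
        rewrite [RHS]big_mkcond; apply: eq_bigr => k _; case: ifP => _; last by rewrite expr0n.
        by rewrite -exprM mulnC exprM; congr (_ ^+ _); field.
      have -> : \sum_(k < J) (if (j < k)%N then (4 / 3) ^+ k * x k l else 0) ^+ 2 =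
          \sum_(k < J | (j < k)%N) (16 / 9) ^+ k * x k l ^+ 2.
        rewrite [RHS]big_mkcond; apply: eq_bigr => k _; case: ifP => _; last by rewrite expr0n.
        by rewrite exprMn -exprM mulnC exprM; congr (_ ^+ _ * _); field.
      move=> h; apply: le_trans h _; rewrite ler_wpM2r // sumr_ge0 // => k _.
      by rewrite mulr_ge0 ?sqr_ge0 // exprn_ge0.
    rewrite -mulr_sumr exchange_big /=.
    have q0 : 0 <= 9 / 7 * (9 / 16 : R) ^+ j by rewrite mulr_ge0 // exprn_ge0.
    apply: (@le_trans _ _ (9 / 7 * (9 / 16) ^+ j * (N%:R * (9 / 64) * (4 / 5 * (4 / 9) ^+ j)))).
      rewrite ler_wpM2l //.
      apply: (@le_trans _ _ (\sum_(k < J | (j < k)%N) N%:R * (9 / 64) * (4 / 9) ^+ k)).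
        apply: ler_sum => k _; rewrite -mulr_sumr.
        have := hN0 k N (N0N k); rewrite -/(x k _).
        have k0 : 0 <= (16 / 9 : R) ^+ k by rewrite exprn_ge0.
        move/(ler_wpM2l k0)/le_trans; apply.
        have -> : (4 / 9 : R) ^+ k = (16 / 9) ^+ k * (1 / 4) ^+ k.
          by rewrite -exprMn; congr (_ ^+ _); field.
        by rewrite le_eqVlt; apply/orP; left; apply/eqP; ring.
      by rewrite -mulr_sumr ler_wpM2l // mulr_ge0.
    have -> : (1 / 4 : R) ^+ j = (9 / 16) ^+ j * (4 / 9) ^+ j.
      by rewrite -exprMn; congr (_ ^+ _); field.
    by rewrite le_eqVlt; apply/orP; left; apply/eqP; field.
  rewrite -(ler_pM2l Np) -[X in X * cabs _](cabs_nat R) -cabsM -(coef_mean sP nN).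
  apply: le_trans (cabs_sum _ _ _) _.
  apply: (@le_trans _ _ (\sum_(k < N) (3 / 16 * cabs (f j).[zeta N ^+ k] ^+ 2 + 4 / 3 * cabs ((T J j - 1).[zeta N ^+ k]) ^+ 2))).
    apply: ler_sum => k _; rewrite cabsM cabs_conj cabsX z1 expr1n mulr1 /P hornerM cabsM.
    have := sqr_ge0 (3 / 8 * cabs (f j).[zeta N ^+ k] - cabs ((T J j - 1).[zeta N ^+ k])); nra.
  rewrite big_split /= -!mulr_sumr.
  have q0 : 0 <= N%:R * (1 / 4 : R) ^+ j by rewrite mulr_ge0 // exprn_ge0.
  lra.
have E : (F J)`_n - (f i)`_n / 10 = \sum_(j < J | (i <= j)%N) (1 / 10) * (f j * (T J j - 1))`_n.
  rewrite /F coef_sum (bigD1 (Ordinal iJ)) //= [RHS](bigD1 (Ordinal iJ)) //= coefZ.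
  rewrite addrAC; congr (_ + _).
    by rewrite mulrBr mulr1 coefB; field.
  rewrite [RHS]big_mkcondl /= ; apply: eq_bigr => j ne; rewrite coefZ.
  case: leqP => ij.
    congr (_ * _); rewrite mulrBr mulr1 coefB (hi1 j) ?subr0 //.
    by rewrite ltn_ord andbT ltn_neqAle ij andbT eq_sym.
  by rewrite coefM big1 ?mulr0 // => m _; rewrite (hi2 j) ?mul0r // -ltnS ltn_ord.
rewrite E; apply: le_trans (cabs_sum _ _ _) _.
apply: (@le_trans _ _ (\sum_(j < J | (i <= j)%N) 1 / 10 * (2 / 5) * (1 / 4) ^+ j)).
  apply: ler_sum => j _; rewrite (cabsM (1 / 10)) c10.
  have := err _ (ltn_ord j); lra.
rewrite -mulr_sumr; have := @geometric_tail (1 / 4) i J ltac:(lra).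
have : 0 <= (1 / 4 : R) ^+ i by rewrite exprn_ge0.
lra.
Qed.
End TestPolynomial.

(** * A dense interval next to a sparse one *)

Section Contrast.
Import mathcomp.boot.fintype mathcomp.boot.finset.
Variables (R : realType) (p : nat).
Hypothesis p_pr : prime p.
Local Notation C := (complex R).
Local Notation F := 'F_p.

Let p_gt0 : (0 < p)%N. Proof. exact: prime_gt0. Qed.

Lemma sum_Fp (V : nmodType) (g : nat -> V) : \sum_(x : F) g (val x) = \sum_(i < p) g i.
Proof. by rewrite -(big_mkord xpredT) Fp_cast // big_mkord. Qed.

Lemma val_natr_Fp n : (n < p)%N -> val (n%:R : F) = n.
Proof. by move=> np; rewrite /= val_Fp_nat // modn_small. Qed.

Lemma natr_val_Fp (x : F) : (val x)%:R = x.
Proof. exact: natr_Zp. Qed.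

Lemma harmonic_block o L N : (2 ^ L * o.+1 <= N)%N ->
  L%:R / 6 <= \sum_(o <= r < N) (1 / (3 * r + 1)%:R : R).
Proof.
elim: L N => [|L IH] N hN.
  by rewrite mul0r sumr_ge0 // => r _; rewrite divr_ge0.
set M := (2 ^ L * o.+1)%N in IH.
have hM : (2 * M <= N)%N by rewrite /M mulnA -expnS.
have oM : (o <= M)%N by rewrite /M (leq_trans (leqnSn o)) // leq_pmull // expn_gt0.
have M0 : (0 < M)%N by rewrite muln_gt0 expn_gt0.
have MN : (M <= N)%N by apply: leq_trans hM; rewrite leq_pmull.
rewrite (big_cat_nat oM MN) /= -[L.+1%:R]natr1 mulrDl; apply: lerD; first exact: IH.
apply: (@le_trans _ _ (\sum_(M <= r < 2 * M) (1 / (6 * M)%:R : R))).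
  rewrite big_const_nat iter_addr_0 mul2n -addnn addnK -mulr_natl natrM.
  have Mp : 0 < M%:R :> R by rewrite ltr0n.
  by rewrite le_eqVlt; apply/orP; left; apply/eqP; field; rewrite gt_eqF.
have M2 : (M <= 2 * M)%N by rewrite leq_pmull.
rewrite [leRHS](big_cat_nat M2 hM) /=.
rewrite -[leLHS]addr0; apply: lerD; last by rewrite sumr_ge0 // => r _; rewrite divr_ge0.
rewrite big_nat_cond [leRHS]big_nat_cond; apply: ler_sum => r /andP[/andP[r1 r2] _].
by rewrite ler_pM2l // lef_pV2 ?posrE ?ltr0n ?ler_nat ?muln_gt0 ?addn_gt0 ?orbT //; lia.
Qed.

(** Points are grouped into blocks of geometrically growing size according to their rank
    counted from the right, so that later blocks consist of smaller elements. *)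
Section Ranks.
Variable P : {set F}.
Definition rank (x : F) := #|[set y in P | (val x < val y)%N]|.
Definition blk (x : F) := trunc_log 4 (3 * rank x + 1).

Lemma rank_anti x y : (val x <= val y)%N -> (rank y <= rank x)%N.
Proof.
move=> xy; apply: subset_leq_card; apply/subsetP => z; rewrite !inE => /andP[-> h].
exact: leq_ltn_trans h.
Qed.

Lemma rank_lt x y : y \in P -> (val x < val y)%N -> (rank y < rank x)%N.
Proof.
move=> yP xy; apply: proper_card; apply/properP; split.
  by apply/subsetP => z; rewrite !inE => /andP[-> h]; apply: ltn_trans h.
by exists y; rewrite !inE yP ?xy // ltnn.
Qed.

Lemma rank_inj : {in P &, injective rank}.
Proof.
move=> x y xP yP e; apply/val_inj; case: (ltngtP (val x) (val y)) => // h.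
  by have := rank_lt yP h; rewrite e ltnn.
by have := rank_lt xP h; rewrite e ltnn.
Qed.

Lemma rank_small x : (rank x <= #|P|)%N.
Proof. by apply: subset_leq_card; apply/subsetP => z; rewrite inE => /andP[]. Qed.

Lemma blk_anti x y : (val x <= val y)%N -> (blk y <= blk x)%N.
Proof.
move=> /rank_anti h; apply: leq_trunc_log; lia.
Qed.

Lemma blk_bounds x : (4 ^ blk x <= 3 * rank x + 1 < 4 ^ (blk x).+1)%N.
Proof. by apply: trunc_log_bounds; rewrite ?addn1. Qed.

(** If [4 ^ j = 3 r0 + 1], then the ranks in block [j] are those in [r0 .. 4 r0], and there are
    [4 ^ j] of these. *)
Lemma card_blk j : (#|[set x in P | blk x == j]| <= 4 ^ j)%N.
Proof.
have [r0 hr0] : exists r0, (4 ^ j = 3 * r0 + 1)%N.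
  elim: j => [|j [r0 IH]]; first by exists 0%N.
  by exists (4 * r0 + 1)%N; rewrite expnS IH; ring.
set S := [set x in P | _].
have u : uniq [seq rank x | x <- enum S].
  rewrite map_inj_in_uniq ?enum_uniq // => x y; rewrite !mem_enum !inE.
  by move=> /andP[xP _] /andP[yP _]; apply: rank_inj.
rewrite cardE -(size_map rank) -(size_iota r0 (4 ^ j)); apply: uniq_leq_size u _.
move=> _ /mapP[x + ->]; rewrite mem_enum inE => /andP[_ /eqP bj].
have := blk_bounds x; rewrite bj mem_iota expnS hr0; lia.
Qed.
End Ranks.

(** A discrete triangle: the number of ways to write [v] as a sum of two numbers below [b],
    that is the coefficient of ['X^v] in the square of [1 + 'X + ... + 'X^(b - 1)]. *)
Definition tri b v : nat := \sum_(j < v.+1) ((j < b) && (v - j < b))%N.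

Lemma coef_tri b v : ((\poly_(i < b) (1 : C)) ^+ 2)`_v = (tri b v)%:R.
Proof.
rewrite expr2 coefM /tri natr_sum; apply: eq_bigr => j _; rewrite !coef_poly.
by case: (_ < _)%N; case: (_ < _)%N; rewrite ?mulr1 ?mulr0 ?mul0r.
Qed.

Lemma tri_eq0 b v : (2 * b <= v)%N -> tri b v = 0%N.
Proof.
move=> bv; rewrite /tri big1 // => j _; case: ltnP => //= jb.
by rewrite ltnNge (_ : (b <= v - j)%N) //; lia.
Qed.

Lemma tri_ge b v : (b <= 2 * v.+1)%N -> (2 * v.+1 <= 3 * b)%N -> (b <= 2 * tri b v)%N.
Proof.
move=> h1 h2; have [vb|bv] := ltnP v b.
  suff -> : tri b v = v.+1 by [].
  rewrite /tri -[RHS]card_ord -sum1_card; apply: eq_bigr => j _.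
  by rewrite (leq_trans (ltn_ord j) vb) (leq_ltn_trans (leq_subr j v) vb).
have : (2 * b - v.+1 <= tri b v)%N.
  rewrite /tri -(big_mkord xpredT (fun j => nat_of_bool ((j < b) && (v - j < b))%N)).
  have e1 : (v.+1 - b <= v.+1)%N by rewrite leq_subr.
  have e2 : (v.+1 - b <= b)%N by lia.
  have e3 : (b <= v.+1)%N by lia.
  rewrite (big_cat_nat (leq0n _) e1) /= (big_cat_nat e2 e3) /=.
  apply: leq_trans (leq_addl _ _); apply: leq_trans (leq_addr _ _).
  rewrite (_ : (2 * b - v.+1 = \sum_(v.+1 - b <= j < b) 1)%N); last first.
    by rewrite sum_nat_const_nat muln1; lia.
  rewrite big_nat_cond [leqRHS]big_nat_cond; apply: leq_sum => j /andP[/andP[j1 j2] _].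
  by rewrite j2 (_ : (v - j < b)%N) //; lia.
lia.
Qed.

Let phase_shuffle (a b c d : C) : a * (b * c * d) = b * d * (a * c).
Proof. by ring. Qed.

Let real_complex_scale (a b : R) : (a / 10 * b)%:C = a%:C * 10^-1 * b%:C :> C.
Proof. by rewrite !rmorphM fmorphV rmorph_nat. Qed.

Let main_term_wins (Q c d r : R) : 0 < Q -> 1 <= c -> c * d <= c * (Q / 16) -> - (c * d) <= r ->
  3 / 80 * Q <= Q / 10 * c + r.
Proof.
move=> Q0 c1 h1 h2; have : Q <= c * Q by rewrite ler_peMl // ltW.
lra.
Qed.

Let contrast_arith (b l x w : R) : 0 < b -> l / 6 <= x -> b / 2 * (3 / 80) * x <= w * b ->
  l <= 320 * w.
Proof.
move=> b0 h1 h2; have h3 : b * (3 / 160 * (l / 6)) <= b * w.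
  apply: le_trans (le_trans _ h2) _; last by rewrite mulrC.
  have -> : b / 2 * (3 / 80) * x = b * (3 / 160 * x) by field.
  by rewrite ler_pM2l //; lra.
rewrite ler_pM2l // in h3; lra.
Qed.

(** The argument of McGehee, Pigno and Smith for Littlewood's conjecture, localised to an
    interval of length [2 b] by a triangle.  The test polynomial has coefficients about
    [4 ^ - blk x] times the phase of [f x], so that its pairing with [f] is at least a
    multiple of the sum of the reciprocals of the ranks.  Only the points in the middle half,
    where the triangle is large, are counted; their ranks run from [o] to [o + n], and the
    sum of their reciprocals is about [ln ((o + n) / o)]. *)
Lemma littlewood_contrast (f : F -> C) b L :
  (0 < b)%N -> (2 * b <= p)%N -> (forall x, x \in supp f -> 1 <= cabs (f x)) ->
  let o := #|[set x in supp f | (val x < 2 * b)%N && (3 * b < 2 * (val x).+1)%N]| in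
  let n := #|[set x in supp f | (b <= 2 * (val x).+1)%N && (2 * (val x).+1 <= 3 * b)%N]| in
  (2 ^ L * o.+1 <= o + n)%N -> L%:R <= 320 * wiener_norm f.
Proof.
move=> b0 bp f1 o n hL.
pose P := [set x in supp f | (val x < 2 * b)%N].
pose In := [set x in supp f | (b <= 2 * (val x).+1)%N && (2 * (val x).+1 <= 3 * b)%N].
pose Out := [set x in supp f | (val x < 2 * b)%N && (3 * b < 2 * (val x).+1)%N].
have InP x : x \in In -> x \in P.
  have arith v : (2 * v.+1 <= 3 * b)%N -> (v < 2 * b)%N by clear -b0; lia.
  by rewrite !inE => /andP[-> /andP[_ h]] /=; apply: arith.
pose q : R := 1 / 4.
have q0 j : 0 < q ^+ j by rewrite exprn_gt0 // divr_gt0.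
have qC j : cabs ((q ^+ j)%:C : C) = q ^+ j by rewrite cabs_real ger0_norm // ltW.
pose c j x : C := if (x \in P) && (blk P x == j) then (q ^+ j)%:C * phase (f x) else 0.
have cle j x : cabs (c j x) <= q ^+ j * ((x \in P) && (blk P x == j))%:R.
  rewrite /c; case: ifP => _; last by rewrite cabs0 mulr0.
  by rewrite cabsM qC ler_pM2l // phase_le1.
(* Block j, with coefficients of modulus (1/4)^j: its sum of moduli is at most 1 and its
   sum of squares at most (1/4)^j, as there are at most 4^j points in it. *)
pose fj j : {poly C} := \poly_(i < p) c j i%:R.
have sumc j : \sum_(x : F) ((x \in P) && (blk P x == j))%:R <= (4 ^ j)%:R :> R.
  rewrite -natr_sum ler_nat; apply: leq_trans (card_blk P j); rewrite -sum1_card [leqRHS]big_mkcond.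
  by apply: leq_sum => x _; rewrite inE; case: ifP.
have q4 j : q ^+ j * (4 ^ j)%:R = 1.
  by rewrite natrX -exprMn (_ : q * 4 = 1) ?expr1n // /q; field.
have toF (V : nmodType) (g : F -> V) : \sum_(i < p) g i%:R = \sum_x g x.
  by rewrite -(sum_Fp (fun i => g i%:R)); apply: eq_bigr => x _; rewrite natr_val_Fp.
have fj1 j z : cabs z = 1 -> cabs (fj j).[z] <= 1.
  move=> z1; rewrite /fj horner_poly; apply: le_trans (cabs_sum _ _ _) _.
  under eq_bigr => i _ do rewrite cabsM cabsX z1 expr1n mulr1.
  rewrite (toF _ (fun x => cabs (c j x))).
  apply: (@le_trans _ _ (\sum_x q ^+ j * ((x \in P) && (blk P x == j))%:R)).
    by apply: ler_sum => x _.
  by rewrite -mulr_sumr; apply: le_trans (ler_wpM2l (ltW (q0 j)) (sumc j)) _; rewrite q4.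
have fj2 j : \sum_(i < size (fj j)) cabs (fj j)`_i ^+ 2 <= (1 / 4) ^+ j.
  have sz : (size (fj j) <= p)%N by apply: size_poly.
  apply: (@le_trans _ _ (\sum_(i < p) cabs (c j i%:R) ^+ 2)).
    rewrite (big_ord_widen p (fun i => cabs (fj j)`_i ^+ 2) sz) big_mkcond.
    by apply: ler_sum => i _ /=; case: ifP => _; rewrite ?sqr_ge0 // coef_poly ltn_ord.
  rewrite (toF _ (fun x => cabs (c j x) ^+ 2)).
  apply: (@le_trans _ _ (\sum_x q ^+ j * q ^+ j * ((x \in P) && (blk P x == j))%:R)).
    apply: ler_sum => x _; rewrite expr2; have h := cle j x.
    apply: le_trans (ler_pM _ _ h h) _; rewrite ?cabs_ge0 //.
    by case: (_ && _); rewrite ?mulr1 ?mulr0.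
  rewrite -mulr_sumr -[leRHS]mulr1 -mulrA ler_pM2l //.
  by apply: le_trans (ler_wpM2l (ltW (q0 j)) (sumc j)) _; rewrite q4.
pose J := #|P|.+1.
have [G [G1 Gc]] := @test_polynomial R J fj (fun j _ => fj1 j) (fun j _ => fj2 j).
have blkJ x : (blk P x < J)%N.
  have /andP[h _] := blk_bounds P x; rewrite ltnS -(@leq_exp2l 4) //.
  apply: leq_trans h _; have := rank_small P x.
  have : (3 * #|P| + 1 <= 4 ^ #|P|)%N.
    by elim: (#|P|) => // m IH; rewrite expnS; lia.
  lia.
have coefG x : x \in P -> cabs (G`_(val x) - (q ^+ blk P x)%:C * phase (f x) / 10) <= q ^+ blk P x / 16.
  move=> xP; have xp := val_Fp_lt p_pr x.
  have E j : (fj j)`_(val x) = c j x by rewrite coef_poly xp natr_val_Fp.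
  have := Gc (blk P x) (val x) (blkJ x); rewrite E /c xP eqxx /=; apply.
    by move=> j /andP[ij _]; rewrite E /c (_ : (blk P x == j) = false) ?andbF // ltn_eqF.
  move=> j m ji mx; have mp : (m < p)%N by apply: leq_ltn_trans xp.
  rewrite coef_poly mp /c; case: ifP => // /andP[mP /eqP bm].
  have : (blk P x <= blk P (m%:R : F))%N by apply: blk_anti; rewrite val_natr_Fp.
  by rewrite bm leqNgt ji.
pose B : {poly C} := \poly_(i < b) 1.
pose phi (x : F) : C := G`_(val x) * conjc (B ^+ 2)`_(val x).
have sB : \sum_(i < size B) cabs B`_i ^+ 2 <= b%:R.
  have sz : (size B <= b)%N by apply: size_poly.
  rewrite (big_ord_widen b (fun i => cabs B`_i ^+ 2) sz) -[b in leRHS]card_ord -sum1_card natr_sum big_mkcond /=.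
  apply: ler_sum => i _; case: ifP => _ //; rewrite coef_poly ltn_ord cabs1 expr1n //.
have ftphi g : cabs (ft phi g) <= b%:R.
  pose z : C := zeta p ^+ val g.
  have z1 : cabs z = 1 by rewrite cabsX cabs_zeta expr1n.
  have E : ft phi g = \sum_(i < p) G`_i * conjc (B ^+ 2)`_i * z ^+ i.
    rewrite -(sum_Fp (fun i => G`_i * conjc (B ^+ 2)`_i * z ^+ i)); apply: eq_bigr => x _.
    by rewrite /phi /chi val_FpM // zeta_mod // exprM.
  have E2 : ft phi g = \sum_(i < maxn (size G) (size (B ^+ 2))) G`_i * conjc (B ^+ 2)`_i * z ^+ i.
    rewrite E; set N := maxn _ _; pose a i := G`_i * conjc (B ^+ 2)`_i * z ^+ i.
    have a0 i : (2 * b <= i)%N -> a i = 0.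
      by move=> bi; rewrite /a coef_tri tri_eq0 // rmorph0 mulr0 mul0r.
    have a1 i : (N <= i)%N -> a i = 0.
      by move=> Ni; rewrite /a nth_default ?mul0r // (leq_trans _ Ni) // leq_maxl.
    have [pN|Np] := leqP p N.
      rewrite (big_ord_widen N a pN) big_mkcond; apply: eq_bigr => i _ /=.
      by case: ltnP => // pi; rewrite -[RHS]/(a i) a0 // (leq_trans bp pi).
    rewrite [RHS](big_ord_widen p a (ltnW Np)) [RHS]big_mkcond; apply: eq_bigr => i _ /=.
    by case: ltnP => // Ni; rewrite -[LHS]/(a i) a1.
  rewrite E2; apply: le_trans (@hadamard_square_le R G B z 1 G1 ler01 z1) _; by rewrite mul1r.
have pair := wiener_pairing p_pr f ftphi.
have lower x : (x \in In)%:R * (b%:R / 2 * (3 / 80 * q ^+ blk P x)) <= Re (f x * phi x).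
  have xS0 : x \notin P -> phi x = 0 \/ f x = 0.
    rewrite inE negb_and => /orP[|h]; first by rewrite inE negbK => /eqP; right.
    by left; rewrite /phi coef_tri tri_eq0 ?rmorph0 ?mulr0 // leqNgt.
  have [xP|xP] := boolP (x \in P); last first.
    have -> : (x \in In) = false by apply: contraNF xP; apply: InP.
    by rewrite mul0r; case: (xS0 xP) => ->; rewrite ?mul0r ?mulr0.
  have xS : x \in supp f by move: xP; rewrite inE => /andP[].
  have fx1 := f1 _ xS; set i := blk P x.
  have e1 : Re (f x * phi x) = (tri b (val x))%:R * Re (f x * G`_(val x)).
    rewrite /phi coef_tri; have -> : ((tri b (val x))%:R : C) = ((tri b (val x))%:R : R)%:C by rewrite rmorph_nat.
    by rewrite conjc_real mulrA mulrC cRe_realM.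
  have e2 : 3 / 80 * q ^+ i <= Re (f x * G`_(val x)).
    have h := coefG _ xP; set dlt := G`_(val x) - _ in h.
    have -> : f x * G`_(val x) = (q ^+ i / 10 * cabs (f x))%:C + f x * dlt.
      have -> : (q ^+ i / 10 * cabs (f x))%:C = f x * ((q ^+ i)%:C * phase (f x) / 10) :> C.
        by rewrite real_complex_scale phase_shuffle phaseM.
      by rewrite -mulrDr /dlt addrC subrK.
    rewrite cReD /=; have := Re_ge_Ncabs (f x * dlt); rewrite cabsM.
    have : cabs (f x) * cabs dlt <= cabs (f x) * (q ^+ i / 16) by rewrite ler_wpM2l // cabs_ge0.
    by move=> e5 e6; apply: main_term_wins (q0 i) fx1 e5 e6.
  rewrite e1; have e3 : 0 <= 3 / 80 * q ^+ i by rewrite mulr_ge0 // ltW.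
  case: (boolP (x \in In)) => xI.
    rewrite mul1r; apply: ler_pM => //.
    move: xI; rewrite inE => /andP[_ /andP[h1 h2]].
    by have := tri_ge h1 h2; rewrite -(ler_nat R) natrM ler_pdivrMr // mulrC.
  by rewrite mul0r mulr_ge0 // (le_trans e3).
have tot : b%:R / 2 * (3 / 80) * \sum_(x in In) q ^+ blk P x <= wiener_norm f * b%:R.
  apply: le_trans pair; apply: le_trans (Re_le_cabs _); rewrite cRe_sum mulr_sumr big_mkcond.
  apply: ler_sum => x _; apply: le_trans (lower x); case: (_ \in _); rewrite ?mul0r ?mul1r //.
  by rewrite !mulrA.
have bpos : 0 < b%:R :> R by rewrite ltr0n.
have rk : \sum_(x in In) (1 / (3 * rank P x + 1)%:R : R) = \sum_(o <= r < o + n) (1 / (3 * r + 1)%:R : R).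
  rewrite -big_enum /= -(big_map (rank P) xpredT (fun r => 1 / (3 * r + 1)%:R : R)) /=.
  apply: perm_big; apply: uniq_perm; [|exact: iota_uniq|].
    rewrite map_inj_in_uniq ?enum_uniq // => x y; rewrite !mem_enum => /InP xP /InP yP.
    exact: rank_inj.
  have u : uniq [seq rank P x | x <- enum In].
    rewrite map_inj_in_uniq ?enum_uniq // => x y; rewrite !mem_enum => /InP xP /InP yP.
    exact: rank_inj.
  have sub : {subset [seq rank P x | x <- enum In] <= index_iota o (o + n)}.
    move=> _ /mapP[x + ->]; rewrite mem_enum mem_index_iota => xI.
    have xP := InP _ xI.
    move: xI; rewrite inE => /andP[xS /andP[x1 x2]]; apply/andP; split.
      apply: subset_leq_card; apply/subsetP => y; rewrite !inE => /andP[-> /andP[-> h]] /=.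
      by move: (leq_ltn_trans x2 h); rewrite ltn_pmul2l.
    have -> : (o + n = #|Out :|: In|)%N.
      rewrite cardsU (_ : Out :&: In = set0) ?cards0 ?subn0 //.
      by apply/setP => y; rewrite !inE; apply/negP => /andP[/andP[_ /andP[_ h1]] /andP[_ /andP[_ h2]]]; move: h1; rewrite ltnNge h2.
    apply: proper_card; apply/properP; split.
      apply/subsetP => y; rewrite !inE => /andP[/andP[-> ->] h] /=.
      case: ltnP => //= h'; rewrite andbT (leq_trans x1) // leq_mul2l /=.
      exact: ltnW.
    by exists x; rewrite !inE ?ltnn ?andbF // x1 x2 !andbT; move: xS; rewrite inE => ->; rewrite orbT.
  have sz : (size (index_iota o (o + n)) <= size [seq rank P x | x <- enum In])%N.
    by rewrite size_iota size_map -cardE addKn.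
  by have [] := uniq_min_size u sub sz.
have low : \sum_(x in In) (1 / (3 * rank P x + 1)%:R : R) <= \sum_(x in In) q ^+ blk P x.
  apply: ler_sum => x _; have /andP[h _] := blk_bounds P x.
  rewrite /q expr_div_n expr1n ler_pM2l // lef_pV2 ?posrE ?exprn_gt0 ?ltr0n ?addn1 //.
  by rewrite -natrX ler_nat; move: h; rewrite addn1.
have := harmonic_block hL; rewrite -rk => har.
have low2 := le_trans har low.
exact: contrast_arith bpos low2 tot.
Qed.
End Contrast.

(** * Large values along a lacunary sequence *)

Section Lacunary.
Variables (R : realType) (p : nat).
Hypothesis p_pr : prime p.
Local Notation C := (complex R).
Local Notation F := 'F_p.

Let p_gt0 : (0 < p)%N. Proof. exact: prime_gt0. Qed.

Lemma natr_p_eq0 : (p%:R : F) = 0.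
Proof. by apply/val_inj; rewrite /= val_Fp_nat // modnn. Qed.

Lemma natr_Fp_neq0 y : (0 < y < p)%N -> (y%:R : F) != 0.
Proof.
move=> /andP[y0 yp]; apply/eqP => /(congr1 val) /=; rewrite val_Fp_nat // modn_small //.
by move=> h; move: y0; rewrite h.
Qed.

(** Expanding a Riesz product over a sequence in which every term exceeds the sum of the
    preceding ones, only the constant term survives averaging over the characters.  The sum
    [Z m u] keeps track of a shift [u], which makes the induction on the length possible. *)
Section Dissociated.
Variables (x : nat -> nat) (a : nat -> C) (A : C).
Let D m := (\sum_(j < m) x j)%N.
Let factor (g : F) j : C := A + a j * chi (g * (x j)%:R) + conjc (a j) * conjc (chi (g * (x j)%:R)).
Let Z m (u : F) : C := \sum_g chi (g * u) * \prod_(j < m) factor g j.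

Let ZS m u : Z m.+1 u = A * Z m u + a m * Z m (u + (x m)%:R) + conjc (a m) * Z m (u - (x m)%:R).
Proof.
rewrite /Z !mulr_sumr -!big_split /=; apply: eq_bigr => g _.
have h1 : chi (g * (u + (x m)%:R)) = chi (g * u) * chi (g * (x m)%:R) :> C.
  by rewrite mulrDr chiD.
have h2 : chi (g * (u - (x m)%:R)) = chi (g * u) * conjc (chi (g * (x m)%:R)) :> C.
  by rewrite mulrBr chiD // chiN.
rewrite big_ord_recr /= h1 h2 /factor.
move: (\prod_(j < m) _) (chi (g * u)) (chi (g * (x m)%:R)) => P b c.
by move: (conjc c) (conjc (a m)) (a m) => c' a' a''; ring.
Qed.

Lemma riesz_mean m : (forall i, (i < m)%N -> (\sum_(j < i) x j < x i)%N) -> (\sum_(j < m) x j < p)%N ->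
  \sum_(g : F) \prod_(j < m) (A + a j * chi (g * (x j)%:R) + conjc (a j * chi (g * (x j)%:R))) =
  p%:R * A ^+ m.
Proof.
move=> lac Dp.
under eq_bigr => g _ do under eq_bigr => j _ do rewrite (rmorphM (conjc (R := R))) -/(factor g j).
have Dle k : (k <= m)%N -> (D k < p)%N.
  move=> km; apply: leq_ltn_trans Dp; rewrite /D.
  by rewrite (big_ord_widen m x km) [leqLHS]big_mkcond; apply: leq_sum => i _; case: ifP.
have Z0 k : (k <= m)%N -> forall y, (D k < y)%N -> (y + D k < p)%N -> Z k y%:R = 0.
  elim: k => [_ y|k IH km y].
    rewrite /D /Z !big_ord0 addn0 => y0 yp.
    under eq_bigr => g _ do rewrite big_ord0 mulr1.
    by rewrite sum_chi // (negbTE (natr_Fp_neq0 _)) // y0.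
  have DS : D k.+1 = (D k + x k)%N by rewrite /D big_ord_recr.
  rewrite DS => h1 h2; rewrite ZS.
  have xy : (x k <= y)%N by lia.
  rewrite -natrD -natrB // !IH ?mulr0 ?addr0 //; lia.
have main k : (k <= m)%N -> Z k 0 = p%:R * A ^+ k.
  elim: k => [_|k IH km].
    rewrite /Z; under eq_bigr => g _ do rewrite big_ord0 mulr1.
    by rewrite sum_chi // eqxx mulr1.
  have DS : D k.+1 = (D k + x k)%N by rewrite /D big_ord_recr.
  have h1 : (D k < x k)%N := lac k km.
  have h2 := Dle _ km; rewrite DS in h2.
  rewrite ZS IH ?(ltnW km) // add0r sub0r Z0 ?(ltnW km) //; last by lia.
  have -> : - (x k)%:R = (p - x k)%:R :> F.
    by rewrite natrB ?natr_p_eq0 ?sub0r //; lia.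
  by rewrite Z0 ?(ltnW km) //; [rewrite exprS; ring|lia|lia].
rewrite -main //; apply: eq_bigr => g _; by rewrite mulr0 chi0 mul1r.
Qed.
End Dissociated.

(** Each factor [expR (l * t)] is at most [1 + l ^ 2 + l * t] for [|t| <= 1], and the product of
    these is a Riesz product, whose mean is [(1 + l ^ 2) ^ m]. *)
Lemma riesz_moment (x : nat -> nat) (d : nat -> C) (l : R) m : 0 <= l <= 1 / 4 ->
  (forall i, cabs (d i) <= 1) ->
  (forall i, (i < m)%N -> (\sum_(j < i) x j < x i)%N) -> (\sum_(j < m) x j < p)%N ->
  \sum_(g : F) expR (l * \sum_(j < m) Re (d j * chi (g * (x j)%:R))) <= p%:R * expR (l ^+ 2 * m%:R).
Proof.
move=> /andP[l0 l1] d1 lac Dp.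
have := @riesz_mean x (fun j => (l / 2)%:C * d j) ((1 + l ^+ 2)%:C) m lac Dp.
move=> E.
apply: (@le_trans _ _ (\sum_(g : F) \prod_(j < m) (1 + l ^+ 2 + l * Re (d j * chi (g * (x j)%:R))))).
  apply: ler_sum => g _; rewrite mulr_sumr expR_sum; apply: ler_prod => j _.
  rewrite expR_ge0 /=; set u := Re _.
  have u1 : `|u| <= 1.
    rewrite ler_norml /u; have := Re_le_cabs (d j * chi (g * (x j)%:R)).
    have := Re_ge_Ncabs (d j * chi (g * (x j)%:R)); rewrite cabsM cabs_chi // mulr1.
    by have := d1 j; move: (cabs _) => t h1 h2 h3; apply/andP; split; lra.
  have lu : `|l * u| <= 1 / 4.
    by rewrite normrM ger0_norm // (le_trans _ l1) // ler_piMr.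
  apply: le_trans (expR_le_quad lu) _; rewrite exprMn.
  have : l ^+ 2 * u ^+ 2 <= l ^+ 2.
    by rewrite ler_piMr ?sqr_ge0 // -(real_normK (num_real u)) expr_le1.
  lra.
have -> : \sum_(g : F) \prod_(j < m) (1 + l ^+ 2 + l * Re (d j * chi (g * (x j)%:R))) = p%:R * (1 + l ^+ 2) ^+ m.
  apply: complexI; rewrite rmorph_sum rmorphM rmorphXn rmorph_nat /= -E; apply: eq_bigr => g _.
  rewrite rmorph_prod; apply: eq_bigr => j _ /=.
  have key (z : C) : (1 + l ^+ 2 + l * Re z)%:C = (1 + l ^+ 2)%:C + (l / 2)%:C * z + conjc ((l / 2)%:C * z).
    by case: z => u v; apply/eqP; rewrite eq_complex /=; apply/andP; split; apply/eqP; field.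
  by rewrite key mulrA.
rewrite ler_pM2l ?ltr0n // expRM_natr; apply: lerXn2r; rewrite ?nnegrE ?addr_ge0 ?sqr_ge0 ?expR_ge0 //.
exact: expR_ge1Dx.
Qed.

Lemma cabs_le_ReIm (z : C) : cabs z <= `|Re z| + `|Im z|.
Proof.
rewrite -(ler_pXn2r (n := 2)) ?nnegrE ?cabs_ge0 ?addr_ge0 // cabsE.
rewrite -(real_normK (num_real (Re z))) -(real_normK (num_real (Im z))).
move: (normr_ge0 (Re z)) (normr_ge0 (Im z)); move: `|_| `|_| => u v u0 v0.
have := mulr_ge0 u0 v0; rewrite sqrrD; lra.
Qed.

(** The threshold [T] splits a value into a bounded part and an excess, which an exponential
    moment controls. *)
Lemma norm_le_expR (y l T : R) : 0 < l ->
  `|y| <= T + l^-1 * expR (- (l * T)) * (expR (l * y) + expR (l * - y)).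
Proof.
move=> l0.
have key z : z <= T + l^-1 * expR (- (l * T)) * expR (l * z).
  rewrite -mulrA -expRD -lerBlDl mulrC ler_pdivlMr //.
  have -> : - (l * T) + l * z = (z - T) * l by ring.
  by apply: le_trans (expR_ge1Dx _); rewrite lerDr.
have c0 : 0 <= l^-1 * expR (- (l * T)) by rewrite mulr_ge0 ?invr_ge0 ?expR_ge0 // ltW.
have h1 := key y; have h2 := key (- y).
have := mulr_ge0 c0 (expR_ge0 (l * y)); have := mulr_ge0 c0 (expR_ge0 (l * - y)).
rewrite mulrDr; move: h1 h2; move: (_ * expR (l * y)) (_ * expR (l * - y)) => u v h1 h2 v0 u0.
by rewrite ler_norml; apply/andP; split; lra.
Qed.

(** Pair [f] with its phases at the points [x j].  The transform [W] of this test function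
    exceeds the threshold [T] rarely by [riesz_moment], and the excess meets coefficients of
    [f] of size at most [2 ^ e * 2 ^ l / p]; the part below [T] contributes at most
    [2 ^ e * T] in each of the real and imaginary parts.  The sum of the moduli of the [m]
    values, at least [m / 2], is too large for this. *)
Lemma riesz_chain (f : F -> C) (e l : nat) (x : nat -> nat) :
  let m := (1024 * 4 ^ e * l)%N in
  (0 < l)%N -> wiener_norm f <= (2 ^ e)%:R -> (#|supp f| <= 2 ^ l)%N ->
  (forall i, (i < m)%N -> (\sum_(j < i) x j < x i)%N) -> (\sum_(j < m) x j < p)%N ->
  (forall i, (i < m)%N -> 1 / 2 <= cabs (f (x i)%:R)) -> False.
Proof.
move=> m l0 wK supl lac xp big.
set K : R := (2 ^ e)%:R; have K1 : 1 <= K by rewrite ler1n expn_gt0.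
have mE : (m%:R : R) = 1024 * K ^+ 2 * l%:R.
  have e4 : (4 ^ e = 2 ^ e * 2 ^ e)%N by rewrite -expnMn.
  by rewrite /m e4 !natrM expr2 mulrA.
have m0 : (0 < m)%N by rewrite /m !muln_gt0 expn_gt0 l0.
(* With these choices lam^2 m = l and lam T = 4 l, so that the excess is at most expR (- 3 l)
   before it is compared with the size 2^l of the support. *)
pose lam : R := (32 * K)^-1; pose T : R := 128 * K * l%:R.
have lam0 : 0 < lam by rewrite invr_gt0; lra.
have lamT : lam * T = 4 * l%:R by rewrite /lam /T; field; lra.
have lam2 : lam ^+ 2 * m%:R = l%:R by rewrite mE /lam; field; lra.
pose d j := phase (f (x j)%:R); pose W (g : F) := \sum_(j < m) d j * chi (g * (x j)%:R).
have moment c : cabs c <= 1 -> \sum_(g : F) expR (lam * Re (c * W g)) <= p%:R * expR l%:R.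
  move=> c1; have d1 j : cabs (c * d j) <= 1 by rewrite cabsM mulr_ile1 ?cabs_ge0 ?phase_le1.
  have lam14 : 0 <= lam <= 1 / 4.
    rewrite (ltW lam0) /= /lam -div1r ler_pdivrMr; lra.
  apply: le_trans _ (_ : _ <= p%:R * expR (lam ^+ 2 * m%:R)) _; last by rewrite lam2.
  apply: le_trans _ (riesz_moment lam14 d1 lac xp); apply: ler_sum => g _.
  rewrite ler_expR ler_pM2l // /W mulr_sumr cRe_sum; apply: ler_sum => j _.
  by rewrite mulrA.
(* The four rotations of W bound the moduli of its real and imaginary parts. *)
pose ii : C := Complex 0 1.
pose E g := expR (lam * Re (1 * W g)) + expR (lam * Re (- 1 * W g)) +
  (expR (lam * Re (- ii * W g)) + expR (lam * Re (ii * W g))).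
have Esum : \sum_g E g <= 4 * (p%:R * expR l%:R).
  rewrite !big_split /=.
  have h1 := moment 1; have h2 := moment (- 1); have h3 := moment (- ii); have h4 := moment ii.
  rewrite !cabsN cabs1 in h1 h2 h3 h4.
  have ci : cabs ii <= 1 by rewrite /= expr0n /= add0r expr1n sqrtr1.
  by move: (h1 (lexx _)) (h2 (lexx _)) (h3 ci) (h4 ci); lra.
pose q := lam^-1 * expR (- (lam * T)).
have WE g : cabs (W g) <= 2 * T + q * E g.
  apply: le_trans (cabs_le_ReIm _) _.
  have h1 := norm_le_expR (Re (W g)) T lam0; have h2 := norm_le_expR (Im (W g)) T lam0.
  have e1 : Re (- 1 * W g) = - Re (W g) by rewrite mulN1r cReN.
  have e2 : Re (- ii * W g) = Im (W g) by case: (W g) => u v /=; ring.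
  have e3 : Re (ii * W g) = - Im (W g) by case: (W g) => u v /=; ring.
  rewrite /E e1 e2 e3 mul1r -/q in h1 h2 *; lra.
have low : m%:R / 2 <= \sum_g cabs (fourier f g) * cabs (W g).
  have S1 : \sum_(j < m) (cabs (f (x j)%:R))%:C = \sum_g fourier f g * W g.
    under eq_bigr => j _ do rewrite -phaseM {1}(fourier_inv p_pr f) mulr_suml.
    rewrite exchange_big; apply: eq_bigr => g _; rewrite mulr_sumr; apply: eq_bigr => j _.
    by rewrite -mulrA (mulrC (chi _)).
  apply: (@le_trans _ _ (cabs (\sum_g fourier f g * W g))); last first.
    apply: le_trans (cabs_sum _ _ _) _; apply: ler_sum => g _; by rewrite cabsM.
  rewrite -S1 -rmorph_sum cabs_real; apply: le_trans (ler_norm _).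
  rewrite -[m in m%:R](card_ord m) -sumr_const mulr_suml; apply: ler_sum => j _.
  exact: big.
have f1 g : cabs (fourier f g) <= p%:R^-1 * (K * 2 ^+ l).
  apply: le_trans (cabs_fourier_le p_pr f g) _; rewrite ler_pM2l ?invr_gt0 ?ltr0n //.
  apply: (@le_trans _ _ (\sum_(y in supp f) K)).
    rewrite [leRHS]big_mkcond /=; apply: ler_sum => y _; rewrite inE.
    case: eqVneq => [->|_]; first by rewrite cabs0.
    by apply: le_trans wK; apply: cabs_le_wiener.
  rewrite sumr_const -[leLHS]mulr_natr ler_wpM2l // ?(le_trans ler01) //.
  by rewrite -natrX ler_nat.
have q0 : 0 < q by apply: mulr_gt0; [rewrite invr_gt0|exact: expR_gt0].
have E0 g : 0 <= E g by rewrite !addr_ge0 ?expR_ge0.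
have up : \sum_g cabs (fourier f g) * cabs (W g) <= K * (2 * T) + p%:R^-1 * (K * 2 ^+ l) * (q * (4 * (p%:R * expR l%:R))).
  apply: (@le_trans _ _ (\sum_g (cabs (fourier f g) * (2 * T) + p%:R^-1 * (K * 2 ^+ l) * (q * E g)))).
    apply: ler_sum => g _; apply: le_trans (ler_wpM2l (cabs_ge0 _) (WE g)) _.
    by rewrite mulrDr lerD2l ler_wpM2r // mulr_ge0 ?E0 ?ltW.
  rewrite big_split /= -mulr_suml -!mulr_sumr lerD //.
    by rewrite ler_wpM2r // /T !mulr_ge0 //; lra.
  rewrite ler_wpM2l ?ler_pM2l // !mulr_ge0 ?exprn_ge0 ?invr_ge0 //; lra.
have small : 2 ^+ l * (expR (- (lam * T)) * expR l%:R) <= 1 :> R.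
  have e2 : 2 ^+ l <= expR l%:R :> R.
    rewrite -[l%:R]mulr1 mulrC expRM_natr lerXn2r ?nnegrE ?expR_ge0 //.
    by apply: le_trans (expR_ge1Dx _).
  apply: le_trans (ler_wpM2r _ e2) _; first by rewrite mulr_ge0 ?expR_ge0.
  rewrite -!expRD lamT -[leRHS]expR0 ler_expR; have : 0 <= l%:R :> R by []. lra.
have p0 : (p%:R : R) != 0 by rewrite pnatr_eq0 -lt0n.
have e1 : p%:R^-1 * (K * 2 ^+ l) * (q * (4 * (p%:R * expR l%:R))) =
   128 * K ^+ 2 * (2 ^+ l * (expR (- (lam * T)) * expR l%:R)).
  rewrite /q /lam invrK; move: (expR _) (expR _) => u v; field; lra.
have e3 : K * (2 * T) = 256 * K ^+ 2 * l%:R by rewrite /T; ring.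
have := le_trans low up; rewrite mE e1 e3.
have K2 : 1 <= K ^+ 2 by rewrite expr_ge1 //; lra.
have := ler_wpM2l (le_trans ler01 K2) small.
have l1 : 1 <= l%:R :> R by rewrite ler1n.
have := ler_wpM2l (le_trans ler01 K2) l1; move: K2.
set u : R := 2 ^+ l * (expR (- (lam * T)) * expR l%:R).
set A := K ^+ 2; set t : R := l%:R.
rewrite mulr1 -!mulrA (mulrA 1024) -(mulrA 1024) => h1 h2 h3.
set v := A * u in h2 *; set w := A * t in h3 *; lra.
Qed.
End Lacunary.

(** * Thinning out the support by a random affine map *)

Section Sparsification.
Import mathcomp.boot.fintype mathcomp.boot.finset.
Variables (p : nat).
Hypothesis p_pr : prime p.
Local Notation F := 'F_p.
Implicit Types (A J : {set F}) (q : F * F).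

Let p_gt0 : (0 < p)%N. Proof. exact: prime_gt0. Qed.

Definition affine q (x : F) : F := q.1 * x + q.2.

(** The pairs [q] are the sample space: distinct points have pairwise independent images under
    a random affine map. *)
Definition hits A J q := (\sum_(x in A) (affine q x \in J))%N.

Lemma sum_mem J : (\sum_(x : F) (x \in J) = #|J|)%N.
Proof. by rewrite -sum1_card [RHS]big_mkcond; apply: eq_bigr => x _; case: (x \in J). Qed.

Lemma sum_affine_mem J (x : F) : (\sum_q (affine q x \in J) = p * #|J|)%N.
Proof.
rewrite -(pair_bigA _ (fun a b => ((a * x + b) \in J) : nat)) /=.
have h (a : F) : (\sum_(b : F) ((a * x + b)%R \in J) = #|J|)%N.
  by rewrite -(sum_mem J) [RHS](reindex_inj (addrI (a * x))).
by under eq_bigr => a _ do rewrite h; rewrite sum_nat_const card_Fp.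
Qed.

Lemma sum_affine_mem2 J (x y : F) : x != y ->
  (\sum_q (affine q x \in J) * (affine q y \in J) = #|J| * #|J|)%N.
Proof.
move=> xy; pose phi q := (affine q x, affine q y).
have inj : injective phi.
  move=> [a b] [a' b'] E.
  have h1 : a * x + b = a' * x + b' := congr1 fst E.
  have h2 : a * y + b = a' * y + b' := congr1 snd E.
  have : (a - a') * (x - y) = (a * x + b) - (a * y + b) - ((a' * x + b') - (a' * y + b')) by ring.
  rewrite h1 h2 subrr => /eqP; rewrite mulf_eq0 !subr_eq0 (negbTE xy) orbF => /eqP aa.
  by move: h1; rewrite aa => /addrI ->.
transitivity (\sum_(u : F * F) (u.1 \in J) * (u.2 \in J))%N.
  by rewrite [RHS](reindex_inj inj).
rewrite -(pair_bigA _ (fun a b => (a \in J) * (b \in J))%N) /=.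
by rewrite -[in RHS](sum_mem J) big_distrl; apply: eq_bigr => a _; rewrite big_distrr.
Qed.

Lemma sum_hits A J : (\sum_q hits A J q = p * (#|A| * #|J|))%N.
Proof.
rewrite exchange_big /=; under eq_bigr => x _ do rewrite sum_affine_mem.
by rewrite sum_nat_const mulnCA.
Qed.

Lemma card_crowded A J t : (#|[set q | (t < hits A J q)%N]| * t <= p * (#|A| * #|J|))%N.
Proof.
rewrite -sum_hits -sum_nat_const big_mkcond; apply: leq_sum => q _.
by rewrite inE; case: ltnP => // /ltnW.
Qed.

(** Chebyshev's inequality: the variance of [hits A J] is at most its mean. *)
Lemma card_missing A J :
  (#|[set q | hits A J q == 0%N]| * (#|A| * #|J|) <= p ^ 3)%N.
Proof.
have S1 := sum_hits A J; set m := (#|A| * #|J|)%N in S1 *.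
have [->|m0] := posnP m; first by rewrite muln0.
have S2 : (\sum_q hits A J q * hits A J q <= p * m + m * m)%N.
  under eq_bigr => q _ do rewrite big_distrlr.
  rewrite exchange_big /=; under eq_bigr => x _ do rewrite exchange_big /=.
  apply: (@leq_trans (\sum_(x in A) \sum_(y in A) ((x == y) * (p * #|J|) + #|J| * #|J|))).
    apply: leq_sum => x _; apply: leq_sum => y _; case: (eqVneq x y) => [->|xy].
      rewrite mul1n -(sum_affine_mem J y); apply: leq_trans (leq_addr _ _).
      by apply: leq_sum => q _; case: (_ \in J).
    by rewrite sum_affine_mem2.
  under eq_bigr => x xA.
    rewrite big_split /= (bigD1 x) //= eqxx big1 ?addn0; last first.
      by move=> y /andP[_ /negbTE h]; rewrite eq_sym h.
    rewrite mul1n sum_nat_const; over.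
  by rewrite sum_nat_const /m; apply/eq_leq; ring.
have S3 : \sum_q (p%:Z * (hits A J q)%:Z - m%:Z) ^+ 2 <= p%:Z ^+ 3 * m%:Z.
  have -> : \sum_q (p%:Z * (hits A J q)%:Z - m%:Z) ^+ 2 =
     p%:Z ^+ 2 * (\sum_q hits A J q * hits A J q)%:Z - 2 * p%:Z * m%:Z * (\sum_q hits A J q)%:Z + (p ^ 2)%:Z * m%:Z ^+ 2.
    rewrite !(big_morph Posz PoszD (erefl _)) !mulr_sumr -sumrB.
    have -> : (p ^ 2)%:Z * m%:Z ^+ 2 = \sum_(q : F * F) m%:Z ^+ 2.
      by rewrite sumr_const card_prod card_Fp // -mulnn -mulr_natl natz.
    rewrite -big_split /=; apply: eq_bigr => q _; rewrite PoszM; ring.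
  move: S2; rewrite S1; move: (\sum_q _)%N => t S2.
  have : p%:Z ^+ 2 * t%:Z <= p%:Z ^+ 2 * (p * m + m * m)%:Z by rewrite ler_wpM2l ?sqr_ge0 // lez_nat.
  rewrite !PoszD !PoszM; nia.
have S4 : (#|[set q | hits A J q == 0%N]|)%:Z * m%:Z ^+ 2 <= p%:Z ^+ 3 * m%:Z.
  apply: le_trans S3; rewrite -natz mulr_natl -sumr_const big_mkcond; apply: ler_sum => q _.
  by rewrite inE; case: eqP => [->|_]; rewrite ?sqr_ge0 // mulr0 sub0r sqrrN.
have : (#|[set q | hits A J q == 0%N]| * m * m <= p ^ 3 * m)%N.
  by rewrite -lez_nat !PoszM -mulrA -expr2 (le_trans S4).
by rewrite leq_pmul2r.
Qed.
End Sparsification.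

(** Multiplication by a triangle restricts a function to an interval without increasing its
    Wiener norm. *)
Section Triangle.
Variables (R : realType) (p : nat).
Hypothesis p_pr : prime p.
Local Notation C := (complex R).
Local Notation F := 'F_p.
Let p_gt0 : (0 < p)%N. Proof. exact: prime_gt0. Qed.

Definition triangle b (x : F) : C := (tri b (val x))%:R / b%:R.

(** The triangle is a self-convolution, so its coefficients are squares up to conjugation
    and Parseval's identity sums their moduli. *)
Lemma triangle_norm b : (0 < b)%N -> (2 * b <= p)%N -> wiener_norm (triangle b) <= 1.
Proof.
move=> b0 bp; set B : {poly C} := \poly_(i < b) 1.
have sB : (size B <= b)%N by apply: size_poly.
have sB2 : (size (B ^+ 2)%R <= p)%N.
  rewrite expr2; apply: leq_trans (size_polyMleq _ _) _.
  apply: leq_trans (leq_pred _) _; apply: leq_trans bp; rewrite mul2n -addnn.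
  exact: leq_add.
have E g : cabs (fourier (triangle b) g) = (p%:R * b%:R)^-1 * cabs (B.[zeta p ^+ val g]) ^+ 2.
  have FE : fourier (triangle b) g = p%:R^-1 * (conjc ((B ^+ 2).[zeta p ^+ val g]) / b%:R).
    rewrite fourierE //; congr (_ * _).
    symmetry.
    rewrite (horner_coef_wide _ sB2) rmorph_sum mulr_suml.
    rewrite -(sum_Fp p_pr (fun i => conjc ((B ^+ 2)`_i * (zeta p ^+ val g) ^+ i) / b%:R)).
    apply: eq_bigr => x _; rewrite coef_tri rmorphM /= rmorph_nat /triangle mulrAC; congr (_ * _ * _).
    by rewrite /chi val_FpM // zeta_mod // exprM.
  rewrite FE !cabsM cabsV cabs_conj cabsV !cabs_nat horner_exp cabsX invfM.
  by move: (_ ^+ 2) => u; ring.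
rewrite /wiener_norm; under eq_bigr => g _ do rewrite E.
rewrite -mulr_sumr (sum_Fp p_pr (fun i => cabs B.[zeta p ^+ i] ^+ 2)).
rewrite poly_parseval ?(leq_trans sB) ?(leq_trans _ bp) ?leq_pmull //.
have -> : \sum_(i < p) cabs B`_i ^+ 2 = b%:R.
  rewrite (eq_bigr (fun i : 'I_p => if (i < b)%N then 1 else 0 : R)); last first.
    by move=> i _; rewrite coef_poly; case: ifP; rewrite ?cabs1 ?cabs0 ?expr1n ?expr0n.
  have bp' : (b <= p)%N by apply: leq_trans bp; rewrite leq_pmull.
  by rewrite -big_mkcond -(big_ord_widen p (fun=> 1) bp') sumr_const card_ord.
by rewrite mulVf // mulf_neq0 // pnatr_eq0 -lt0n.
Qed.

Lemma triangle_eq0 b (x : F) : (2 * b <= val x)%N -> triangle b x = 0.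
Proof. by move=> h; rewrite /triangle (tri_eq0 p_pr) // mul0r. Qed.

Lemma triangle_ge b (x : F) : (0 < b)%N -> (b <= 2 * (val x).+1)%N -> (2 * (val x).+1 <= 3 * b)%N ->
  1 / 2 <= cabs (triangle b x).
Proof.
move=> b0 h1 h2; rewrite /triangle cabsM cabsV !cabs_nat ler_pdivlMr ?ltr0n //.
by rewrite mul1r mulrC ler_pdivrMr ?ltr0n // -natrM ler_nat mulnC (tri_ge p_pr).
Qed.
End Triangle.

Section SparseAnnulus.
Import mathcomp.boot.fintype mathcomp.boot.finset.
Variables (R : realType) (p : nat).
Hypothesis p_pr : prime p.
Local Notation C := (complex R).
Local Notation F := 'F_p.
Let p_gt0 : (0 < p)%N. Proof. exact: prime_gt0. Qed.

Lemma card_window a b : (a + b <= p)%N -> #|[set x : F | (a <= val x < a + b)%N]| = b.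
Proof.
move=> abp; have vE (k : 'I_b) : val ((a + k)%:R : F) = (a + k)%N.
  by rewrite (val_natr_Fp p_pr) // (leq_trans _ abp) // ltn_add2l.
have inj : injective (fun k : 'I_b => (a + k)%:R : F).
  by move=> k k' /(congr1 val); rewrite !vE => /addnI/val_inj.
rewrite -[RHS]card_ord -(card_imset _ inj); apply: eq_card => x; rewrite inE.
apply/idP/imsetP => [/andP[ax xb]|[k _ ->]]; last by rewrite vE leq_addr ltn_add2l ltn_ord.
have kb : (val x - a < b)%N by rewrite ltn_subLR.
by exists (Ordinal kb) => //=; rewrite subnKC // natr_val_Fp.
Qed.

Lemma card_hits (S J : {set F}) q : #|[set x in S | affine q x \in J]| = hits S J q.
Proof.
rewrite -sum1_card /hits big_mkcond [RHS]big_mkcond; apply: eq_bigr => x _.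
by rewrite inE; case: (x \in S); case: (_ \in J).
Qed.

(** Each of the three kinds of bad pairs (constant maps, maps sending too many points of [S]
    into [J'], maps missing [J] on some [A i]) makes up a small proportion of all pairs. *)
Lemma good_affine (S J J' : {set F}) (A : nat -> {set F}) I T : (2 < p)%N ->
  (4 * (#|S| * #|J'|) <= p * T)%N ->
  (forall i, (i < I)%N -> (4 * I * p <= #|A i| * #|J|)%N) ->
  exists q : F * F, [/\ q.1 != 0, (hits S J' q <= T)%N & forall i, (i < I)%N -> (0 < hits (A i) J q)%N].
Proof.
move=> p2 few many.
pose B0 := [set q : F * F | q.1 == 0]; pose B1 := [set q | (T < hits S J' q)%N].
pose B2 i := [set q | hits (A i) J q == 0%N].
have b0 : #|B0| = p.
  have -> : B0 = setX [set 0] setT by apply/setP => -[u v]; rewrite !inE andbT.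
  by rewrite cardsX cards1 cardsT card_Fp // mul1n.
have b1 : (4 * #|B1| <= p ^ 2)%N.
  have [T0|T0] := posnP T.
    move: few; rewrite T0 muln0 leqn0 muln_eq0 /= => /eqP h.
    suff -> : B1 = set0 by rewrite cards0.
    apply/setP => q; rewrite !inE; apply/negbTE; rewrite -leqNgt.
    have := sum_hits p_pr S J'; rewrite h muln0 => /eqP.
    by rewrite sum_nat_eq0 => /forallP/(_ q) /= /eqP ->.
  have := card_crowded p_pr S J' T; rewrite -/B1 => h.
  rewrite -(leq_pmul2r T0); move: h few; move: (#|B1|) (#|S| * #|J'|)%N => u v h few.
  have := leq_mul (leqnn p) few; lia.
have b2 i : (i < I)%N -> (4 * I * #|B2 i| <= p ^ 2)%N.
  move=> iI; have := card_missing p_pr (A i) J; rewrite -/(B2 i) => h.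
  have := leq_mul (leqnn #|B2 i|) (many i iI) => h2.
  rewrite -(leq_pmul2r p_gt0); apply: leq_trans (_ : _ <= #|B2 i| * (4 * I * p))%N _.
    by apply/eq_leq; ring.
  by apply: leq_trans (leq_trans h2 h) _; apply/eq_leq; ring.
have b2s : (4 * (\sum_(i < I) #|B2 i|) <= p ^ 2)%N.
  have [->|I0] := posnP I; first by rewrite big_ord0.
  rewrite -(leq_pmul2l I0) mulnCA mulnA big_distrr /= -[X in (_ <= X * _)%N](card_ord I) -sum_nat_const.
  by apply: leq_sum => i _; apply: b2.
case: (pickP [pred q : F * F | [&& q \notin B0, q \notin B1 & [forall i : 'I_I, q \notin B2 i]]]) => [q /and3P[h0 h1 /forallP h2]|no].
  exists q; split; first by move: h0; rewrite inE.
    by move: h1; rewrite inE -leqNgt.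
  by move=> i iI; have := h2 (Ordinal iI); rewrite inE lt0n.
have : (p ^ 2 <= #|B0| + #|B1| + \sum_(i < I) #|B2 i|)%N.
  have -> : (p ^ 2 = \sum_(q : F * F) 1)%N by rewrite sum1_card card_prod card_Fp // mulnn.
  have cE (B : {set F * F}) : (#|B| = \sum_q (q \in B))%N.
    by rewrite -sum1_card big_mkcond; apply: eq_bigr => q _; case: (q \in B).
  under [X in (_ <= _ + X)%N]eq_bigr => i _ do rewrite cE.
  rewrite !cE exchange_big -!big_split /=; apply: leq_sum => q _.
  have := no q; rewrite /=; case: (q \in B0) => //=; case: (q \in B1) => //=.
  move=> /negbT; rewrite negb_forall => hex; have [i qi0] := fintype.existsP hex; move: qi0.
  rewrite negbK => qi.
  by rewrite (bigD1 i) //= qi.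
rewrite b0; move: (\sum_(i < I) _)%N b2s => u hu; move: (#|B1|) b1 => v hv.
have : (3 * p <= p ^ 2)%N by rewrite -mulnn leq_mul2r p2 orbT.
lia.
Qed.

(** If all annuli were dense, a triangle composed with a suitable affine map would leave at
    most [2 ^ l] points of the support, but a point of every annulus where the triangle is at
    least a half.  As the annuli grow by a factor of three, these points are lacunary, and
    [riesz_chain] applies to the product. *)
Lemma sparse_annulus (f : F -> C) (e c l w : nat) :
  let I := (1024 * 4 ^ e * l)%N in
  (0 < l)%N -> (0 < w)%N -> wiener_norm f <= (2 ^ e)%:R ->
  (forall x, x \in supp f -> 1 <= cabs (f x)) ->
  (64 * I * 2 ^ c <= 2 ^ l)%N -> (16 * I * 2 ^ c <= #|supp f|)%N -> (3 ^ I * w <= p)%N ->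
  exists2 i, (i < I)%N & (2 ^ c * #|[set x in supp f | (3 ^ i * w <= val x < 2 * (3 ^ i * w))%N]| < #|supp f|)%N.
Proof.
move=> I l0 w0 wK f1 hl hs hw.
have I0 : (1024 <= I)%N by rewrite /I -mulnA leq_pmulr // muln_gt0 expn_gt0.
move: (erefl I); rewrite {2}/I; move: I I0 hl hs hw => I I0 hl hs hw IE.
set S := supp f in hs *; set s := #|S| in hs *.
pose A i := [set x in S | (3 ^ i * w <= val x < 2 * (3 ^ i * w))%N].
have c0 : (0 < 2 ^ c)%N by rewrite expn_gt0.
case: (boolP [exists i : 'I_I, (2 ^ c * #|A i| < s)%N]) => [hex|].
  by have [i hi] := fintype.existsP hex; exists i.
rewrite negb_exists => hall; have dense i : (i < I)%N -> (s <= 2 ^ c * #|A i|)%N.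
  by move=> iI; have := fintype.forallP hall (Ordinal iI); rewrite -leqNgt.
exfalso.
have sp : (s <= p)%N by rewrite /s -[leqRHS](card_Fp p_pr) max_card.
set W := (I * 2 ^ c)%N; have WI : (1024 <= W)%N by rewrite /W; apply: leq_trans I0 (leq_pmulr _ _).
have hs' : (16 * W <= s)%N by rewrite mulnA.
have s0 : (0 < s)%N by lia.
have p16 : (16 * 1024 <= p)%N by lia.
(* The least half-width for which good_affine finds a point of every annulus. *)
pose b := ((4 * W * p) %/ s).+1.
have b1 : (4 * W * p < s * b)%N by rewrite [ltnRHS]mulnC ltn_ceil.
have b2 : (s * b <= 4 * W * p + s)%N by rewrite mulnS addnC leq_add2r mulnC leq_trunc_div.
have b0 : (0 < b)%N by [].
have bp : (2 * b <= p)%N.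
  rewrite -(leq_pmul2l s0); move: b2 hs' sp p16 {b1 hs}; move: (b) => B.
  move=> h1 h2 h3 h4; have h5 : (16 * W * p <= s * p)%N by rewrite leq_mul2r h2 orbT.
  have h6 : (16 * 1024 * s <= s * p)%N by rewrite mulnC leq_mul2l h4 orbT.
  rewrite mulnCA; lia.
pose J := [set x : F | ((uphalf b).-1 <= val x < (uphalf b).-1 + b)%N].
pose J' := [set x : F | (0 <= val x < 0 + 2 * b)%N].
have cJ : #|J| = b by apply: card_window; apply: leq_trans bp; rewrite uphalf_half; lia.
have cJ' : #|J'| = (2 * b)%N by apply: card_window.
have p2 : (2 < p)%N by apply: leq_trans p16.
have few0 : (4 * (#|S| * #|J'|) <= p * 2 ^ l)%N.
  rewrite cJ' -/s; apply: (@leq_trans (p * (64 * W))); last by rewrite leq_mul2l mulnA hl orbT.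
  move: b2 sp WI; move: (b) => B h1 h2 h3.
  have h4 : (s <= p * W)%N by apply: leq_trans h2 _; rewrite leq_pmulr //; lia.
  lia.
have many0 i : (i < I)%N -> (4 * I * p <= #|A i| * #|J|)%N.
  move=> iI; rewrite cJ -(leq_pmul2l c0); have h := leq_mul (dense i iI) (leqnn b).
  rewrite [leqRHS]mulnA; apply: leq_trans h; apply: leq_trans (ltnW b1).
  by apply/eq_leq; rewrite /W; ring.
have [q [q0 few many]] := good_affine p2 few0 many0.
pose g x := f x * triangle R b (affine q x).
have gK : wiener_norm g <= (2 ^ e)%:R.
  apply: le_trans (wiener_mul p_pr _ _) _; rewrite (wiener_affine p_pr _ _ q0).
  by apply: le_trans _ wK; rewrite ler_piMr ?wiener_ge0 // triangle_norm.
have gS : (#|supp g| <= 2 ^ l)%N.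
  apply: leq_trans few; rewrite -card_hits; apply: subset_leq_card; apply/subsetP => x.
  rewrite !inE /g mulf_eq0 negb_or => /andP[-> h] /=; rewrite ltnNge.
  by apply: contra h => h; apply/eqP/(triangle_eq0 _ p_pr).
pose y i : F := odflt 0 [pick x in A i | affine q x \in J].
have yP i : (i < I)%N -> (y i \in A i) && (affine q (y i) \in J).
  move=> /many; rewrite -card_hits => /card_gt0P[x]; rewrite inE => /andP[xA xJ].
  by rewrite /y; case: pickP => [//|/(_ x)]; rewrite /= xA xJ.
pose x i := val (y i).
have xE i : (x i)%:R = y i by apply: natr_val_Fp.
have xr i : (i < I)%N -> (3 ^ i * w <= x i < 2 * (3 ^ i * w))%N.
  by move=> /yP/andP[+ _]; rewrite inE => /andP[_ ->].
have xs i : (i <= I)%N -> (\sum_(j < i) x j + w <= 3 ^ i * w)%N.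
  elim: i => [_|i IH iI]; first by rewrite big_ord0 expn0 mul1n.
  rewrite big_ord_recr /= expnS -mulnA; have := IH (ltnW iI); have /andP[_] := xr i iI.
  move: (\sum_(j < i) x j)%N (3 ^ i * w)%N => u v h1 h2; lia.
apply: (@riesz_chain R p p_pr g e l x) => //; rewrite -/I -IE.
- move=> i iI; have := xs i (ltnW iI); have /andP[+ _] := xr i iI.
  by move=> h1 h2; apply: leq_trans h1; apply: leq_trans h2; rewrite -addn1 leq_add2l.
- by apply: leq_trans hw; apply: leq_trans (xs I (leqnn I)); rewrite -addn1 leq_add2l.
move=> i iI; rewrite xE /g cabsM; have /andP[yA yJ] := yP i iI.
rewrite -[1 / 2]mul1r; apply: ler_pM => //.
  by apply: f1; move: yA; rewrite inE => /andP[].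
move: yJ; rewrite inE => /andP[]; rewrite uphalf_half => h1 h2.
by apply: triangle_ge => //; lia.
Qed.
End SparseAnnulus.

(** * The lower bound in terms of powers of two *)

Section Assembly.
Import mathcomp.boot.fintype mathcomp.boot.finset.
Variables (R : realType) (p : nat).
Hypothesis p_pr : prime p.
Local Notation C := (complex R).
Local Notation F := 'F_p.
Let p_gt0 : (0 < p)%N. Proof. exact: prime_gt0. Qed.

(** Translation by [2 a] moves the interval [(- a, a)] to the middle half of [0 .. 4 a - 1] and
    the annulus to its last quarter, so [littlewood_contrast] applies. *)
Lemma window_contrast (f : F -> C) a L :
  (0 < a)%N -> (4 * a <= p)%N -> (forall x, x \in supp f -> 1 <= cabs (f x)) ->
  (2 ^ L * (#|[set x in supp f | (a <= val x < 2 * a)%N]|).+1 <= #|[set x in supp f | near0 a x]|)%N ->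
  L%:R <= 320 * wiener_norm f.
Proof.
move=> a0 ap f1 hL; set A := [set x in supp f | _] in hL; set N := [set x in supp f | _] in hL.
pose t : F := (2 * a)%:R.
have tv : val t = (2 * a)%N by apply: (val_natr_Fp p_pr); lia.
pose g x := f (1 * x + - t).
have gE x : g x = f (x - t) by rewrite /g mul1r.
have <- : wiener_norm g = wiener_norm f by apply: wiener_affine => //; apply: oner_neq0.
have g1 x : x \in supp g -> 1 <= cabs (g x).
  by rewrite inE gE => h; apply: f1; rewrite inE.
apply: (@littlewood_contrast R p p_pr g (2 * a) L) => //; first by lia.
  by rewrite mulnA.
set O := [set x in supp g | _]; set M := [set x in supp g | _].
have OA : (#|O| <= #|A|)%N.
  rewrite -(card_imset O (addIr (- t))); apply/subset_leq_card/subsetP => z /imsetP[x + ->].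
  rewrite !inE gE => /andP[-> h]; rewrite andTb.
  have e : val (x - t + t) = ((val (x - t)%R + 2 * a) %% p)%N by rewrite val_FpD // tv.
  rewrite subrK in e; move: e h (val_Fp_lt p_pr x) (val_Fp_lt p_pr (x - t)).
  move: (val x) (val (x - t)) => u v; have [h|h] := ltnP (v + 2 * a) p.
    by rewrite modn_small // => -> h1 _ _; lia.
  move=> e h1 up vp; exfalso; move: e.
  have -> : (v + 2 * a = v + 2 * a - p + p)%N by lia.
  by rewrite modnDr modn_small; lia.
have NM : (#|N| <= #|M|)%N.
  rewrite -(card_imset N (addIr t)); apply/subset_leq_card/subsetP => z /imsetP[x + ->].
  rewrite !inE gE addrK => /andP[-> h]; rewrite andTb val_FpD // tv.
  move: h (val_Fp_lt p_pr x); rewrite /near0; move: (val x) => u /orP[h|h] up.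
    by rewrite modn_small; lia.
  have -> : (u + 2 * a = u + 2 * a - p + p)%N by lia.
  by rewrite modnDr modn_small; lia.
apply: leq_trans (leq_addl #|O| #|M|); apply: leq_trans NM; apply: leq_trans hL.
by rewrite leq_mul2l ltnS OA orbT.
Qed.

Let lin_le_exp k : (5 <= k)%N -> (4 * k + 3 <= 2 ^ k)%N.
Proof.
elim: k => // k IH; rewrite leq_eqVlt => /predU1P[<- //|h].
by rewrite expnS; have := IH h; move: (2 ^ k)%N => t; lia.
Qed.

Let exp34 k : (3 <= k)%N -> (2 * 3 ^ k <= 4 ^ k)%N.
Proof.
elim: k => // k IH; rewrite leq_eqVlt => /predU1P[<- //|h].
by rewrite !expnS; have := IH h; move: (3 ^ k)%N (4 ^ k)%N => t u; lia.
Qed.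

Let norm_gap (t u : R) : u <= t -> 0 < t -> 321%:R * t <= 320 * u -> False.
Proof. lra. Qed.

(** The heart of the argument.  By [structured_part] the support contains a translate of a
    large structured set; after the affine change of variable that [concentration] provides,
    a substantial part of the support lies in [(- w, w)].  By [sparse_annulus] one of the
    annuli around this interval is nearly empty.  The jump of the density at this annulus
    contradicts [window_contrast].

    The exponent [c] measures the density of a sparse annulus: [322 * 2 ^ e] is what
    [window_contrast] asks for, the rest is the density of the structured set.  The exponents
    [l] and [h] bound the sparse support of [riesz_chain] and the ratio [p / w], for which
    there must be room for all annuli. *)
Lemma small_or_far (f : F -> C) e v n :
  (0 < e)%N -> (forall x, x \in supp f -> 1 <= cabs (f x)) ->
  (16 * (112 * e * (2 * n).+2) <= 2 ^ n)%N ->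
  v = (40000 * (112 * e) ^ 2 * n.+1 ^ 2)%N ->
  let c := (322 * 2 ^ e + (2 * e + 4 + v * 2 ^ n))%N in
  let l := (2 * (16 + 2 * e + c))%N in
  let h := (2 * (1024 * 4 ^ e * l).+1)%N in
  (2 ^ l <= #|supp f|)%N ->
  (2 ^ (56 * e) * #|supp f| * 2 ^ ((4 * h + 3) * (2 ^ n.+1 * v.+1) + (2 * h).+1) <= p)%N ->
  (2 ^ e)%:R < wiener_norm f.
Proof.
move=> e0 f1 hn hv c l h hs hp; rewrite ltNge; apply/negP => wK.
have S0 : supp f != set0 by rewrite -card_gt0 (leq_trans _ hs) // expn_gt0.
have [Y [a [Y0 YS hY hYY growth]]] := structured_part p_pr e0 wK S0 f1 hn hv.
set q := (v * 2 ^ n)%N in c l h hs hp hY.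
set I := (1024 * 4 ^ e * l)%N in h hp.
set r := (2 ^ n.+1 * v.+1)%N in hp growth.
have e1 : (0 < 2 ^ e)%N by rewrite expn_gt0.
have s0 : (0 < #|supp f|)%N by rewrite card_gt0.
have l32 : (32 <= l)%N by rewrite /l; lia.
have lI : (2 * l <= I)%N.
  rewrite /I leq_mul2r; apply/orP; right; apply: (@leq_trans (1024 * 1)) => //.
  by rewrite leq_mul2l expn_gt0.
have h5 : (5 <= h)%N by rewrite /h; lia.
have cl : (c <= l)%N by rewrite /l; lia.
have v0 : (0 < v)%N by rewrite hv !muln_gt0 e0.
clear hv hn.
have hr : (r * (4 * h + 3) <= 2 ^ (2 * h))%N.
  rewrite [(2 * h)%N]mul2n -addnn expnD; apply: leq_mul (lin_le_exp h5).
  apply: leq_trans (ltnW (ltn_expl h (leqnn 2))).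
  have : (r <= 4 * q)%N.
    rewrite /r /q expnS; have : (2 ^ n * v.+1 <= 2 ^ n * (2 * v))%N by rewrite leq_mul2l; lia.
    by move: (2 ^ n)%N => t; lia.
  have : (q <= c)%N by rewrite /c; lia.
  by rewrite /h -/I; move: cl lI; clear; lia.
have hp' : (#|diffset Y Y| * 2 ^ ((4 * h + 3) * r + (2 * h).+1) <= p)%N.
  by apply: leq_trans hp; rewrite leq_mul2r hYY orbT.
pose w := (p %/ 2 ^ h).+1.
have hw : (p <= 2 ^ h * w)%N by rewrite mulnC ltnW // ltn_ceil // expn_gt0.
have hw2 : (3 ^ I.+1 * w <= p)%N.
  have h2p : (2 ^ h <= p)%N.
    apply: leq_trans hp; rewrite -[leqLHS]mul1n leq_mul ?muln_gt0 ?expn_gt0 ?s0 //.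
    by rewrite leq_exp2l //; move: (_ * _)%N => t; lia.
  have E34 : (2 * 3 ^ I.+1 <= 2 ^ h)%N.
    by rewrite /h (expnM 2 2) exp34 //; move: lI l32; lia.
  have : (2 ^ h * w <= 2 * p)%N.
    by rewrite /w mulnS mulnC addnC mul2n -addnn leq_add // leq_trunc_div.
  have := leq_mul E34 (leqnn w); rewrite -mulnA; move: (3 ^ _ * w)%N (2 ^ h * w)%N => x y; lia.
have [g g0 [y0 y0Y hN]] := concentration R p_pr Y0 (ltnW (ltnW (ltnW (ltnW h5)))) growth hr hp' hw.
set Ny := [set y in Y | _] in hN.
pose f0 x := f (g^-1 * x + (a + y0)).
have f0K : wiener_norm f0 = wiener_norm f by apply: wiener_affine; rewrite // invr_eq0.
have f01 x : x \in supp f0 -> 1 <= cabs (f0 x).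
  by rewrite inE => hx; apply: f1; rewrite inE.
have f0s : #|supp f0| = #|supp f|.
  have inj : injective (fun x => g^-1 * x + (a + y0)).
    by move=> x y /addIr; apply: mulfI; rewrite invr_eq0.
  rewrite -(card_preimset (supp f) inj); apply: eq_card => x; by rewrite !inE.
pose N b := [set x in supp f0 | near0 b x].
have NyN : (#|Ny| <= #|N w|)%N.
  have inj : injective (fun y => g * (y - y0)) by move=> x y /(mulfI g0)/addIr.
  rewrite -(card_imset Ny inj); apply/subset_leq_card/subsetP => z /imsetP[y + ->].
  rewrite inE => /andP[yY nr]; rewrite inE nr andbT inE /f0.
  have -> : g^-1 * (g * (y - y0)) + (a + y0) = a + y by rewrite mulKf //; ring.
  by move/subsetP/(_ (a + y)): YS; rewrite inE; apply; rewrite mem_sumset ?inE.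
have hl2 : (2 ^ (16 + 2 * e + c) * l <= 2 ^ l)%N.
  set B := (16 + 2 * e + c)%N; have B5 : (5 <= B)%N by rewrite /B -!addnA leq_addr.
  have lE : (2 ^ l = 2 ^ B * 2 ^ B)%N by rewrite -expnD addnn -mul2n.
  rewrite lE leq_mul2l; apply/orP; right; have := lin_le_exp B5.
  by rewrite /l -/B; move: (2 ^ B)%N (B) => t u; clear; lia.
have II : (64 * I * 2 ^ c = 2 ^ (16 + 2 * e + c) * l)%N.
  have E16 : (64 * 1024 = 2 ^ 16)%N by rewrite (expnD 2 6 10).
  rewrite /I -addnA (expnD 2 16) expnD (expnM 2 2 e) -E16.
  by move: (2 ^ 2 ^ e)%N (2 ^ c)%N => t u; ring.
have [||||||i iI hi] := @sparse_annulus R p p_pr f0 e c l w _ _ _ f01; rewrite ?f0K ?f0s -/I //.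
- by rewrite II.
- by apply: leq_trans hs; apply: leq_trans hl2; rewrite -II -!mulnA leq_mul2r; apply/orP; right.
- by apply: leq_trans hw2; rewrite leq_mul2r leq_exp2l // leqnSn orbT.
set A := [set x in _ | _] in hi.
set b := (3 ^ i * w)%N in A hi.
have b0 : (0 < b)%N by rewrite muln_gt0 expn_gt0.
have bp : (4 * b <= p)%N.
  apply: leq_trans hw2; rewrite /b mulnA leq_mul2r /=.
  have : (3 ^ i.+2 <= 3 ^ I.+1)%N by rewrite leq_exp2l.
  by rewrite !(expnS 3 _.+1) (expnS 3 i); move: (3 ^ i)%N (3 * 3 ^ I)%N => t u; clear; lia.
have wb : (w <= b)%N by rewrite leq_pmull // expn_gt0.
have NN : (#|N w| <= #|N b|)%N.
  apply/subset_leq_card/subsetP => x; rewrite !inE => /andP[-> h1].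
  by rewrite andTb; move: h1 wb; rewrite /near0; clear; lia.
have hsN : (#|supp f| <= 2 ^ (2 * e + 4 + q) * #|N b|)%N.
  apply: leq_trans hY _; have -> : (2 * e + 4 + q = (2 * e + 3 + q) + 1)%N by clear; lia.
  rewrite (expnD 2 (2 * e + 3 + q) 1) -mulnA leq_mul2l; apply/orP; right; apply: leq_trans hN _.
  by rewrite leq_mul2l (leq_trans NyN NN).
have hL : (2 ^ (321 * 2 ^ e) * #|A|.+1 <= #|N b|)%N.
  have D0 : (0 < 2 ^ (2 * e + 4 + q))%N by rewrite expn_gt0.
  rewrite -(leq_pmul2l D0); apply: leq_trans hsN; rewrite mulnA -expnD.
  set D := (2 * e + 4 + q + _)%N; have Dc : (2 ^ D * 2 <= 2 ^ c)%N.
    by rewrite -expnSr leq_exp2l // /D /c; move: e1; clear; lia.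
  have cs : (2 ^ c <= #|supp f|)%N by apply: leq_trans hs; rewrite leq_exp2l.
  have h1 := leq_mul Dc (leqnn #|A|); move: h1 hi Dc cs; rewrite f0s (mulnAC _ 2%N) (mulnS _ #|A|).
  move: (2 ^ D * #|A|)%N (2 ^ D)%N (2 ^ c * #|A|)%N (2 ^ c)%N.
  by clear; lia.
have := window_contrast b0 bp f01 hL; rewrite f0K natrM.
by move: wK e1; rewrite -(ltr0n R); apply: norm_gap.
Qed.
End Assembly.

(** * The size of the parameters *)

Section Sizes.
Local Open Scope nat_scope.

Let le_2exp k : k.+1 <= 2 ^ k. Proof. exact: ltn_expl. Qed.

Let pow_up_log k : 0 < k -> 2 ^ up_log 2 k <= 2 * k.
Proof.
case: k => // -[|k] _; first by rewrite up_log1.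
have := @up_log_gtn 2 k.+2 isT isT; have := @up_log_gt0 2 k.+2.
by case: (up_log _ _) => // m _ /ltnW h; rewrite expnS leq_mul2l.
Qed.

Lemma sextic_le_exp e : e ^ 6 <= 6 ^ 6 * 2 ^ e.
Proof.
have h : e <= 6 * 2 ^ (e %/ 6).
  by apply: leq_trans (ltnW (ltn_ceil e (isT : 0 < 6))) _; rewrite mulnC leq_mul2l le_2exp.
apply: leq_trans (leq_exp2r_weak 6 h) _; rewrite expnMn -expnM leq_mul2l leq_exp2l //.
by rewrite leq_trunc_div orbT.
Qed.

Let succ_mul_le N x y z : 0 < z -> y <= x * z -> (N * y).+1 <= (N * x).+1 * z.
Proof. by move=> z0 h; rewrite mulSn -addn1 addnC leq_add // -mulnA leq_mul2l h orbT. Qed.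

Section Bounds.
Variables (e V n : nat).
Hypotheses (e0 : 0 < e) (VE : V = up_log 2 e) (nE : n = V + up_log 2 V.+1 + 17).

Let n_le : n.+1 <= 19 * V.+1.
Proof. by rewrite nE; have := up_log_min (isT : 1 < 2) (le_2exp V); lia. Qed.

Let V_le : V.+1 <= 2 * e.
Proof. by apply: leq_trans (le_2exp V) _; rewrite VE pow_up_log. Qed.

(** The length [n] of the iteration is the least that [structured_part] needs, up to a
    constant: [2 ^ n] is of order [e * up_log 2 e]. *)
Lemma iteration_count : 16 * (112 * e * (2 * n).+2) <= 2 ^ n.
Proof.
have h : e * V.+1 <= 2 ^ V * 2 ^ up_log 2 V.+1 by rewrite leq_mul // ?VE up_logP.
rewrite [in leqRHS]nE expnD expnD (expnD 2 11 6).
apply: leq_trans (leq_mul h (leqnn _)).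
have h1 : 16 * 112 <= 2 ^ 11 by [].
have h2 : 38 <= 2 ^ 6 by [].
apply: leq_trans (leq_mul (leqnn (e * V.+1)) (leq_mul h1 h2)).
have : (2 * n).+2 <= 38 * V.+1 by lia.
move: (2 * n).+2 => N hN; apply: (@leq_trans (16 * (112 * e * (38 * V.+1)))).
  by rewrite !leq_mul2l hN !orbT.
by apply/eq_leq; ring.
Qed.

Let pow_n_le : 2 ^ n <= 2 ^ 19 * (e * V.+1).
Proof.
rewrite nE expnD expnD (expnD 2 2 17) mulnC -mulnA (mulnCA (2 ^ 2)) leq_mul2l; apply/orP; right.
have h := leq_mul (pow_up_log e0) (pow_up_log (ltn0Sn V)); rewrite -VE in h.
by apply: leq_trans h _; apply/eq_leq; ring.
Qed.

Let cube_le : (e * V.+1) ^ 3 <= (8 * 6 ^ 6) * 2 ^ e.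
Proof.
rewrite -mulnA; apply: leq_trans (leq_mul (leqnn 8) (sextic_le_exp e)).
have h : e * V.+1 <= 2 * (e * e) by rewrite mulnCA leq_mul2l V_le orbT.
apply: leq_trans (leq_exp2r_weak 3 h) _; apply/eq_leq; ring.
Qed.

(** With [u = e * (V + 1)], the cost [q] of the structured set is of order [u ^ 3], hence [c]
    and [l] are of order [2 ^ e] and [h] of order [8 ^ e]; the exponent of [p / |supp f|] is of
    the order of [h] times the rank, which is [q] again. *)
Lemma parameter_bounds a v q c l h :
  v = a * e ^ 2 * n.+1 ^ 2 -> 0 < a -> q = v * 2 ^ n ->
  c = 322 * 2 ^ e + (2 * e + 4 + q) -> l = 2 * (16 + 2 * e + c) -> h = 2 * (1024 * 4 ^ e * l).+1 ->
  let A := a * 19 ^ 2 * 2 ^ 19 in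
  let C1 := 2 * (346 + A * (8 * 6 ^ 6)) in
  let C2 := 2 * (1024 * C1).+1 in
  l <= C1 * 2 ^ e /\
  56 * e + ((4 * h + 3) * (2 ^ n.+1 * v.+1) + (2 * h).+1) <= (57 + (4 * C2 + 3) * (4 * A) + 2 * C2) * (8 ^ e * (e * V.+1) ^ 3).
Proof.
move=> vE a0 qE cE lE hE A.
have un := pow_n_le; have uc := cube_le; set u := e * V.+1 in un uc *.
have u0 : 0 < u by rewrite muln_gt0 e0.
have e1 := le_2exp e; set t := 2 ^ e in e1 uc cE *.
have t8 : 8 ^ e = t * (t * t) by rewrite -!expnMn.
have t4 : 4 ^ e = t * t by rewrite -expnMn.
have vu : v <= a * 19 ^ 2 * u ^ 2.
  rewrite vE -(mulnA a (e ^ 2)) -(mulnA a (19 ^ 2)) -(expnMn e) -(expnMn 19).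
  rewrite leq_mul2l leq_exp2r_weak ?orbT //.
  by rewrite /u mulnCA leq_mul2l n_le orbT.
have qu : q <= A * u ^ 3.
  rewrite qE; apply: leq_trans (leq_mul vu un) _; rewrite /A; move: (2 ^ 19) (19 ^ 2) => x y.
  by apply/eq_leq; ring.
have v0 : 0 < v by rewrite vE !muln_gt0 a0 e0.
have rq : 2 ^ n.+1 * v.+1 <= 4 * (A * u ^ 3).
  apply: leq_trans (_ : 4 * q <= _); last by rewrite leq_mul2l qu.
  have : 2 ^ n * v.+1 <= 2 ^ n * (2 * v) by rewrite leq_mul2l; apply/orP; right; move: v0; clear; lia.
  by rewrite qE expnS; move: (2 ^ n) => x; clear; lia.
clearbody A; clear vE vu un v0.
move: (8 * 6 ^ 6) uc => k uc C1 C2.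
have l1 : l <= 2 * (346 + A * k) * t.
  have h1 := leq_trans qu (leq_mul (leqnn A) uc); rewrite mulnA in h1.
  rewrite lE cE -[leqRHS]mulnA leq_mul2l /= mulnDl; move: h1 e1; move: (A * k * t) => x; clear; lia.
split => //.
rewrite -/C1 in l1.
have t0 : 0 < t by move: e1; clear; lia.
have h1 : h <= C2 * 8 ^ e.
  rewrite hE -/C2 t8 t4 /C2 -[leqRHS]mulnA leq_mul2l /=.
  have h2 : t * t * l <= C1 * (t * (t * t)).
    by apply: leq_trans (leq_mul (leqnn (t * t)) l1) _; apply/eq_leq; ring.
  have : 0 < t * (t * t) by rewrite !muln_gt0 t0.
  by rewrite -(mulnA 1024 (t * t) l) => z0; apply: succ_mul_le.
clearbody C2.
have E0 : t <= 8 ^ e by rewrite t8 leq_pmulr // muln_gt0 t0.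
have u3 : 0 < u ^ 3 by rewrite expn_gt0 u0.
move: h1 E0 rq u3; move: (u ^ 3) (8 ^ e) (2 ^ n.+1 * v.+1) => x y r h1 E0 rq x0.
have b1 : e <= y * x by apply: leq_trans (leq_pmulr y x0); apply: leq_trans E0; apply: ltnW.
have b2 : h <= C2 * (y * x) by apply: leq_trans h1 _; rewrite mulnA leq_pmulr.
have b3 : 1 <= y * x by rewrite muln_gt0 x0 andbT (leq_trans t0).
have b4 : (4 * h + 3) * r <= (4 * C2 + 3) * (4 * A) * (y * x).
  have h3 : 4 * h + 3 <= (4 * C2 + 3) * y.
    have : 0 < y by apply: leq_trans E0.
    by rewrite mulnDl -mulnA; move: h1; move: (C2 * y) => z; clear; lia.
  by apply: leq_trans (leq_mul h3 rq) _; apply/eq_leq; ring.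
rewrite (mulnDl (57 + _)) (mulnDl 57) -(mulnA 2 C2); move: b1 b2 b3 b4.
set z1 := _ * r; set z2 := C2 * (y * x); set z3 := _ * (4 * A) * (y * x); set z4 := y * x.
by clearbody z1 z2 z3 z4; clear; lia.
Qed.
End Bounds.
End Sizes.

Local Open Scope classical_set_scope.

(** * Logarithms *)

Section Final.
Variable R : realType.

Lemma wiener_lower_bound : exists2 C0 : nat, (0 < C0)%N & forall p (f : 'F_p -> complex R) e,
  prime p -> (0 < e)%N -> (forall x : 'F_p, x \in supp f -> 1 <= cabs (f x)) ->
  (2 ^ (C0 * 2 ^ e) <= #|supp f|)%N ->
  (#|supp f| * 2 ^ (C0 * (8 ^ e * (e * (up_log 2 e).+1) ^ 3)) <= p)%N ->
  (2 ^ e)%:R < wiener_norm f.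
Proof.
have [a aE] : exists a, a = (40000 * 112 ^ 2)%N by exists (40000 * 112 ^ 2)%N.
have [A AE] : exists A, A = (a * 19 ^ 2 * 2 ^ 19)%N by exists (a * 19 ^ 2 * 2 ^ 19)%N.
have [C1 C1E] : exists C1, C1 = (2 * (346 + A * (8 * 6 ^ 6)))%N.
  by exists (2 * (346 + A * (8 * 6 ^ 6)))%N.
have [C2 C2E] : exists C2, C2 = (2 * (1024 * C1).+1)%N by exists (2 * (1024 * C1).+1)%N.
exists (C1 + (57 + (4 * C2 + 3) * (4 * A) + 2 * C2))%N; first by rewrite -addnA addnCA.
move=> p f e p_pr e0 f1 hs hp.
pose n := (up_log 2 e + up_log 2 (up_log 2 e).+1 + 17)%N.
pose v := (a * e ^ 2 * n.+1 ^ 2)%N.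
have vE : v = (40000 * (112 * e) ^ 2 * n.+1 ^ 2)%N by rewrite /v aE expnMn !mulnA.
have a0 : (0 < a)%N by rewrite aE muln_gt0.
have hn : (16 * (112 * e * (2 * n).+2) <= 2 ^ n)%N by apply: (@iteration_count e _ n e0 erefl).
have [] := @parameter_bounds e _ n e0 erefl erefl a v _ _ _ _ erefl a0 erefl erefl erefl erefl.
rewrite -AE -C1E -C2E => b1 b2.
apply: (small_or_far p_pr e0 f1 hn vE).
  apply: leq_trans hs; rewrite leq_exp2l //; apply: leq_trans b1 _.
  by rewrite leq_mul2r leq_addr orbT.
apply: leq_trans hp; rewrite -mulnA mulnCA leq_mul2l -expnD leq_exp2l //; apply/orP; right.
by apply: leq_trans b2 _; rewrite leq_mul2r leq_addl orbT.
Qed.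

Let expR_half2 : expR (1 / 2) <= 2 :> R.
Proof.
have := expR_ge1Dx (- (1 / 2) : R); have := expRxMexpNx_1 (1 / 2 : R).
have := expR_gt0 (1 / 2 : R); move: (expR _) (expR _) => u v u0 uv v2.
have := ler_wpM2l (ltW u0) v2; rewrite uv; lra.
Qed.

Lemma exponent_le_ln k (z : R) : 2 ^+ k <= z -> k%:R <= 2 * ln z.
Proof.
move=> kz; have z0 : 0 < z by apply: lt_le_trans kz; rewrite exprn_gt0.
have h : expR (1 / 2 * k%:R) <= z.
  by apply: le_trans kz; rewrite expRM_natr lerXn2r ?nnegrE ?expR_ge0.
by move: h; rewrite -[z in X in X -> _](@lnK R) ?posrE // ler_expR; lra.
Qed.

Lemma pow2_le_expR k : 2 ^+ k <= expR k%:R :> R.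
Proof.
rewrite -[k%:R]mul1r expRM_natr lerXn2r ?nnegrE ?expR_ge0 //.
by apply: le_trans (expR_ge1Dx _).
Qed.

(** The tangent bound [ln (y / x) <= y / x - 1] suffices, as [1 <= ln x]. *)
Lemma div_ln_mono (x y : R) : expR 1 <= x -> x <= y -> x / ln x <= y / ln y.
Proof.
move=> x1 xy; have x0 : 0 < x by apply: lt_le_trans x1; apply: expR_gt0.
have y0 : 0 < y by apply: lt_le_trans xy.
have l1 : 1 <= ln x by rewrite -[1](expRK) ler_ln ?posrE ?expR_gt0.
have l2 : ln x <= ln y by rewrite ler_ln ?posrE.
have ly0 : 0 < ln y by lra.
rewrite ler_pdivrMr; last by lra.
rewrite mulrAC ler_pdivlMr // .
have h : ln y <= ln x + (y / x - 1).
  have -> : y = x * (1 + (y / x - 1)) by field; lra.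
  rewrite lnM ?posrE //; last by rewrite addrC subrK divr_gt0.
  rewrite lerD2l; have -> : x * (1 + (y / x - 1)) / x - 1 = y / x - 1 by field; lra.
  by apply: le_ln1Dx; rewrite ltrBrDr addNr divr_gt0.
apply: (@le_trans _ _ (x * (ln x + (y / x - 1)))); first by rewrite ler_pM2l.
have -> : x * (ln x + (y / x - 1)) = x * ln x + (y - x) by field; lra.
have : (y - x) * 1 <= (y - x) * ln x by rewrite ler_wpM2l // subr_ge0.
lra.
Qed.

Lemma cube_root (x : R) : 0 <= x -> (x `^ (1 / 3)) ^+ 3 = x.
Proof.
by move=> x0; rewrite -powR_mulrn ?powR_ge0 // -powRrM div1r mulVf ?pnatr_eq0 // powRr1.
Qed.

Lemma iterated_ln_ge1 (t : R) : expR (expR (expR 1)) <= t ->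
  [/\ 0 < t, expR (expR 1) <= ln t, expR 1 <= ln (ln t) & 1 <= ln (ln (ln t))].
Proof.
move=> h; have t0 : 0 < t by apply: lt_le_trans h; apply: expR_gt0.
have h1 : expR (expR 1) <= ln t by rewrite -[expR (expR 1)]expRK ler_ln ?posrE ?expR_gt0.
have l0 : 0 < ln t by apply: lt_le_trans h1; apply: expR_gt0.
have h2 : expR 1 <= ln (ln t) by rewrite -[expR 1]expRK ler_ln ?posrE ?expR_gt0.
have l1 : 0 < ln (ln t) by apply: lt_le_trans h2; apply: expR_gt0.
by split => //; rewrite -[1]expRK ler_ln ?posrE ?expR_gt0.
Qed.

Let half_lt (a y w : R) : y <= 2 * a -> a < w -> y / 2 <= w.
Proof. lra. Qed.

Let exponent_small (a x l : R) : a <= 2 * x -> x <= 1 / 3 * l -> 0 <= l -> a <= l.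
Proof. lra. Qed.

Let level_small (a b l : R) : a <= b + 2 -> b <= 2 * l -> 1 <= l -> a <= 4 * l.
Proof. lra. Qed.

(** With [L1], [L2], [L3] the iterated logarithms of [t], choose [e] such that [2 ^ e] is about
    [y = d * L1 ^ (1 / 3) / (L2 * L3)].  Then [e <= L2] and [up_log 2 e + 1 <= 4 * L3], so the
    exponent in [wiener_lower_bound] is at most [C0 * (4 * y * L2 * L3) ^ 3], which is at most
    [L1] by the choice of [d].  The lower bound on the support gives [ln |supp f|] at least
    [(L1 / L2) ^ (1 / 3)], which exceeds [C0 * 2 ^ e].  If [y < 2], there is no such [e], but
    then the trivial bound [1 <= wiener_norm f] is enough. *)
Lemma wiener_asymptotic : exists2 c : R, 0 < c & forall p (f : 'F_p -> complex R) (t : R),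
  prime p -> admissible f -> t = p%:R / #|supp f|%:R -> expR (expR (expR 1)) <= t ->
  c * ln t `^ (1 / 3) / (ln (ln t) * ln (ln (ln t))) <= wiener_norm f.
Proof.
have [C0 C0_gt0 bound] := wiener_lower_bound.
have C1 : 1 <= C0%:R :> R by rewrite ler1n.
have C0R : 0 < C0%:R :> R by lra.
pose d : R := (64 * C0%:R)^-1.
have d0 : 0 < d by rewrite invr_gt0; lra.
have dC : d * (64 * C0%:R) = 1 by rewrite mulVf //; lra.
exists (d / 2); first by rewrite divr_gt0.
move=> p f t p_pr [f1 hS _] tE t_large.
have [t0 L1e L2e L3_1] := iterated_ln_ge1 t_large.
set L1 := ln t in L1e L2e L3_1 *; set L2 := ln L1 in L2e L3_1 *; set L3 := ln L2 in L3_1 *.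
have e2 : 2 <= expR 1 :> R by apply: le_trans (expR_ge1Dx _).
have L2_2 : 2 <= L2 by apply: le_trans L2e.
have L2_0 : 0 < L2 by lra.
have L2_1 : 1 <= L2 by lra.
have L3_0 : 0 < L3 by lra.
have L1_0 : 0 < L1 by apply: lt_le_trans L1e; apply: expR_gt0.
have [s0|s_gt0] := posnP #|supp f|; first by move: t0; rewrite tE s0 invr0 mulr0 ltxx.
set s := #|supp f| in hS s_gt0 tE *.
have sR : 1 <= s%:R :> R by rewrite ler1n.
have pE : p%:R = t * s%:R by rewrite tE divfK //; lra.
have W1 : 1 <= wiener_norm f.
  have [x xS] : exists x, x \in supp f by apply/set0Pn; rewrite -card_gt0.
  by apply: le_trans (f1 x xS) _; apply: cabs_le_wiener.
set r := L1 `^ (1 / 3).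
have r3 : r ^+ 3 = L1 by apply: cube_root; apply: ltW.
have r0 : 0 < r by apply: powR_gt0.
pose y := d * r / (L2 * L3).
have LL : 0 < L2 * L3 by apply: mulr_gt0.
have L2L3 : 1 <= L2 * L3 by apply: mulr_ege1.
have d1 : d <= 1 by rewrite invf_le1; lra.
have -> : d / 2 * r / (L2 * L3) = y / 2 by rewrite /y; field; lra.
have y0 : 0 < y by apply: divr_gt0 => //; apply: mulr_gt0.
have yE : y * (L2 * L3) = d * r by rewrite /y divfK //; lra.
have [y2|y2] := ltP y 2; first by lra.
have /andP[my ym] := truncn_itv (ltW y0); set m := Num.truncn y in my ym.
have m2 : (2 <= m)%N by rewrite -ltnS -(ltr_nat R); apply: le_lt_trans ym.
have m0 : (0 < m)%N by apply: ltnW.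
have /andP[em me] := trunc_log_bounds (isT : (1 < 2)%N) m0; set e := trunc_log 2 m in em me.
have e_gt0 : (0 < e)%N by rewrite lt0n; apply/eqP => e0; move: me; rewrite e0 ltnNge m2.
have ey : 2 ^+ e <= y by apply: le_trans my; rewrite -natrX ler_nat.
have ye : y <= 2 * 2 ^+ e.
  by apply: ltW; apply: lt_le_trans ym _; rewrite -exprS -natrX ler_nat.
suff : (2 ^ e)%:R < wiener_norm f by rewrite natrX; apply: half_lt.
have yr : y <= r.
  have h1 : y <= y * (L2 * L3) by rewrite ler_peMr // ltW.
  by apply: le_trans h1 _; rewrite yE ler_piMl // ltW.
have eL2 : e%:R <= L2.
  have h1 := exponent_le_ln ey; have h2 : ln y <= ln r by rewrite ler_ln ?posrE.
  by rewrite /r ln_powR -/L2 in h2; apply: exponent_small h1 h2 (ltW L2_0).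
have VL3 : (up_log 2 e).+1%:R <= 4 * L3.
  have [e1|e1] := leqP e 1.
    have -> : e = 1%N by apply/eqP; rewrite eqn_leq e1.
    by rewrite up_log1 (le_trans L3_1) // ler_peMl ?(ltW L3_0) // ler1n.
  have h1 := up_log_gtn (isT : (1 < 2)%N) e1.
  have h2 : 2 ^+ (up_log 2 e).-1 <= L2 by apply: le_trans eL2; rewrite -natrX ler_nat ltnW.
  have h3 := exponent_le_ln h2; rewrite -/L3 in h3.
  apply: level_small h3 L3_1.
  by rewrite -natrD ler_nat; case: (up_log 2 e) => // k; rewrite addn2.
apply: bound => //.
- rewrite -(ler_nat R) natrX; apply: le_trans (pow2_le_expR _) _; apply: le_trans hS.
  rewrite ler_expR natrM natrX; apply: (@le_trans _ _ (C0%:R * y)); first by rewrite ler_pM2l.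
  have h1 : C0%:R * y <= r / L2.
    rewrite ler_pdivlMr //.
    have h2 : y * L2 <= d * r.
      by rewrite -yE mulrA; apply: ler_peMr => //; apply: mulr_ge0; apply: ltW.
    have h3 : C0%:R * y * L2 <= C0%:R * (d * r) by rewrite -mulrA ler_wpM2l.
    have h4 : C0%:R * (d * r) = d * (64 * C0%:R) * r / 64 by field.
    by apply: le_trans h3 _; rewrite h4 dC mul1r ler_pdivrMr // ler_peMr ?(ltW r0) // ler1n.
  apply: le_trans h1 _; set P := ln p%:R.
  have tp : t <= p%:R by rewrite pE ler_peMr // ltW.
  have LP : L1 <= P by rewrite ler_ln ?posrE ?(lt_le_trans t0).
  have h5 : L1 / L2 <= P / ln P.
    by apply: div_ln_mono LP; apply: le_trans L1e; rewrite ler_expR (le_trans _ e2) // ler1n.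
  have q0 : 0 <= P / ln P by apply: le_trans h5; apply: divr_ge0; apply: ltW.
  rewrite -(ler_pXn2r (n := 3)) ?nnegrE ?powR_ge0 ?divr_ge0 ?(ltW r0) ?(ltW L2_0) //.
  rewrite cube_root //; apply: le_trans h5; rewrite expr_div_n r3 ler_pM2l //.
  rewrite lef_pV2 ?posrE ?exprn_gt0 //.
  by apply: ler_eXnr.
rewrite -(ler_nat R) natrM pE mulrC -[#|supp f|]/s ler_wpM2r // natrX.
apply: le_trans (pow2_le_expR _) _; rewrite -[t in leRHS]lnK ?posrE // ler_expR -/L1.
have e8 : (8 ^ e = (2 ^ e) ^ 3)%N by rewrite -expnM mulnC expnM.
rewrite e8 -expnMn natrM natrX !natrM natrX.
have h1 : 2 ^+ e * (e%:R * (up_log 2 e).+1%:R) <= y * (L2 * (4 * L3)).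
  by rewrite ler_pM // ?mulr_ge0 ?exprn_ge0 // ler_pM.
apply: (@le_trans _ _ (C0%:R * (4 * d * r) ^+ 3)).
  rewrite ler_wpM2l // lerXn2r ?nnegrE ?mulr_ge0 ?exprn_ge0 // ?(ltW d0) ?(ltW r0) //.
  by apply: le_trans h1 _; rewrite -mulrA -yE le_eqVlt; apply/orP; left; apply/eqP; ring.
have -> : C0%:R * (4 * d * r) ^+ 3 = d * (64 * C0%:R) * d ^+ 2 * r ^+ 3 by ring.
by rewrite dC mul1r r3 ler_piMl ?(ltW L1_0) // expr_le1 ?(ltW d0).
Qed.

(** The exponent [omega] of the theorem turns the factor [1 / ln (ln (ln t))] into a power of [ln (ln t)]:
    with [L = ln (ln (ln t))], the power [(ln (ln t)) ^ - (ln L / L)] is [1 / L].  It tends to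
    zero as [L >= (ln L) ^ 2 / 4]. *)
Lemma ratio_cvg0 : (ln (ln (ln (ln t))) / ln (ln (ln t))) @[t --> +oo%R] --> (0 : R).
Proof.
apply/cvgrPdist_le => eps eps0.
have : \forall t \near +oo%R, expR (expR (expR (expR (1 + 4 / eps)))) <= t.
  by apply: nbhs_pinfty_ge; apply: num_real.
apply: filterS => t ht.
have l1 (x z : R) : expR x <= z -> x <= ln z.
  move=> h; have z0 : 0 < z by apply: lt_le_trans h; apply: expR_gt0.
  by rewrite -[x]expRK ler_ln ?posrE ?expR_gt0.
have := l1 _ _ (l1 _ _ (l1 _ _ ht)); set L := ln (ln (ln t)) => hL.
have L0 : 0 < L by apply: lt_le_trans hL; apply: expR_gt0.
have hM := l1 _ _ hL; set M := ln L in hM *.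
have q0 : 0 < 4 / eps by rewrite divr_gt0.
have M0 : 0 < M by lra.
have LE : M ^+ 2 / 4 <= L.
  have h := expR_ge1Dx (M / 2).
  have -> : L = expR (M / 2) ^+ 2 by rewrite -expRM_natr divfK // lnK.
  have h2 : (M / 2) ^+ 2 <= expR (M / 2) ^+ 2.
    by rewrite lerXn2r ?nnegrE ?expR_ge0 //; lra.
  by apply: le_trans h2; rewrite expr_div_n; lra.
rewrite sub0r normrN ger0_norm; last by rewrite divr_ge0 ?ltW.
rewrite ler_pdivrMr //; apply: le_trans (_ : eps * (M ^+ 2 / 4) <= _); last by rewrite ler_pM2l.
have h4 : 4 <= eps * M.
  have h5 : eps * (4 / eps) <= eps * M by rewrite ler_pM2l //; lra.
  by move: h5; rewrite mulrCA divff ?mulr1 //; lra.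
have := ler_wpM2r (ltW M0) h4; rewrite -mulrA -expr2; lra.
Qed.
End Final.

Theorem theorem2 (R : realType) :
  (forall (p : nat) (f : 'F_p -> complex R),
     prime p -> (3 <= p)%N -> admissible f ->
     max_abs f <= wiener_norm f)
  /\
  (exists (c t0 : R) (omega : R -> R),
     [/\ 0 < c, 3 <= t0, omega t @[t --> +oo%R] --> (0 : R)
       & forall (p : nat) (f : 'F_p -> complex R),
           prime p -> (3 <= p)%N -> admissible f ->
           forall t : R, t = p%:R / #|supp f|%:R -> t0 <= t ->
             c * ln t `^ (1 / 3) * ln (ln t) `^ (- 1 - omega t)
               <= wiener_norm f]).
Proof.
split=> [p f p_pr _ _|]; first exact: max_le_wiener.
have [c c0 bound] := wiener_asymptotic R.
exists c, (expR (expR (expR 1))), (fun t => ln (ln (ln (ln t))) / ln (ln (ln t))).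
split => //; [| exact: ratio_cvg0 |].
  have h1 := expR_ge1Dx (1 : R); have h2 := expR_ge1Dx (expR 1 : R).
  have h3 := expR_ge1Dx (expR (expR 1) : R); lra.
move=> p f p_pr _ adm t tE t_large; apply: le_trans (bound p f t p_pr adm tE t_large).
have [_ _ L2e L3_1] := iterated_ln_ge1 t_large.
set L2 := ln (ln t) in L2e L3_1 *; set L3 := ln L2 in L3_1 *.
have L2_0 : 0 < L2 by apply: lt_le_trans L2e; apply: expR_gt0.
have L3_0 : 0 < L3 by lra.
have -> : L2 `^ (-1 - ln L3 / L3) = (L2 * L3)^-1; last by [].
rewrite /powR gt_eqF // -/L3 mulrBl divfK ?gt_eqF // mulN1r expRD !expRN.
by rewrite !lnK ?posrE // invfM.
Qed.
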